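(* Let $n\ge2$, let $K\subset(0,\infty)$ be compact, let $\mathsf A$ be a compact metric space, and let $L:K\times\mathsf A\to[0,\infty)$ be bounded and continuous. For an action-valued POVM $D$ on $\mathcal H^{\otimes n}$ with outcomes in $\mathsf A$ put $$R_{z,N}(D):=\int_{\mathsf A}L(N,a)\operatorname{Tr}[\rho_{z,N}^{\otimes n}D(da)],\qquad z\in\mathbb C,\ N\in K.$$ Then $$\inf_D\sup_{z\in\mathbb C,\,N\in K}R_{z,N}(D)=\inf_{D\in\mathfrak M_{\mathrm{inv}}^{(n)}}\sup_{z\in\mathbb C,\,N\in K}R_{z,N}(D)=\inf_{D\in\mathfrak M_{\mathrm{inv}}^{(n)}}\sup_{N\in K}R_{0,N}(D).$$ Further, for every probability measure $\Pi$ supported on $K$, $$\inf_D\sup_{z\in\mathbb C}\int_KR_{z,N}(D)\,\Pi(dN)=\inf_{D\in\mathfrak M_{\mathrm{inv}}^{(n)}}\int_KR_{0,N}(D)\,\Pi(dN).$$ Here $\inf_D$ is over all action-valued POVMs on $\mathcal H^{\otimes n}$ with outcomes in $\mathsf A$, and $\inf_{D\in\mathfrak M_{\mathrm{inv}}^{(n)}}$ is over those that are collective-displacement invariant.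
   Context: $\mathcal H=L^2(\mathbb R)$ with number (Hermite) basis $\{|k\rangle\}_{k\ge0}$, annihilation operator $a$ ($a|k\rangle=\sqrt k|k-1\rangle$), displacement operators $D(z)=\exp(za^\dagger-\bar za)$, $z\in\mathbb C$. The thermal state with mean photon number $N>0$ is $\phi_N=\frac1{N+1}\sum_{k\ge0}\bigl(\frac N{N+1}\bigr)^k|k\rangle\langle k|$, and $\rho_{z,N}=D(z)\phi_ND(z)^\dagger$. An action-valued POVM is a map $D$ from the Borel sets of $\mathsf A$ to positive bounded operators on $\mathcal H^{\otimes n}$, countably additive in the weak operator topology, with $D(\mathsf A)=I$. It is collective-displacement invariant if $(D(w)^{\otimes n})^\dagger D(B)\,D(w)^{\otimes n}=D(B)$ for all $w\in\mathbb C$ and Borel $B\subseteq\mathsf A$ (here $D(w)$ denotes the displacement operator and $D(B)$ the POVM element). *)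

(* Defs.v *)
From HB Require Import structures.
From mathcomp Require Import all_boot all_order all_algebra.
From mathcomp Require Import all_classical all_reals all_analysis.
From mathcomp Require Import ring lra.
From mathcomp.real_closed Require Export complex.

Set Implicit Arguments.
Unset Strict Implicit.
Unset Printing Implicit Defensive.
Import Order.TTheory GRing.Theory Num.Theory numFieldNormedType.Exports.

Local Open Scope classical_set_scope.
Local Open Scope ring_scope.
Local Open Scope complex_scope.

(* Unconditional sum of an absolutely summable real, resp. complex, family. *)
Definition rsum (R : realType) (I : choiceType) (f : I -> R) : R :=
  fine (esum setT (EFin \o f)^\+ - esum setT (EFin \o f)^\-)%E.

Definition csum (R : realType) (I : choiceType) (f : I -> R[i]) : R[i] :=
  rsum (fun i => complex.Re (f i)) +i* rsum (fun i => complex.Im (f i)).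

Section ell2.
Context (R : realType) (I : choiceType).
Implicit Types x y : I -> R[i].

Definition square_summable : {pred I -> R[i]} :=
  fun x => `[< summable setT (fun i => (complex.Re `|x i| ^+ 2)%:E) >].

Record ell2 := Ell2 {
  ell2_val :> I -> R[i];
  _ : square_summable ell2_val }.

HB.instance Definition _ := [isSub for ell2_val].
HB.instance Definition _ := [Choice of ell2 by <:].

Let sq z : R := complex.Re (`|z : R[i]|) ^+ 2.

Let sqE z : sq z = complex.Re z ^+ 2 + complex.Im z ^+ 2.
Proof.
by rewrite /sq normc_def /= sqr_sqrtr// addr_ge0 ?sqr_ge0.
Qed.

Let sqM a z : sq (a * z) = sq a * sq z.
Proof. by rewrite !sqE; case: a z => [a b] [c d] /=; ring. Qed.

Let sq_ge0 z : 0 <= sq z. Proof. exact: sqr_ge0. Qed.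

Let sqD z w : sq (z + w) <= 2 * sq z + 2 * sq w.
Proof.
rewrite !sqE; case: z w => [a b] [c d] /=.
rewrite -subr_ge0 (_ : _ - _ = (a - c) ^+ 2 + (b - d) ^+ 2); last by ring.
by rewrite addr_ge0 ?sqr_ge0.
Qed.

Let summable_le (f g : I -> R) (k : nat) : (forall i, 0 <= f i) ->
  (forall i, f i <= k%:R * g i) ->
  summable setT (EFin \o g) -> summable setT (EFin \o f).
Proof.
move=> f0 fg gs.
suff h m : summable setT (EFin \o (fun i => m%:R * g i)).
  apply: le_lt_trans (h k); apply: le_esum => i _ /=.
  by rewrite lee_fin (ger0_norm (f0 i)) (le_trans (fg i))// ler_norm.
elim: m => [|m IH].
  rewrite /summable esum1 ?ltry// => i _ /=.
  by rewrite mul0r normr0.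
have := summableD gs IH; congr (summable _ _); apply/funext => i /=.
by rewrite -EFinD -natr1 mulrDl mul1r addrC.
Qed.

Let ell2_closed : submod_closed square_summable.
Proof.
split=> [|a x y]; rewrite ?unfold_in.
  apply/asboolP; rewrite /summable esum1 ?ltry// => i _.
  by rewrite normr0 expr0n /= normr0.
move=> /asboolP hx /asboolP hy; apply/asboolP.
have [k hk] : exists k : nat, sq a <= k%:R.
  by exists (Num.truncn (sq a)).+1; exact/ltW/truncnS_gt.
apply: (@summable_le (fun i => sq ((a *: x + y) i))
  (fun i => sq (x i) + sq (y i)) (2 * k + 2)%N) => [i|i|].
- exact: sq_ge0.
- apply: (le_trans (sqD _ _)); rewrite sqM natrD natrM.
  have := ler_wpM2r (sq_ge0 (x i)) hk; have := sq_ge0 (y i).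
  have := sq_ge0 (x i); have : 0 <= k%:R :> R by [].
  by nra.
- by have := summableD hx hy; congr (summable _ _); apply/funext.
Qed.

HB.instance Definition _ := GRing.isSubmodClosed.Build R[i] (I -> R[i])
  square_summable ell2_closed.

HB.instance Definition _ := [SubChoice_isSubZmodule of ell2 by <:].
HB.instance Definition _ := [SubZmodule_isSubLmodule of ell2 by <:].

End ell2.

Section operators.
Context (R : realType) (I : choiceType).
Local Notation H := (ell2 R I).
Implicit Types (u v : H) (T : H -> H).

(* The element of l^2 with coordinates x; the value 0 for a non-square-summable
   x is never met by the operators below. *)
Definition toell2 (x : I -> R[i]) : H := insubd 0 x.

Definition ket (i : I) : H := toell2 (fun j => (j == i)%:R).

(* Conjugate-linear in the first argument. *)
Definition inner u v : R[i] := csum (fun i => conjc (u i) * v i).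

Definition norm2 u : R := Num.sqrt (complex.Re (inner u u)).

Definition bounded_operator T : Prop :=
  linear T /\ exists M : R, forall u, norm2 (T u) <= M * norm2 u.

(* The order of R[i] makes 0 <= z mean that z is real and nonnegative. *)
Definition positive_operator T : Prop := forall u, 0 <= inner u (T u).

Definition op_of_matrix (M : I -> I -> R[i]) : H -> H :=
  fun u => toell2 (fun i => csum (fun j => M i j * u j)).

(* The unique S with <S u, v> = <u, T v>; it exists for every bounded T. *)
Definition adjoint T : H -> H :=
  xget (idfun : H -> H) [set S : H -> H | forall u v, inner (S u) v = inner u (T v)].

(* Meaningful for trace-class T, where it does not depend on the basis. *)
Definition trace T : R[i] := csum (fun i => inner (ket i) (T (ket i))).

End operators.

Section fock_space.
Context (R : realType).

(* L^2(R) in the coordinates of its Hermite basis: ket k is the number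
   state |k>. *)
Definition mode := ell2 R nat.

(* The n-fold Hilbert tensor power of mode, in the coordinates of its product
   basis |k_0> (x) ... (x) |k_(n-1)>. *)
Definition modes (n : nat) := ell2 R {ffun 'I_n -> nat}.

(* a|k> = sqrt k |k-1> and its adjoint a^+ |k> = sqrt (k+1) |k+1>, acting on
   coordinate sequences; both are unbounded and do not preserve l^2. *)
Definition annihilation (x : nat -> R[i]) : nat -> R[i] :=
  fun k => (Num.sqrt k.+1%:R)%:C * x k.+1.

Definition creation (x : nat -> R[i]) : nat -> R[i] :=
  fun k => if k is j.+1 then (Num.sqrt k%:R)%:C * x j else 0.

Definition displacement_generator (z : R[i]) (x : nat -> R[i]) : nat -> R[i] :=
  fun k => z * creation x k - conjc z * annihilation x k.

(* exp (z a^+ - conj(z) a). Number states are entire vectors of the generator G,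
   so the exponential series sum_j G^j |k> / j! converges in l^2 for each k and
   gives the columns of the unitary operator. *)
Definition displacement (z : R[i]) : mode -> mode :=
  op_of_matrix (fun m k =>
    csum (fun j : nat =>
      iter j (displacement_generator z) (ket R k) m / j`!%:R)).

Definition thermal (N : R) : mode -> mode :=
  fun u => toell2 (fun k => ((N + 1)^-1 * (N / (N + 1)) ^+ k)%:C * u k).

Definition displaced_thermal (z : R[i]) (N : R) : mode -> mode :=
  displacement z \o thermal N \o adjoint (displacement z).

(* <m| T^(x)n |k> = prod_i <m_i| T |k_i> on product basis vectors. *)
Definition tensor_power (n : nat) (T : mode -> mode) : modes n -> modes n :=
  op_of_matrix (fun m k : {ffun 'I_n -> nat} =>
    \prod_(i < n) inner (ket R (m i)) (T (ket R (k i)))).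

End fock_space.

Arguments tensor_power {R} n T.

(* Metric spaces with a distinguished point: the library's measurable types are
   pointed. *)
#[short(type="pmetricType")]
HB.structure Definition PMetric (K : numDomainType) :=
  { M of Metric K M & Pointed M }.

Definition borel_type (R : realType) (A : pmetricType R) :=
  g_sigma_algebraType (@open A).

Section povm.
Context (R : realType) (n : nat) (A : pmetricType R).
Local Notation H := (modes R n).
Local Notation B := (borel_type A).
Implicit Types D : set B -> H -> H.

(* The values of D outside the Borel sets are irrelevant. *)
Record is_povm D : Prop := {
  povm_bounded : forall E, measurable E -> bounded_operator (D E) ;
  povm_positive : forall E, measurable E -> positive_operator (D E) ;
  povm_sigma_additive : forall E : (set B)^nat,
    (forall k, measurable (E k)) -> trivIset setT E ->
    forall u v : H,
      series (fun k => inner u (D (E k) v)) @ \oo -->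
        (inner u (D (\bigcup_k E k) v) : R[i]^o) ;
  povm_total : D setT = idfun }.

Definition displacement_invariant D : Prop :=
  forall (w : R[i]) (E : set B), measurable E ->
    let W := tensor_power n (displacement w) in adjoint W \o D E \o W = D E.

Definition povms : set (set B -> H -> H) := [set D | is_povm D].

Definition invariant_povms : set (set B -> H -> H) :=
  [set D | is_povm D /\ displacement_invariant D].

Definition outcome_law (rho : H -> H) D : set B -> \bar R :=
  fun E => (complex.Re (trace (rho \o D E)))%:E.

Definition risk (L : R -> A -> R) D (z : R[i]) (N : R) : \bar R :=
  (\int[outcome_law (tensor_power n (displaced_thermal z N)) D]_a
     (L N a)%:E)%E.

End povm.

Arguments povms {R} n A.
Arguments invariant_povms {R} n A.

(* Main.v *)
(** Let m be a translation-invariant mean on bounded functions on the discrete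
    abelian group C; it exists because averages over boxes in finitely generated
    subgroups are almost invariant. Given a POVM D and a vector v,
    f |-> m_w (int f d<W_w v, D W_w v>), with W_w = D(w)^(x)n, is a positive
    functional on C(A), hence a Borel measure nu_v by Riesz-Markov. The linear
    relations that make v |-> <v, D(E) v> a quadratic form hold between measures,
    so they pass to integrals, to means and back to the nu_v: by polarization the
    nu_v are the laws <v, D'(E) v> of a POVM D', which is invariant because
    W_z W_w and W_(z+w) differ by a phase (Weyl relations).

    The state rho_(z,N)^(x)n is a mixture, with weights p_l(N), of the vectors
    W_z e_l, where e_l runs over the product number basis. Hence
    R_(z,N)(D) = sum_l int p_l(N) L(N, .) d<W_z e_l, D W_z e_l>, which for an
    invariant POVM does not depend on z. Every partial sum of the series of D' is
    a mean over w of partial sums for D at W_w e_l, so it is at most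
    sup_w R_(w,N)(D). For the Bayes risk the continuous function p_l(N) L(N, .) is
    replaced by its average over Pi, which is still continuous in the action. *)

Require Import Defs.
From HB Require Import structures.
From mathcomp Require Import all_boot all_order all_algebra.
From mathcomp Require Import all_classical all_reals all_analysis.
From mathcomp Require Import finmap measurable_realfun.
From mathcomp Require Import ring lra.
Set Implicit Arguments.
Unset Strict Implicit.
Unset Printing Implicit Defensive.
Import Order.TTheory GRing.Theory Num.Theory numFieldNormedType.Exports.
Local Open Scope classical_set_scope.
Local Open Scope ring_scope.
Local Open Scope complex_scope.

(** * Unconditional sums of complex families *)

(** A mean is only finitely additive, and this shapes the proof. The mean over w of <W_w v, D(E) W_w
    v> need not be countably additive in E, so it is taken on integrals of continuous functions, and
    Riesz-Markov on the compact space A restores countable additivity; hence losses must be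
    continuous in the action. Nor does a mean commute with infinite sums or with the integral over
    Pi: risks are compared through partial sums of nonnegative series, and the integral over Pi is
    moved inside by Tonelli beforehand. In return w ranges over a discrete group, so no regularity
    in w has to be checked, and the absence of a finite invariant measure on C is harmless.

    The displacement is the exponential series of an unbounded generator on number states.
    Everything about it is read from matrix entries: the commutators of a and a^+ with the generator
    give a row and a column recursion that determine the matrix from its vacuum entry, and
    summability, adjoints and Weyl relations are inductions along these recursions. *)

Section complex_facts.
Context (R : realType).
Implicit Types z w : R[i].
Local Notation Re := (@complex.Re R).
Local Notation Im := (@complex.Im R).

Lemma ReD z w : Re (z + w) = Re z + Re w. Proof. by case: z w => [? ?] []. Qed.
Lemma ImD z w : Im (z + w) = Im z + Im w. Proof. by case: z w => [? ?] []. Qed.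

Lemma ReB z w : Re (z - w) = Re z - Re w. Proof. by case: z w => [? ?] []. Qed.
Lemma ImB z w : Im (z - w) = Im z - Im w. Proof. by case: z w => [? ?] []. Qed.
Lemma ReM z w : Re (z * w) = Re z * Re w - Im z * Im w.
Proof. by case: z w => [? ?] []. Qed.
Lemma ImM z w : Im (z * w) = Re z * Im w + Im z * Re w.
Proof. by case: z w => [? ?] []. Qed.

Lemma Re_sum (J : Type) (r : seq J) (P : pred J) (f : J -> R[i]) :
  Re (\sum_(j <- r | P j) f j) = \sum_(j <- r | P j) Re (f j).
Proof. exact: (big_morph Re ReD). Qed.

Lemma Im_sum (J : Type) (r : seq J) (P : pred J) (f : J -> R[i]) :
  Im (\sum_(j <- r | P j) f j) = \sum_(j <- r | P j) Im (f j).
Proof. exact: (big_morph Im ImD). Qed.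

Lemma normcE2 z : (Re `|z|) ^+ 2 = Re z ^+ 2 + Im z ^+ 2.
Proof. by rewrite normc_def /= sqr_sqrtr ?addr_ge0 ?sqr_ge0. Qed.

Lemma ReC_norm z : (Re `|z|)%:C = `|z|.
Proof. by rewrite normc_def. Qed.

Lemma Re_norm_ge0 z : 0 <= Re `|z|.
Proof. by rewrite -ler0c ReC_norm. Qed.

Lemma Re_normM z w : Re `|z * w| = Re `|z| * Re `|w|.
Proof. by apply: complexI; rewrite rmorphM/= !ReC_norm normrM. Qed.

Lemma Re_normD z w : Re `|z + w| <= Re `|z| + Re `|w|.
Proof. by rewrite -lecR rmorphD/= !ReC_norm ler_normD. Qed.

Lemma Re_norm0_eq0 z : Re `|z| = 0 -> z = 0.
Proof. by move=> h; apply/normr0_eq0; rewrite -ReC_norm h. Qed.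

Lemma Re_norm_real (x : R) : Re `|x%:C| = `|x|.
Proof. by rewrite normc_def /= expr0n addr0 sqrtr_sqr. Qed.

Lemma norm_Re_le z : `|Re z| <= Re `|z|.
Proof. by rewrite -lecR ReC_norm normc_ge_Re. Qed.

Lemma norm_Im_le z : `|Im z| <= Re `|z|.
Proof.
rewrite -ler_sqr ?nnegrE ?Re_norm_ge0//.
by rewrite real_normK ?num_real// normcE2 lerDr sqr_ge0.
Qed.

Lemma Re_norm_le z : Re `|z| <= `|Re z| + `|Im z|.
Proof.
rewrite -ler_sqr ?nnegrE ?Re_norm_ge0 ?addr_ge0//.
rewrite sqrrD !real_normK ?num_real// normcE2.
have := normr_ge0 (Re z); have := normr_ge0 (Im z); nra.
Qed.

(** The bridge by which limits in [R[i]], whose norm is itself [R[i]]-valued, are reduced to real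
    ones. *)
Lemma cvg_complexP (T : Type) (F : set_system T) {FF : Filter F} (f : T -> R[i])
    (s : R[i]) :
  ((f : T -> R[i]^o) @ F --> (s : R[i]^o)) <->
  ((Re \o f) @ F --> Re s) /\ ((Im \o f) @ F --> Im s).
Proof.
split=> [/cvgrPdist_lt /= h|[/cvgrPdist_lt /= h1 /cvgrPdist_lt /= h2]].
  split; apply/cvgrPdist_lt => e e0; have := h e%:C; rewrite ltcR => /(_ e0);
    apply: filterS => t; rewrite -ReC_norm ltcR; apply: le_lt_trans.
    by rewrite /= -ReB norm_Re_le.
  by rewrite /= -ImB norm_Im_le.
apply/cvgrPdist_lt => e e0 /=.
have e20 : 0 < Re e / 2.
  by rewrite divr_gt0//; move: e0; rewrite ltcE => /andP[].
have -> : e = (Re e)%:C.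
  by case: e e0 {e20} => a b; rewrite ltcE /= => /andP[/eqP -> _].
near=> t.
rewrite -ReC_norm ltcR (le_lt_trans (Re_norm_le _))// ReB ImB.
rewrite [ltRHS]splitr ltrD//.
- by near: t; exact: h1.
- by near: t; exact: h2.
Unshelve. all: by end_near. Qed.

End complex_facts.

Section fset_nbhs.
Context (I : choiceType).

(** Finite subsets directed by inclusion, as a filter: convergence along it is unconditional
    summation. *)
Definition fset_nbhs : set_system {fset I} :=
  filter_from setT (fun F0 => [set F | (F0 `<=` F)%fset]).

Global Instance fset_nbhs_filter : ProperFilter fset_nbhs.
Proof.
apply: filter_from_proper; last by move=> F _; exists F => /=.
apply: filter_from_filter; first by exists fset0.
move=> F G _ _; exists (F `|` G)%fset => //= H.
by rewrite /= fsubUset => /andP[].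
Qed.

Lemma fset_sum_incl (V : nmodType) (F0 F : {fset I}) (f : I -> V) :
  (F0 `<=` F)%fset ->
  \sum_(i <- F) f i = \sum_(i <- F0) f i + \sum_(i <- (F `\` F0)%fset) f i.
Proof.
move=> /fsubsetP F0F; rewrite (big_fsetID _ (mem F0))/=; congr (_ + _).
  apply: eq_fbigl => i; rewrite !inE/=.
  by case: (boolP (i \in F0)) => [/F0F ->|]; rewrite ?andbF.
by apply: eq_fbigl => i; rewrite !inE/= andbC.
Qed.

Lemma fset_nbhs_ge (F0 : {fset I}) : \forall F \near fset_nbhs, (F0 `<=` F)%fset.
Proof. by exists F0. Qed.

End fset_nbhs.

Section real_sums.
Context (R : realType) (I : choiceType).
Implicit Types f : I -> R.

Lemma fsbig_fset (f : I -> \bar R) (F : {fset I}) :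
  (\sum_(i \in [set` F]) f i = \sum_(i <- F) f i)%E.
Proof. by rewrite fsbig_finite//= set_fsetK. Qed.

Lemma esum_fset_ge f (F : {fset I}) :
  ((\sum_(i <- F) f i)%:E <= esum setT (EFin \o f))%E.
Proof.
apply: ereal_sup_ubound; exists [set` F]; first by split.
by rewrite fsbig_fset sumEFin.
Qed.

Lemma esum_fset_le f (M : \bar R) :
  (forall F : {fset I}, (\sum_(i <- F) f i)%:E <= M)%E ->
  (esum setT (EFin \o f) <= M)%E.
Proof.
move=> h; apply: ge_ereal_sup => _ [X [finX _] <-].
have /finite_fsetP[F ->] := finX.
by rewrite fsbig_fset sumEFin.
Qed.

Lemma esum_ge0_cvg f (M : R) : (forall i, 0 <= f i) ->
  (forall F : {fset I}, \sum_(i <- F) f i <= M) ->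
  esum setT (EFin \o f) \is a fin_num /\
  (fun F : {fset I} => \sum_(i <- F) f i) @ (@fset_nbhs I) -->
    fine (esum setT (EFin \o f)).
Proof.
move=> f0 fM.
have fin : esum setT (EFin \o f) \is a fin_num.
  rewrite ge0_fin_numE; last by apply: esum_ge0 => i _; rewrite lee_fin.
  by rewrite (le_lt_trans (esum_fset_le (M := M%:E) _)) ?ltry// => F; rewrite lee_fin.
split => //; apply/cvgrPdist_lt => e e0 /=.
have [F0 hF0] : exists F0 : {fset I},
    fine (esum setT (EFin \o f)) - e < \sum_(i <- F0) f i.
  apply/not_existsP => h.
  have : (esum setT (EFin \o f) <= (fine (esum setT (EFin \o f)) - e)%:E)%E.
    by apply: esum_fset_le => F; rewrite lee_fin leNgt; apply/negP/h.
  by rewrite -{1}(fineK fin) lee_fin; lra.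
near=> F.
have h1 : \sum_(i <- F) f i <= fine (esum setT (EFin \o f)).
  by rewrite -lee_fin fineK// esum_fset_ge.
have h2 : \sum_(i <- F0) f i <= \sum_(i <- F) f i.
  rewrite (@fset_sum_incl _ _ F0 F); last by near: F; exists F0.
  by rewrite lerDl sumr_ge0.
by rewrite ger0_norm; lra.
Unshelve. all: by end_near. Qed.

End real_sums.

Section complex_sums.
Context (R : realType).
Local Notation C := R[i].
Local Notation Re := (@complex.Re R).
Local Notation Im := (@complex.Im R).

Section one_index.
Context (I : choiceType).
Implicit Types f g : I -> C.

Definition fset_sum f : {fset I} -> C^o := fun F => \sum_(i <- F) f i.

(** The bound lies in [R[i]]; comparison with the empty sum forces it to be real, as [real_bound]
    extracts. *)
Definition csummable f : Prop :=
  exists M : C, forall F : {fset I}, \sum_(i <- F) `|f i| <= M.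

Definition has_csum f (s : C) : Prop :=
  csummable f /\ (fset_sum f @ (@fset_nbhs I) --> (s : C^o)).

Lemma real_bound (M x : C) : x <= M -> 0 <= x -> M = (Re M)%:C.
Proof.
by case: M x => a b [c d]; rewrite !lecE /= => /andP[/eqP-> _] /andP[/eqP-> _].
Qed.

Lemma csummable_le (M : R) f :
  (forall F : {fset I}, \sum_(i <- F) Re `|f i| <= M) -> csummable f.
Proof.
move=> h; exists M%:C => F.
rewrite (eq_bigr (fun i => (Re `|f i|)%:C)); last by move=> *; rewrite ReC_norm.
by rewrite -rmorph_sum lecR.
Qed.

Lemma csummableP f : csummable f ->
  exists2 M : R, 0 <= M & forall F : {fset I}, \sum_(i <- F) Re `|f i| <= M.
Proof.
move=> [M fM].
have ME : M = (Re M)%:C.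
  by apply: (real_bound (fM fset0)); rewrite big_seq_fset0.
exists (Re M) => [|F].
  by have := fM fset0; rewrite big_seq_fset0 ME ler0c.
by rewrite -Re_sum; have := fM F; rewrite lecE => /andP[].
Qed.

Lemma csummable_dom f g : (forall i, `|f i| <= `|g i|) ->
  csummable g -> csummable f.
Proof.
by move=> fg [M gM]; exists M => F; apply: le_trans (gM F); exact: ler_sum.
Qed.

Lemma rsum_cvg (f : I -> R) (M : R) :
  (forall F : {fset I}, \sum_(i <- F) `|f i| <= M) ->
  (fun F : {fset I} => \sum_(i <- F) f i) @ (@fset_nbhs I) --> rsum f.
Proof.
move=> fM.
pose p i := Num.max (f i) 0; pose q i := Num.max (- f i) 0.
have pE : (EFin \o f)^\+%E = EFin \o p.
  by apply/funext => i; rewrite funeposE /= EFin_max.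
have qE : (EFin \o f)^\-%E = EFin \o q.
  by apply/funext => i; rewrite funenegE /= EFin_max.
have p0 i : 0 <= p i by rewrite le_max lexx orbT.
have q0 i : 0 <= q i by rewrite le_max lexx orbT.
have pf i : p i <= `|f i| by rewrite ge_max ler_norm normr_ge0.
have qf i : q i <= `|f i| by rewrite ge_max -normrN ler_norm normr_ge0.
have [pfin pc] := @esum_ge0_cvg _ _ p M p0
  (fun F => le_trans (ler_sum _ (fun i _ => pf i)) (fM F)).
have [qfin qc] := @esum_ge0_cvg _ _ q M q0
  (fun F => le_trans (ler_sum _ (fun i _ => qf i)) (fM F)).
rewrite /rsum pE qE fineB//.
have -> : (fun F : {fset I} => \sum_(i <- F) f i) =
    (fun F : {fset I} => \sum_(i <- F) p i) \- (fun F : {fset I} => \sum_(i <- F) q i).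
  apply/funext => F /=; rewrite -sumrB; apply: eq_bigr => i _.
  by rewrite /p /q /Num.max; case: ifP; case: ifP; lra.
exact: cvgB.
Qed.

Lemma csummable_has_csum f : csummable f -> has_csum f (csum f).
Proof.
move=> sf; split => //; have [M _ fM] := csummableP sf.
apply/cvg_complexP; split.
  have -> : Re \o fset_sum f = fun F => \sum_(i <- F) Re (f i).
    by apply/funext => F; rewrite /= /fset_sum Re_sum.
  apply: (@rsum_cvg _ M) => F; apply: le_trans (fM F).
  by apply: ler_sum => i _; exact: norm_Re_le.
have -> : Im \o fset_sum f = fun F => \sum_(i <- F) Im (f i).
  by apply/funext => F; rewrite /= /fset_sum Im_sum.
apply: (@rsum_cvg _ M) => F; apply: le_trans (fM F).
by apply: ler_sum => i _; exact: norm_Im_le.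
Qed.

Lemma cvgC_unique (T : Type) (F : set_system T) {FF : ProperFilter F}
  (f : T -> C^o) (s t : C^o) : f @ F --> s -> f @ F --> t -> s = t.
Proof. exact: (cvg_unique (@norm_hausdorff _ _)). Qed.

Lemma has_csum_unique f s t : has_csum f s -> has_csum f t -> s = t.
Proof. by move=> [_ fs] [_]; exact: cvgC_unique. Qed.

Lemma has_csumE f s : has_csum f s -> csum f = s.
Proof.
by move=> fs; apply: has_csum_unique (fs); apply: csummable_has_csum; case: fs.
Qed.

Lemma eq_has_csum f g s : f =1 g -> has_csum f s -> has_csum g s.
Proof. by move=> /funext ->. Qed.

Lemma has_csumD f g s t : has_csum f s -> has_csum g t ->
  has_csum (fun i => f i + g i) (s + t).
Proof.
move=> [[M fM] fs] [[N gN] gt]; split.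
  exists (M + N) => F; apply: le_trans (lerD (fM F) (gN F)).
  by rewrite -big_split; apply: ler_sum => i _; exact: ler_normD.
have -> : fset_sum (fun i => f i + g i) = (fun F => fset_sum f F + fset_sum g F).
  by apply/funext => F; exact: big_split.
move: fs gt => /cvg_complexP[f1 f2] /cvg_complexP[g1 g2]; apply/cvg_complexP; split.
  rewrite ReD; apply: cvg_trans (cvgD f1 g1); apply: near_eq_cvg; near=> F.
  by rewrite /= ReD.
rewrite ImD; apply: cvg_trans (cvgD f2 g2); apply: near_eq_cvg; near=> F.
by rewrite /= ImD.
Unshelve. all: by end_near. Qed.

Lemma has_csumZ f c s : has_csum f s -> has_csum (fun i => c * f i) (c * s).
Proof.
move=> [[M fM] fs]; split.
  exists (`|c| * M) => F.
  rewrite (eq_bigr (fun i => `|c| * `|f i|)); last by move=> *; rewrite normrM.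
  by rewrite -mulr_sumr ler_wpM2l.
have -> : fset_sum (fun i => c * f i) = (fun F => c * fset_sum f F).
  by apply/funext => F; rewrite /fset_sum mulr_sumr.
have cM (x y : R) (g : {fset I} -> R) : g @ (@fset_nbhs I) --> y ->
    (fun F => x * g F) @ (@fset_nbhs I) --> x * y.
  by move=> gy; apply: cvgM => //; exact: cvg_cst.
move: fs => /cvg_complexP[f1 f2]; apply/cvg_complexP; split.
  rewrite ReM; apply: cvg_trans; last first.
    by apply: (cvgB (cM (Re c) _ _ f1) (cM (Im c) _ _ f2)).
  by apply: near_eq_cvg; near=> F; rewrite /= ReM.
rewrite ImM; apply: cvg_trans; last first.
  by apply: (cvgD (cM (Re c) _ _ f2) (cM (Im c) _ _ f1)).
by apply: near_eq_cvg; near=> F; rewrite /= ImM.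
Unshelve. all: by end_near. Qed.

Lemma has_csumN f s : has_csum f s -> has_csum (fun i => - f i) (- s).
Proof.
move=> h; rewrite -mulN1r; apply: eq_has_csum (has_csumZ (-1) h) => i.
by rewrite mulN1r.
Qed.

Lemma has_csumB f g s t : has_csum f s -> has_csum g t ->
  has_csum (fun i => f i - g i) (s - t).
Proof. by move=> fs gt; exact: has_csumD fs (has_csumN gt). Qed.

Lemma has_csum0 : has_csum (fun=> 0) 0.
Proof.
split; first by exists 0 => F; rewrite big1// => i _; rewrite normr0.
have -> : fset_sum (fun=> 0) = cst 0 by apply/funext => F; rewrite /fset_sum big1.
exact: cvg_cst.
Qed.

Lemma has_csum_sum (J : Type) (r : seq J) (f : J -> I -> C) (s : J -> C) :
  (forall j, has_csum (f j) (s j)) ->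
  has_csum (fun i => \sum_(j <- r) f j i) (\sum_(j <- r) s j).
Proof.
move=> h; elim: r => [|j r IH].
  by rewrite big_nil; apply: eq_has_csum has_csum0 => i; rewrite big_nil.
rewrite big_cons; apply: eq_has_csum (has_csumD (h j) IH) => i.
by rewrite big_cons.
Qed.

Lemma has_csum_fset f (F0 : {fset I}) : (forall i, i \notin F0 -> f i = 0) ->
  has_csum f (\sum_(i <- F0) f i).
Proof.
move=> f0.
have E (V : nmodType) (g : I -> V) (F : {fset I}) :
    (forall i, i \notin F0 -> g i = 0) -> (F0 `<=` F)%fset ->
    \sum_(i <- F) g i = \sum_(i <- F0) g i.
  move=> g0 F0F; rewrite (fset_sum_incl _ F0F) [X in _ + X]big1_seq ?addr0//.
  by move=> i /=; rewrite inE => /andP[/g0].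
split.
  exists (\sum_(i <- F0) `|f i|) => F.
  rewrite -(E _ _ (F `|` F0)%fset) ?fsubsetUr//.
    by rewrite (@fset_sum_incl _ _ F) ?fsubsetUl// lerDl sumr_ge0.
  by move=> i /f0 ->; rewrite normr0.
apply: cvg_near_cst; near=> F; rewrite /fset_sum E//.
by near: F; exact: fset_nbhs_ge.
Unshelve. all: by end_near. Qed.

Lemma has_csum1 f i0 : (forall i, i != i0 -> f i = 0) -> has_csum f (f i0).
Proof.
move=> h; have := @has_csum_fset f [fset i0]%fset.
by rewrite big_seq_fset1; apply=> i; rewrite inE => /h.
Qed.

Lemma has_csum_normBle f s c (M : C) : has_csum f s ->
  (\forall F \near (@fset_nbhs I), `|fset_sum f F - c| <= M) -> `|s - c| <= M.
Proof.
move=> [_ /cvg_complexP[f1 f2]] fM.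
have MR : M = (Re M)%:C.
  by have [F /= hF] := filter_ex fM; exact: (real_bound hF).
have fs : ((fun F => fset_sum f F - c) : _ -> C^o) @ (@fset_nbhs I) --> (s - c : C^o).
  apply/cvg_complexP; split.
    rewrite ReB; apply: cvg_trans (cvgB f1 (cvg_cst (Re c))); apply: near_eq_cvg; near=> F.
    by rewrite /= fctE; exact: (esym (ReB _ _)).
  rewrite ImB; apply: cvg_trans (cvgB f2 (cvg_cst (Im c))); apply: near_eq_cvg; near=> F.
  by rewrite /= fctE; exact: (esym (ImB _ _)).
have /cvg_complexP[h _] : (fun F => `|fset_sum f F - c| : C^o) @ (@fset_nbhs I) -->
    ((Re `|s - c|)%:C : C^o).
  by rewrite ReC_norm; exact: (@cvg_norm _ _ _ _ _ _ _ fs).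
rewrite -ReC_norm MR lecR.
have <- : lim ((Re \o (fun F => `|fset_sum f F - c|)) @ (@fset_nbhs I)) = Re `|s - c|.
  exact/cvg_lim.
apply: limr_le; first by apply/cvg_ex; eexists; exact: h.
by apply: filterS fM => F; rewrite MR -{1}ReC_norm lecR.
Unshelve. all: by end_near. Qed.

Lemma has_csum_le f s (M : C) : has_csum f s ->
  (forall F : {fset I}, \sum_(i <- F) `|f i| <= M) -> `|s| <= M.
Proof.
move=> h fM; rewrite -[s]subr0; apply: (has_csum_normBle h); near=> F.
rewrite subr0; exact: le_trans (ler_norm_sum _ _ _) (fM F).
Unshelve. all: by end_near. Qed.

Lemma has_csum_ge0 f s : has_csum f s -> (forall i, 0 <= f i) -> 0 <= s.
Proof.
move=> [_ /cvg_complexP[h1 h2]] f0; rewrite lecE /=; apply/andP; split.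
  apply/eqP; apply: cvg_unique h2 _ => //; apply: cvg_near_cst; near=> F.
  by rewrite /= /fset_sum Im_sum big1// => i _; exact: ger0_Im.
have -> : Re s = lim ((Re \o fset_sum f) @ (@fset_nbhs I)) by apply/esym/cvg_lim.
apply: limr_ge; first by apply/cvg_ex; eexists; exact: h1.
near=> F; rewrite /= /fset_sum Re_sum sumr_ge0// => i _.
by have := f0 i; rewrite lecE => /andP[].
Unshelve. all: by end_near. Qed.

Lemma csummable_esum (p : I -> R) s : (forall i, 0 <= p i) ->
  has_csum (fun i => (p i)%:C) s -> esum setT (EFin \o p) = (Re s)%:E.
Proof.
move=> p0 [/csummableP[M _ pM] /cvg_complexP[h _]].
have pM' (F : {fset I}) : \sum_(i <- F) p i <= M.
  apply: le_trans (pM F); apply: ler_sum => i _.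
  by rewrite Re_norm_real ler_norm.
have [fin c] := esum_ge0_cvg p0 pM'.
rewrite -(fineK fin); congr EFin; apply: cvg_unique c _ => //.
apply: cvg_trans h; apply: near_eq_cvg; near=> F.
by rewrite /= /fset_sum Re_sum.
Unshelve. all: by end_near. Qed.

Lemma has_csum_ge_fset f s (F0 : {fset I}) : has_csum f s ->
  (forall i, 0 <= f i) -> \sum_(i <- F0) f i <= s.
Proof.
move=> hs f0; rewrite -subr_ge0.
have := has_csum_fset (f := fun i => if i \in F0 then f i else 0) (F0 := F0).
have -> : \sum_(i <- F0) (if i \in F0 then f i else 0) = \sum_(i <- F0) f i.
  by rewrite big_seq_cond [RHS]big_seq_cond; apply: eq_bigr => i /andP[-> _].
move=> h.
apply: (has_csum_ge0 (has_csumB hs (h _))) => i /=; first by move=> /negbTE ->.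
by case: ifP; rewrite ?subrr ?subr0.
Qed.

End one_index.

Section reindexing.
Context (I J : choiceType).

(** Serves every change of index below: shifts, swaps, even indices, tuples, and the enumeration of
    the product basis. *)
Lemma has_csum_inj (h : I -> J) (f : J -> C) (s : C) : injective h ->
  (forall j, (forall i, h i <> j) -> f j = 0) ->
  has_csum (f \o h) s <-> has_csum f s.
Proof.
move=> inj_h f0.
have im (V : nmodType) (g : J -> V) (F : {fset I}) :
    \sum_(j <- [fset h i | i in F]%fset) g j = \sum_(i <- F) g (h i).
  by rewrite big_imfset//= => x y _ _; exact: inj_h.
(* [F] is the preimage of [G], obtained from a partial inverse of [h]. Quantifying over [g] lets the
   same [F] serve both [f] and its absolute values. *)
have pre (G : {fset J}) : exists F : {fset I},
    (forall i, i \in F <-> h i \in G) /\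
    forall (V : nmodType) (g : J -> V), (forall j, f j = 0 -> g j = 0) ->
     \sum_(j <- G) g j = \sum_(i <- F) g (h i).
  have [hinv hK] : exists hinv : J -> option I, forall i j, hinv j = Some i <-> h i = j.
    exists (fun j => if pselect (exists i, h i = j) is left e then Some (projT1 (cid e)) else None).
    move=> i j; case: pselect => [e|ne].
      case: cid => i' /= <-; split=> [[->]//|/inj_h ->//].
    by split=> // hi; case: ne; exists i.
  pose s' := pmap hinv (enum_fset G).
  have F_in i : i \in [fset i in s']%fset <-> h i \in G.
    rewrite !inE /s' mem_pmap; split.
      by move=> /mapP[j jG /esym/hK ->].
    by move=> iG; apply/mapP; exists (h i) => //; apply/esym/hK.
  exists [fset i in s']%fset; split => // V g g0.
  rewrite -im; apply/esym/big_fset_incl.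
    by apply/fsubsetP => j /imfsetP[i /= /F_in iG ->].
  move=> j jG jn; apply: g0; apply: f0 => i hij; move/negP: jn; apply.
  by apply/imfsetP; exists i => //=; apply/F_in; rewrite hij.
have preC := fun G => cid (pre G).
have direct t : has_csum (f \o h) t -> has_csum f t.
  move=> [[M fM] fs]; split.
    exists M => G; have [F [_ E]] := pre G.
    by rewrite (E C (fun j => `|f j|)) => [|j ->]; rewrite ?normr0//; exact: fM.
  pose p G := projT1 (preC G).
  have pE G : fset_sum f G = fset_sum (f \o h) (p G).
    by have [_ E] := projT2 (preC G); exact: E.
  have -> : fset_sum f = fset_sum (f \o h) \o p by apply/funext.
  apply: cvg_comp fs => A -[F0 _ /= F0A]; exists [fset h i | i in F0]%fset => //= G hG.
  apply: F0A => /=; apply/fsubsetP => i iF0; have [inF _] := projT2 (preC G).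
  by apply/inF; apply: (fsubsetP hG); apply/imfsetP; exists i.
(* Conversely, [f \o h] has some sum; [direct] makes it a sum of [f], and uniqueness identifies it
   with [s]. *)
split=> [/direct//|[[M fM] fs]].
have sfh : csummable (f \o h).
  by exists M => F; rewrite -(im _ (fun j => `|f j|)); exact: fM.
suff: has_csum f (csum (f \o h)).
  move=> h1; have <- : csum (f \o h) = s.
    by apply: has_csum_unique h1 _; split => //; exists M.
  exact: csummable_has_csum sfh.
by apply: direct; exact: csummable_has_csum.
Qed.

Lemma big_fsetM (V : nmodType) (F : {fset I}) (G : {fset J}) (f : I -> J -> V) :
  \sum_(i <- F) \sum_(j <- G) f i j = \sum_(p <- (F `*` G)%fset) f p.1 p.2.
Proof.
transitivity (\sum_(p <- [seq (i, j) | i <- F, j <- G]) f p.1 p.2).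
  by rewrite big_allpairs.
apply: perm_big; apply: uniq_perm.
- by apply: allpairs_uniq; rewrite ?fset_uniq// => -[? ?] [? ?] _ _ [-> ->].
- exact: fset_uniq.
move=> [i j]; rewrite in_fsetM /=; apply/allpairsP/andP => /=.
  by move=> [[i' j'] [/= ? ? [-> ->]]].
by move=> [? ?]; exists (i, j).
Qed.

(** A finite set of pairs lies in the product of its two projections, so finite rectangles are
    cofinal. *)
Lemma csummable_pair (f : I * J -> C) (M : C) :
  (forall (F : {fset I}) (G : {fset J}), \sum_(i <- F) \sum_(j <- G) `|f (i, j)| <= M) ->
  csummable f.
Proof.
move=> fM; exists M => P.
pose F := [fset p.1 | p in P]%fset; pose G := [fset p.2 | p in P]%fset.
apply: le_trans (fM F G); rewrite (big_fsetM F G (fun i j => `|f (i, j)|)).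
rewrite [leRHS](@fset_sum_incl _ _ P); last first.
  by apply/fsubsetP => p pP; rewrite in_fsetM; apply/andP; split; apply/imfsetP; exists p.
have -> : \sum_(i <- P) `|f i| = \sum_(i <- P) `|f (i.1, i.2)|.
  by apply: eq_bigr => -[].
by rewrite lerDl sumr_ge0.
Qed.

Lemma has_csum_pair (f : I * J -> C) (S : C) : has_csum f S ->
  (forall i, csummable (fun j => f (i, j))) /\
  has_csum (fun i => csum (fun j => f (i, j))) S.
Proof.
move=> [/csummableP[M M0 fM] fS].
have box (F : {fset I}) (G : {fset J}) :
    \sum_(j <- G) \sum_(i <- F) Re `|f (i, j)| <= M.
  rewrite exchange_big (big_fsetM F G (fun i j => Re `|f (i, j)|)).
  apply: le_trans (fM (F `*` G)%fset); rewrite le_eqVlt; apply/orP; left.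
  by apply/eqP/eq_bigr => -[].
have row i : csummable (fun j => f (i, j)).
  apply: (@csummable_le _ M) => G; apply: le_trans (box [fset i]%fset G).
  by apply: ler_sum => j _; rewrite big_seq_fset1.
split => //; set g := fun i => _.
have rowg i : has_csum (fun j => f (i, j)) (g i) by exact: csummable_has_csum.
have rowa i : has_csum (fun j => `|f (i, j)|) (csum (fun j => `|f (i, j)|)).
  apply: csummable_has_csum; apply: csummable_dom (row i) => j.
  by rewrite normr_id.
split.
  exists M%:C => F.
  have h : \sum_(i <- F) `|g i| <= \sum_(i <- F) csum (fun j => `|f (i, j)|).
    apply: ler_sum => i _; apply: (has_csum_le (rowg i)) => G.
    by apply: has_csum_ge_fset (rowa i) _ => j.
  apply: le_trans h _; have hs := has_csum_sum F rowa.
  apply: le_trans (real_ler_norm _) _.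
    apply: ger0_real; apply: (has_csum_ge0 hs) => j; exact: sumr_ge0.
  apply: (has_csum_le hs) => G.
  rewrite (eq_bigr (fun j => (\sum_(i <- F) Re `|f (i, j)|)%:C)); last first.
    move=> j _; rewrite ger0_norm ?sumr_ge0// rmorph_sum.
    by apply: eq_bigr => i _; exact/esym/ReC_norm.
  by rewrite -rmorph_sum lecR.
apply/cvgrPdist_le => e e0.
move/cvgrPdist_le : fS => /(_ e e0) [P0 _ hP0].
exists [fset p.1 | p in P0]%fset => //= F hF.
(* For fixed [F], the finite sum of row sums is a limit over [G] of sums over rectangles, all within
   [e] of [S] once the rectangle contains [P0]. *)
rewrite distrC; apply: (has_csum_normBle (has_csum_sum F rowg)).
exists [fset p.2 | p in P0]%fset => //= G hG.
rewrite /fset_sum exchange_big (big_fsetM F G (fun i j => f (i, j))).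
have -> : \sum_(p <- (F `*` G)%fset) f (p.1, p.2) = \sum_(p <- (F `*` G)%fset) f p.
  by apply: eq_bigr => -[].
rewrite distrC; apply: hP0; apply/fsubsetP => p pP; rewrite in_fsetM (fsubsetP hF) ?(fsubsetP hG)//;
  by apply/imfsetP; exists p.
Qed.

Lemma has_csum_mul (f : I -> C) (g : J -> C) (s t : C) :
  has_csum f s -> has_csum g t -> has_csum (fun p => f p.1 * g p.2) (s * t).
Proof.
move=> fs gt; have [/csummableP[M M0 fM] _] := fs.
have [/csummableP[N N0 gN] _] := gt.
have /csummable_has_csum h : csummable (fun p => f p.1 * g p.2).
  apply: (@csummable_pair _ (M * N)%:C) => F G /=.
  rewrite (eq_bigr (fun i => ((Re `|f i|) * \sum_(j <- G) Re `|g j|)%:C)).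
    rewrite -rmorph_sum lecR -mulr_suml ler_pM ?sumr_ge0// => i _; exact: Re_norm_ge0.
  move=> i _; rewrite mulr_sumr rmorph_sum; apply: eq_bigr => j _.
  by rewrite -Re_normM; exact/esym/ReC_norm.
have [_ h2] := has_csum_pair h; rewrite [s * t](_ : _ = csum (fun p => f p.1 * g p.2))//.
apply: has_csum_unique h2; rewrite mulrC; apply: eq_has_csum (has_csumZ t fs) => i /=.
by rewrite mulrC; apply/esym/has_csumE/has_csumZ.
Qed.

End reindexing.

Lemma has_csum_swap (I J : choiceType) (f : I * J -> C) s : has_csum f s ->
  has_csum (fun p => f (p.2, p.1)) s.
Proof.
move=> h; have -> : (fun p => f (p.2, p.1)) = f \o (fun p : J * I => (p.2, p.1)) by [].
apply/has_csum_inj => //; first by move=> [? ?] [? ?] [-> ->].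
by move=> [i j] /(_ (j, i)).
Qed.

(** Induction on the number of factors: [h] prepends a coordinate to a tuple, so that one sum times
    an n-fold sum becomes an (n+1)-fold sum. *)
Lemma has_csum_ffun (J : choiceType) (n : nat) (f : 'I_n -> J -> C) (s : 'I_n -> C) :
  (forall i, has_csum (f i) (s i)) ->
  has_csum (fun k : {ffun 'I_n -> J} => \prod_(i < n) f i (k i)) (\prod_(i < n) s i).
Proof.
elim: n f s => [|n IH] f s fs.
  rewrite big_ord0; pose k0 : {ffun 'I_0 -> J} := ffun0 (card_ord 0).
  have uk k : k = k0 by apply/ffunP => -[].
  have := @has_csum1 _ (fun k : {ffun 'I_0 -> J} => \prod_(i < 0) f i (k i)) k0.
  by rewrite big_ord0; apply=> k; rewrite (uk k) eqxx.
rewrite big_ord_recl.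
pose h (p : J * {ffun 'I_n -> J}) : {ffun 'I_n.+1 -> J} :=
  [ffun i => oapp p.2 p.1 (unlift ord0 i)].
have h0 p : h p ord0 = p.1 by rewrite ffunE unlift_none.
have hS p i : h p (lift ord0 i) = p.2 i by rewrite ffunE liftK.
apply/(@has_csum_inj _ _ h).
- move=> p q hpq; rewrite [p]surjective_pairing [q]surjective_pairing.
  rewrite -h0 hpq h0; congr pair; apply/ffunP => i.
  by rewrite -hS hpq hS.
- move=> k /(_ (k ord0, [ffun i => k (lift ord0 i)]))[]; apply/ffunP => i.
  by case: (unliftP ord0 i) => [i' ->|->]; rewrite ?h0 ?hS ?ffunE.
have := has_csum_mul (fs ord0) (IH _ _ (fun i => fs (lift ord0 i))).
apply: eq_has_csum => p /=; rewrite big_ord_recl h0; congr (_ * _).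
by apply: eq_bigr => i _; rewrite hS.
Qed.

Lemma has_csum_shift (f : nat -> C) s : has_csum f s ->
  has_csum (fun k => if k is j.+1 then f j else 0) s.
Proof.
move=> h; apply/(@has_csum_inj _ _ S) => //; first by move=> ? ? [].
by case=> // j /(_ j).
Qed.

End complex_sums.

(** * Sesquilinear forms and operators on l^2 *)

Section forms.
Context (R : realType) (V : lmodType R[i]).
Local Notation C := R[i].
Local Notation Re := (@complex.Re R).
Local Notation Im := (@complex.Im R).

Definition sesquilinear (B : V -> V -> C) : Prop :=
  (forall u v w, B u (v + w) = B u v + B u w) /\
  (forall u c v, B u (c *: v) = c * B u v) /\
  (forall u v w, B (u + v) w = B u w + B v w) /\
  (forall c u v, B (c *: u) v = conjc c * B u v).

Variable B : V -> V -> C.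
Hypothesis Bses : sesquilinear B.

Lemma formDr u v w : B u (v + w) = B u v + B u w. Proof. by case: Bses. Qed.
Lemma formZr u c v : B u (c *: v) = c * B u v. Proof. by case: Bses => _ []. Qed.
Lemma formDl u v w : B (u + v) w = B u w + B v w.
Proof. by case: Bses => _ [_ []]. Qed.
Lemma formZl c u v : B (c *: u) v = conjc c * B u v.
Proof. by case: Bses => _ [_ []]. Qed.

Lemma form0r u : B u 0 = 0. Proof. by rewrite -(scale0r 0) formZr mul0r. Qed.
Lemma form0l u : B 0 u = 0.
Proof. by rewrite -(scale0r 0) formZl conjc0 mul0r. Qed.
Lemma formNr u v : B u (- v) = - B u v. Proof. by rewrite -scaleN1r formZr mulN1r. Qed.
Lemma formNl u v : B (- u) v = - B u v.
Proof. by rewrite -scaleN1r formZl rmorphN rmorph1 mulN1r. Qed.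

Lemma form_sumr (J : Type) (r : seq J) (f : J -> V) u :
  B u (\sum_(j <- r) f j) = \sum_(j <- r) B u (f j).
Proof. by elim: r => [|j r IH]; rewrite ?big_nil ?form0r// !big_cons formDr IH. Qed.

Lemma form_suml (J : Type) (r : seq J) (f : J -> V) u :
  B (\sum_(j <- r) f j) u = \sum_(j <- r) B (f j) u.
Proof. by elim: r => [|j r IH]; rewrite ?big_nil ?form0l// !big_cons formDl IH. Qed.

Hypothesis B_ge0 : forall u, 0 <= B u u.

(** Reality of the form at u + v relates the imaginary parts of the two values, reality at u + iv
    their real parts. *)
Lemma form_herm u v : B v u = conjc (B u v).
Proof.
have h1 := ger0_Im (B_ge0 (u + v)); have h2 := ger0_Im (B_ge0 (u + 'i *: v)).
have hu := ger0_Im (B_ge0 u); have hv := ger0_Im (B_ge0 v).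
move: h1 h2; rewrite !(formDl, formDr, formZl, formZr).
move: (B u u) (B v v) (B u v) (B v u) hu hv => [a a'] [b b'] [c c'] [d d'] /= -> ->.
move=> h1 h2; apply/eqP; rewrite eq_complex /=; apply/andP; split; apply/eqP; lra.
Qed.

Lemma form_CS u v : (Re `|B u v|) ^+ 2 <= Re (B u u) * Re (B v v).
Proof.
have Re0 w : 0 <= Re (B w w) by have := B_ge0 w; rewrite lecE => /andP[].
(* Nonnegativity at u - t B(v, u) v: the factor B(v, u) absorbs the phase and leaves a real
   polynomial in t. *)
have key t : 0 <= Re (B u u) - 2 * t * (Re `|B u v|) ^+ 2 +
    t ^+ 2 * (Re `|B u v|) ^+ 2 * Re (B v v).
  have := Re0 (u - (t%:C * B v u) *: v).
  rewrite !(formDl, formDr, formNl, formNr, formZl, formZr) !normcE2 (form_herm u v).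
  have := ger0_Im (B_ge0 v); have := ger0_Im (B_ge0 u).
  move: (B u u) (B v v) (B u v) => [a a'] [b b'] [c c'] /= _ ->.
  by move=> h; apply: le_trans h _; rewrite le_eqVlt; apply/orP; left; apply/eqP; ring.
set x := Re `|B u v| ^+ 2 in key *; set a := Re _ in key *; set d := Re _ in key *.
have x0 : 0 <= x by exact: sqr_ge0.
(* For d = 0 the polynomial is affine in t, and if x > 0 the chosen t gives it the value -1.
   Otherwise t = 1/d is its minimizer. *)
have [d0|d0] := eqVneq d 0.
  rewrite d0 mulr0 leNgt; apply/negP => xp.
  have := key ((a + 1) / (2 * x)); rewrite d0 mulr0 addr0.
  have -> : 2 * ((a + 1) / (2 * x)) * x = a + 1 by field; rewrite gt_eqF.
  lra.
have dp : 0 < d by rewrite lt_neqAle eq_sym d0 Re0.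
have := key d^-1.
have -> : a - 2 * d^-1 * x + d^-1 ^+ 2 * x * d = (a * d - x) / d by field.
by rewrite pmulr_lge0 ?invr_gt0// subr_ge0.
Qed.

End forms.

Section ell2_theory.
Context (R : realType) (I : choiceType).
Local Notation C := R[i].
Local Notation H := (ell2 R I).
Local Notation Re := (@complex.Re R).
Local Notation Im := (@complex.Im R).
Implicit Types u v w : H.

Lemma ell2D u v i : (u + v) i = u i + v i. Proof. by []. Qed.
Lemma ell2Z c u i : (c *: u) i = c * u i. Proof. by []. Qed.
Lemma ell2_ext u v : (forall i, u i = v i) -> u = v.
Proof. by move=> /funext h; apply: val_inj. Qed.

Lemma summable_bound (p : I -> R) : (forall i, 0 <= p i) ->
  summable setT (EFin \o p) <-> exists M, forall F : {fset I}, \sum_(i <- F) p i <= M.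
Proof.
move=> p0; rewrite /summable.
have -> : (fun i => `|(EFin \o p) i|%E) = EFin \o p.
  by apply/funext => i /=; rewrite ger0_norm.
split=> [h|[M hM]]; last first.
  by apply: le_lt_trans (ltry M); apply: esum_fset_le => F; rewrite lee_fin.
have fin : esum setT (EFin \o p) \is a fin_num.
  by rewrite ge0_fin_numE//; apply: esum_ge0 => i _; rewrite lee_fin.
exists (fine (esum setT (EFin \o p))) => F.
by rewrite -lee_fin fineK//; exact: esum_fset_ge.
Qed.

Lemma square_summableP (x : I -> C) : square_summable x <->
  exists M, forall F : {fset I}, \sum_(i <- F) (Re `|x i|) ^+ 2 <= M.
Proof.
rewrite -(@summable_bound (fun i => Re `|x i| ^+ 2)); last by move=> i; exact: sqr_ge0.
by split=> [/asboolP|?]; last exact/asboolP.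
Qed.

Lemma toell2E (x : I -> C) (M : R) :
  (forall F : {fset I}, \sum_(i <- F) (Re `|x i|) ^+ 2 <= M) -> toell2 x = x :> (I -> C).
Proof.
move=> h; rewrite /toell2; apply: insubdK; rewrite unfold_in.
by apply/square_summableP; exists M.
Qed.

Lemma ell2_bound u : exists M, forall F : {fset I}, \sum_(i <- F) (Re `|u i|) ^+ 2 <= M.
Proof. by apply/square_summableP; case: u. Qed.

Lemma has_csum_inner u v : has_csum (fun i => conjc (u i) * v i) (inner u v).
Proof.
apply: csummable_has_csum.
have [M hM] := ell2_bound u; have [N hN] := ell2_bound v.
apply: (@csummable_le _ _ (M + N)) => F; apply: le_trans (lerD (hM F) (hN F)).
rewrite -big_split; apply: ler_sum => i _; rewrite Re_normM normcJ.
have ab (a b : R) : a * b <= a ^+ 2 + b ^+ 2 by nra.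
exact: ab.
Qed.

Lemma inner_sesquilinear : sesquilinear (@inner R I).
Proof.
split; [|split; [|split]] => [u v w|u c v|u v w|c u v]; apply: has_csumE.
- apply: eq_has_csum (has_csumD (has_csum_inner u v) (has_csum_inner u w)) => i.
  by rewrite ell2D mulrDr.
- apply: eq_has_csum (has_csumZ c (has_csum_inner u v)) => i.
  by rewrite ell2Z mulrCA.
- apply: eq_has_csum (has_csumD (has_csum_inner u w) (has_csum_inner v w)) => i.
  by rewrite ell2D rmorphD mulrDl.
- apply: eq_has_csum (has_csumZ (conjc c) (has_csum_inner u v)) => i.
  by rewrite ell2Z rmorphM mulrA.
Qed.

Lemma conj_mul_self (z : C) : conjc z * z = ((Re `|z|) ^+ 2)%:C.
Proof. by rewrite mulrC -sqr_normc rmorphXn/= ReC_norm. Qed.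

Lemma inner_ge0 u : 0 <= inner u u.
Proof.
apply: has_csum_ge0 (has_csum_inner u u) _ => i.
by rewrite conj_mul_self ler0c sqr_ge0.
Qed.

Definition nsq u : R := Re (inner u u).

Lemma nsqC u : (nsq u)%:C = inner u u.
Proof. by rewrite /nsq RRe_real// ger0_real// inner_ge0. Qed.

Lemma nsq_ge0 u : 0 <= nsq u. Proof. by rewrite -ler0c nsqC inner_ge0. Qed.

Lemma nsq_ge_fset u (F : {fset I}) : \sum_(i <- F) (Re `|u i|) ^+ 2 <= nsq u.
Proof.
rewrite -lecR nsqC rmorph_sum/= (eq_bigr (fun i => conjc (u i) * u i)) => [|i _].
  apply: (has_csum_ge_fset (f := fun i => conjc (u i) * u i) _ (has_csum_inner u u)).
  by move=> i; rewrite conj_mul_self ler0c sqr_ge0.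
by rewrite conj_mul_self.
Qed.

Lemma nsq_le_fset u (M : R) : (forall F : {fset I}, \sum_(i <- F) (Re `|u i|) ^+ 2 <= M) ->
  nsq u <= M.
Proof.
move=> h; rewrite -lecR nsqC; apply: le_trans (real_ler_norm _) _.
  by rewrite ger0_real// inner_ge0.
apply: (has_csum_le (has_csum_inner u u)) => F.
rewrite (eq_bigr (fun i => ((Re `|u i|) ^+ 2)%:C)) => [|i _].
  by rewrite -rmorph_sum lecR.
by rewrite conj_mul_self ger0_norm// ler0c sqr_ge0.
Qed.

Lemma norm2E u : norm2 u = Num.sqrt (nsq u). Proof. by []. Qed.

Lemma nsq0_eq0 u : nsq u = 0 -> u = 0.
Proof.
move=> u0; apply: ell2_ext => i; have := nsq_ge_fset u [fset i]%fset.
rewrite big_seq_fset1 u0 => h; apply: Re_norm0_eq0; apply/eqP.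
by rewrite -sqrf_eq0 eq_le h sqr_ge0.
Qed.

Lemma inner_CS u v : (Re `|inner u v|) ^+ 2 <= nsq u * nsq v.
Proof. exact: (form_CS inner_sesquilinear inner_ge0). Qed.

Lemma inner_conj u v : inner v u = conjc (inner u v).
Proof. exact: (form_herm inner_sesquilinear inner_ge0). Qed.

Lemma ketE (i j : I) : ket R i j = (j == i)%:R.
Proof.
rewrite /ket (@toell2E _ 1)// => F.
rewrite (eq_bigr (fun j => ((j == i)%:R : R))) => [|k _]; last first.
  by case: eqP; rewrite ?normr1 ?normr0 ?expr1n ?expr0n.
have [iF|iF] := boolP (i \in F).
  rewrite (big_fsetD1 i)//= eqxx big1_seq ?addr0// => k /=.
  by rewrite !inE => /andP[/negbTE ->].
rewrite big1_seq// => k /= kF; case: eqP => // ki; by rewrite -ki kF in iF.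
Qed.

Lemma inner_ketl i u : inner (ket R i) u = u i.
Proof.
apply: has_csumE; have := @has_csum1 R _ (fun j => conjc (ket R i j) * u j) i.
rewrite ketE eqxx conjc1 mul1r; apply=> j ji.
by rewrite ketE (negbTE ji) conjc0 mul0r.
Qed.

Lemma inner_ketr i u : inner u (ket R i) = conjc (u i).
Proof. by rewrite inner_conj inner_ketl. Qed.

Lemma inner_extr u v : (forall w, inner w u = inner w v) -> u = v.
Proof. by move=> h; apply: ell2_ext => i; rewrite -!inner_ketl. Qed.

Lemma inner_extl u v : (forall w, inner u w = inner v w) -> u = v.
Proof. by move=> h; apply: inner_extr => w; rewrite inner_conj h -inner_conj. Qed.

Definition finite_vector (F : {fset I}) (x : I -> C) : H := \sum_(i <- F) x i *: ket R i.

Lemma finite_vectorE (F : {fset I}) x i :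
  finite_vector F x i = if i \in F then x i else 0.
Proof.
rewrite -inner_ketl (form_sumr inner_sesquilinear).
rewrite (eq_bigr (fun j => if j == i then x i else 0)) => [|j _]; last first.
  rewrite (formZr inner_sesquilinear) inner_ketl ketE eq_sym.
  by case: eqP => [->|]; rewrite ?mulr1 ?mulr0.
case: ifPn => iF.
  rewrite (big_fsetD1 i)//= eqxx big1_seq ?addr0// => k /=.
  by rewrite !inE => /andP[/negbTE ->].
rewrite big1_seq// => k /= kF; case: eqP => // ki; by rewrite -ki kF in iF.
Qed.

Lemma inner_finite_vector (F : {fset I}) x u :
  inner (finite_vector F x) u = \sum_(i <- F) conjc (x i) * u i.
Proof.
rewrite (form_suml inner_sesquilinear); apply: eq_bigr => i _.
by rewrite (formZl inner_sesquilinear) inner_ketl.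
Qed.

Lemma nsq_finite_vector (F : {fset I}) x :
  nsq (finite_vector F x) = \sum_(i <- F) (Re `|x i|) ^+ 2.
Proof.
apply: complexI; rewrite nsqC inner_finite_vector rmorph_sum.
rewrite big_seq [RHS]big_seq; apply: eq_bigr => i iF.
by rewrite finite_vectorE iF conj_mul_self.
Qed.

Lemma nsq_ket i : nsq (ket R i) = 1.
Proof. by rewrite /nsq inner_ketl ketE eqxx. Qed.

(** Such a functional vanishes on finite vectors, so its value at u is controlled by the tail of u,
    which is arbitrarily small. *)
Lemma linear_ket_eq0 (phi : H -> C) (M : R) :
  (forall u v, phi (u + v) = phi u + phi v) -> (forall c u, phi (c *: u) = c * phi u) ->
  (forall u, (Re `|phi u|) ^+ 2 <= M * nsq u) ->
  (forall i, phi (ket R i) = 0) -> forall u, phi u = 0.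
Proof.
move=> phiD phiZ phiM phi0 u.
have phi_fin F : phi (finite_vector F u) = 0.
  rewrite /finite_vector; elim/big_ind: _ => [|? ? h1 h2|i _].
  - by rewrite -(scale0r 0) phiZ mul0r.
  - by rewrite phiD h1 h2 addr0.
  - by rewrite phiZ phi0 mulr0.
(* [M] may be negative, but the bound then forces every norm to vanish. *)
have M0 : (0 <= M \/ forall v, nsq v = 0).
  have [|Mn] := leP 0 M; [by left|right => v].
  have := le_trans (sqr_ge0 _) (phiM v); have := nsq_ge0 v; nra.
case: M0 => [M0|h]; last first.
  by rewrite (nsq0_eq0 (h u)) -(scale0r 0) phiZ mul0r.
apply: Re_norm0_eq0; apply/eqP; rewrite -sqrf_eq0 eq_le sqr_ge0 andbT.
apply/ler_addgt0Pl => e e0; rewrite addr0.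
(* With a tail below e / (M + 1), M times the tail stays below e, including when M = 0. *)
have [F hF] : exists F : {fset I}, nsq u - e / (M + 1) < \sum_(i <- F) (Re `|u i|) ^+ 2.
  apply/not_existsP => h.
  have : nsq u <= nsq u - e / (M + 1).
    by apply: nsq_le_fset => F; rewrite leNgt; apply/negP/h.
  rewrite lerBrDr gerDl leNgt divr_gt0//; lra.
have -> : phi u = phi (u - finite_vector F u).
  by rewrite phiD -scaleN1r phiZ phi_fin mulr0 addr0.
apply: le_trans (phiM _) _.
have -> : nsq (u - finite_vector F u) = nsq u - \sum_(i <- F) (Re `|u i|) ^+ 2.
  have fu : inner (finite_vector F u) u = (\sum_(i <- F) (Re `|u i|) ^+ 2)%:C.
    rewrite inner_finite_vector rmorph_sum; apply: eq_bigr => i _.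
    by rewrite conj_mul_self.
  apply: complexI; rewrite rmorphB/= !nsqC.
  rewrite !(formDl inner_sesquilinear, formDr inner_sesquilinear,
    formNl inner_sesquilinear, formNr inner_sesquilinear).
  rewrite -(nsqC (finite_vector _ _)) nsq_finite_vector fu.
  by rewrite (inner_conj (finite_vector F u) u) fu conjc_real; ring.
have h1 : nsq u - \sum_(i <- F) (Re `|u i|) ^+ 2 <= e / (M + 1) by lra.
apply: le_trans (ler_wpM2l M0 h1) _.
rewrite mulrCA ler_piMr// ?(ltW e0)// ler_pdivrMr; lra.
Qed.

(** [adjoint] is picked by choice; nondegeneracy of the inner product leaves a single candidate. *)
Lemma adjointE (T S : H -> H) :
  (forall u v, inner (S u) v = inner u (T v)) -> adjoint T = S.
Proof.
move=> hS; rewrite /adjoint.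
have : [set S' | forall u v, inner (S' u) v = inner u (T v)] (adjoint T).
  by apply: xgetPex; exists S.
move=> h; apply/funext => u; apply: inner_extl => v.
by rewrite hS; exact: h.
Qed.

Lemma positive_form (T : H -> H) : linear T -> positive_operator T ->
  sesquilinear (fun u v => inner u (T v)).
Proof.
move=> linT _; have TD u v : T (u + v) = T u + T v.
  by have := linT 1 u v; rewrite !scale1r.
have T0 : T 0 = 0 by have := linT (-1) 0 0; rewrite scaler0 addr0 scaleN1r addNr.
have TZ c v : T (c *: v) = c *: T v by have := linT c v 0; rewrite T0 !addr0.
split; [|split; [|split]] => [u v w|u c v|u v w|c u v].
- by rewrite TD (formDr inner_sesquilinear).
- by rewrite TZ (formZr inner_sesquilinear).
- exact: (formDl inner_sesquilinear).
- exact: (formZl inner_sesquilinear).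
Qed.

Lemma positive_sym (T : H -> H) u v : linear T -> positive_operator T ->
  inner (T u) v = inner u (T v).
Proof.
move=> linT posT; rewrite inner_conj.
by rewrite -(form_herm (positive_form linT posT) posT).
Qed.

End ell2_theory.

(** * Bounded operators given by matrices *)

Section matrices.
Context (R : realType) (I : choiceType).
Local Notation C := R[i].
Local Notation H := (ell2 R I).
Local Notation Re := (@complex.Re R).
Implicit Types (u v : H) (M : I -> I -> C).

(** Bounds on squared norms avoid the square root of [norm2]; c is the square of an operator
    bound. *)
Definition nsq_bounded (T : H -> H) (c : R) := 0 <= c /\ forall u, nsq (T u) <= c * nsq u.

Lemma nsq_bounded_operator (T : H -> H) (c : R) : linear T -> nsq_bounded T c ->
  bounded_operator T.
Proof.
move=> linT [c0 Tc]; split => //; exists (Num.sqrt c) => u.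
by rewrite !norm2E -sqrtrM// ler_sqrt// mulr_ge0// nsq_ge0.
Qed.

Lemma bounded_operator_nsq (T : H -> H) : bounded_operator T ->
  exists c : R, nsq_bounded T c.
Proof.
move=> [_ [b Tb]]; exists (b ^+ 2); split; first exact: sqr_ge0.
move=> u; have := Tb u; rewrite !norm2E => h.
have h2 : Num.sqrt (nsq (T u)) <= `|b| * Num.sqrt (nsq u).
  by apply: le_trans h _; rewrite ler_wpM2r ?sqrtr_ge0// ler_norm.
rewrite -(sqr_sqrtr (nsq_ge0 (T u))) -[nsq u]sqr_sqrtr ?nsq_ge0// -exprMn.
rewrite -[leRHS]real_normK ?num_real// normrM (ger0_norm (sqrtr_ge0 (nsq u))).
by rewrite ler_sqr ?nnegrE ?mulr_ge0 ?sqrtr_ge0.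
Qed.

(** Only finitely supported vectors are tested, so no convergence is presupposed; this suffices for
    [op_of_matrix] to be a genuine bounded operator. *)
Definition matrix_bounded M (c : R) := forall (F G : {fset I}) (x y : I -> C),
  (Re `|\sum_(i <- F) \sum_(j <- G) conjc (x i) * M i j * y j|) ^+ 2 <=
    c * (\sum_(i <- F) Re `|x i| ^+ 2) * (\sum_(j <- G) Re `|y j| ^+ 2).

Section bounded_matrix.
Variables (M : I -> I -> C) (c : R).
Hypotheses (c0 : 0 <= c) (Mc : matrix_bounded M c).

(** Testing the form on the conjugated row itself gives S^2 <= c S for the truncated square sum
    S. *)
Lemma matrix_row_bound i (G : {fset I}) : \sum_(j <- G) Re `|M i j| ^+ 2 <= c.
Proof.
have := Mc [fset i]%fset G (fun=> 1) (fun j => conjc (M i j)).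
rewrite !big_seq_fset1 normr1 expr1n mulr1 conjc1.
set S := \sum_(j <- G) Re `|M i j| ^+ 2.
rewrite (eq_bigr (fun j => (Re `|M i j| ^+ 2)%:C)) => [|j _]; last first.
  by rewrite mul1r mulrC conj_mul_self.
rewrite -rmorph_sum Re_norm_real -/S real_normK ?num_real//.
rewrite (eq_bigr (fun j => Re `|M i j| ^+ 2)) => [|j _]; last by rewrite normcJ.
rewrite -/S => h; have S0 : 0 <= S by apply: sumr_ge0 => j _; exact: sqr_ge0.
have [->//|Sn0] := eqVneq S 0; have Sp : 0 < S by rewrite lt_neqAle eq_sym Sn0.
by rewrite -(ler_pM2r Sp) -expr2.
Qed.

Lemma has_csum_matrix_row u i : has_csum (fun j => M i j * u j) (csum (fun j => M i j * u j)).
Proof.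
have rowE : toell2 (fun j => conjc (M i j)) = (fun j => conjc (M i j)) :> (I -> C).
  apply: (@toell2E _ _ _ c) => F; under eq_bigr do rewrite normcJ.
  exact: matrix_row_bound.
have [h _] := has_csum_inner (toell2 (fun j => conjc (M i j))) u.
apply: csummable_has_csum; move: h; rewrite rowE.
by under [X in csummable X]eq_fun do rewrite conjcK.
Qed.

(** The same duality: pairing the image with its own truncation gives X^2 <= c X nsq(u), and X
    cancels. *)
Lemma matrix_image_bound u (F : {fset I}) :
  \sum_(i <- F) Re `|csum (fun j => M i j * u j)| ^+ 2 <= c * nsq u.
Proof.
set x := fun i => csum (fun j => M i j * u j).
set X := \sum_(i <- F) _; have X0 : 0 <= X by apply: sumr_ge0 => j _; exact: sqr_ge0.
have XE : \sum_(i <- F) conjc (x i) * x i = X%:C.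
  by rewrite /X rmorph_sum; apply: eq_bigr => i _; rewrite conj_mul_self.
have h : has_csum (fun j => \sum_(i <- F) conjc (x i) * (M i j * u j)) X%:C.
  rewrite -XE; apply: has_csum_sum => i; apply: has_csumZ; exact: has_csum_matrix_row.
have : `|X%:C - 0| <= (Num.sqrt (c * X * nsq u))%:C.
  apply: (has_csum_normBle h); near=> G.
  rewrite subr0 -ReC_norm lecR /fset_sum.
  rewrite -(ger0_norm (Re_norm_ge0 _)) -sqrtr_sqr ler_sqrt; last first.
    by rewrite !mulr_ge0 ?nsq_ge0.
  have := Mc F G x u; rewrite exchange_big /=.
  under eq_bigr => j _ do under eq_bigr => i _ do rewrite -mulrA.
  move/le_trans; apply; rewrite ler_wpM2l ?mulr_ge0//; exact: nsq_ge_fset.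
rewrite subr0 -ReC_norm Re_norm_real lecR ger0_norm// => h2.
have : X ^+ 2 <= c * X * nsq u.
  rewrite -[leRHS]sqr_sqrtr ?mulr_ge0 ?nsq_ge0//.
  by rewrite ler_sqr ?nnegrE ?sqrtr_ge0.
have [->|Xn0] := eqVneq X 0; first by rewrite mulr_ge0 ?nsq_ge0.
have Xp : 0 < X by rewrite lt_neqAle eq_sym Xn0.
by rewrite expr2 mulrAC ler_pM2r.
Unshelve. all: by end_near. Qed.

Lemma op_of_matrixE u i : op_of_matrix M u i = csum (fun j => M i j * u j).
Proof. by rewrite /op_of_matrix (toell2E (matrix_image_bound u)). Qed.

Lemma has_csum_op_of_matrix u i : has_csum (fun j => M i j * u j) (op_of_matrix M u i).
Proof. by rewrite op_of_matrixE; exact: has_csum_matrix_row. Qed.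

Lemma op_of_matrix_nsq : nsq_bounded (op_of_matrix M) c.
Proof.
split=> // u; apply: nsq_le_fset => F.
under eq_bigr do rewrite op_of_matrixE; exact: matrix_image_bound.
Qed.

Lemma op_of_matrix_linear : linear (op_of_matrix M).
Proof.
move=> a u v; apply: ell2_ext => i; rewrite ell2D ell2Z.
apply: has_csum_unique (has_csum_op_of_matrix _ i) _.
apply: eq_has_csum (has_csumD (has_csumZ a (has_csum_op_of_matrix u i))
  (has_csum_op_of_matrix v i)) => j.
by rewrite ell2D ell2Z mulrDr mulrCA.
Qed.

Lemma op_of_matrix_ket i j : op_of_matrix M (ket R j) i = M i j.
Proof.
have h := @has_csum1 R _ (fun k => M i k * ket R j k) j.
rewrite op_of_matrixE; apply: has_csumE; move: h; rewrite ketE eqxx mulr1.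
by apply => k kj; rewrite ketE (negbTE kj) mulr0.
Qed.

End bounded_matrix.

Lemma linearP2 (T : H -> H) : linear T ->
  (forall u v, T (u + v) = T u + T v) /\ (forall a u, T (a *: u) = a *: T u).
Proof.
move=> linT; have TD u v : T (u + v) = T u + T v.
  by have := linT 1 u v; rewrite !scale1r.
split=> // a v.
have T0 : T 0 = 0 by have := linT (-1) 0 0; rewrite scaler0 addr0 scaleN1r addNr.
by have := linT a v 0; rewrite T0 !addr0.
Qed.

(** The tool behind the operator identities below: compute on basis vectors, then extend by
    boundedness, one argument at a time. *)
Lemma form_eq_ket (B1 B2 : H -> H -> C) (c1 c2 : R) :
  sesquilinear B1 -> sesquilinear B2 ->
  (forall u v, Re `|B1 u v| ^+ 2 <= c1 * nsq u * nsq v) ->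
  (forall u v, Re `|B2 u v| ^+ 2 <= c2 * nsq u * nsq v) ->
  (forall i j, B1 (ket R i) (ket R j) = B2 (ket R i) (ket R j)) ->
  forall u v, B1 u v = B2 u v.
Proof.
move=> s1 s2 b1 b2 e u v.
have bd u' v' : Re `|B1 u' v' - B2 u' v'| ^+ 2 <= (2 * c1 + 2 * c2) * nsq u' * nsq v'.
  have := Re_normD (B1 u' v') (- B2 u' v'); rewrite normrN.
  move: (b1 u' v') (b2 u' v') (Re_norm_ge0 (B1 u' v' - B2 u' v')).
  move: (Re_norm_ge0 (B1 u' v')) (Re_norm_ge0 (B2 u' v')).
  move: (Re `|_|) (Re `|_|) (Re `|_|) => c a b b0 a0 hb ha c0 hc.
  have h1 : c ^+ 2 <= (b + a) ^+ 2 by rewrite ler_sqr ?nnegrE ?addr_ge0.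
  have h2 : (b + a) ^+ 2 <= 2 * a ^+ 2 + 2 * b ^+ 2.
    rewrite -subr_ge0 (_ : _ - _ = (a - b) ^+ 2) ?sqr_ge0//; ring.
  rewrite !mulrDl -!mulrA; lra.
have step i w : B1 (ket R i) w - B2 (ket R i) w = 0.
  apply: (@linear_ket_eq0 R I (fun w => B1 (ket R i) w - B2 (ket R i) w)
    ((2 * c1 + 2 * c2) * nsq (ket R i))) => [? ?|? ?|?|j].
  - by rewrite (formDr s1) (formDr s2); ring.
  - by rewrite (formZr s1) (formZr s2); ring.
  - exact: bd.
  - by rewrite e subrr.
(* In the first argument the difference is conjugate-linear, so [linear_ket_eq0] is applied to its
   conjugate. *)
apply/eqP; rewrite -subr_eq0 -conjc_eq0; apply/eqP.
apply: (@linear_ket_eq0 R I (fun w => conjc (B1 w v - B2 w v))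
    ((2 * c1 + 2 * c2) * nsq v)) => [? ?|? ?|?|j].
- by rewrite (formDl s1) (formDl s2) -rmorphD; congr conjc; ring.
- by rewrite (formZl s1) (formZl s2) -mulrBr rmorphM; congr (_ * _); exact: conjcK.
- by rewrite normcJ mulrAC; exact: bd.
- by rewrite step conjc0.
Qed.

Lemma operator_form (T S : H -> H) (c d : R) : linear T -> linear S ->
  nsq_bounded T c -> nsq_bounded S d -> sesquilinear (fun u v => inner (S u) (T v)) /\
  forall u v, Re `|inner (S u) (T v)| ^+ 2 <= (c * d) * nsq u * nsq v.
Proof.
move=> /linearP2[TD TZ] /linearP2[SD SZ] [c0 Tc] [d0 Sd]; split.
  have s := inner_sesquilinear R I.
  split; [|split; [|split]] => *; rewrite ?TD ?TZ ?SD ?SZ.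
  - exact: (formDr s).
  - exact: (formZr s).
  - exact: (formDl s).
  - exact: (formZl s).
move=> u v; apply: le_trans (inner_CS _ _) _.
apply: le_trans (ler_pM (nsq_ge0 _) (nsq_ge0 _) (Sd u) (Tc v)) _.
by rewrite le_eqVlt; apply/orP; left; apply/eqP; ring.
Qed.

Lemma id_nsq_bounded : nsq_bounded (@idfun H) 1.
Proof. by split=> // u; rewrite mul1r. Qed.

Lemma id_linear : linear (@idfun H). Proof. by []. Qed.

(** The operator has the matrix of the form in the basis; [form_eq_ket] then identifies the two
    forms. *)
Lemma operator_of_form (B : H -> H -> C) (c : R) : 0 <= c -> sesquilinear B ->
  (forall u v, Re `|B u v| ^+ 2 <= c * nsq u * nsq v) ->
  exists2 T : H -> H, bounded_operator T & forall u v, inner u (T v) = B u v.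
Proof.
move=> c0 sB bB.
have mB : matrix_bounded (fun i j => B (ket R i) (ket R j)) c.
  move=> F G x y; rewrite -!nsq_finite_vector.
  rewrite (_ : \sum_(i <- F) _ = B (finite_vector F x) (finite_vector G y)) ?bB//.
  rewrite (form_suml sB); apply: eq_bigr => i _; rewrite (form_sumr sB).
  by apply: eq_bigr => j _; rewrite (formZl sB) (formZr sB); ring.
have lT := op_of_matrix_linear c0 mB; have bT := op_of_matrix_nsq c0 mB.
exists (op_of_matrix (fun i j => B (ket R i) (ket R j))).
  exact: nsq_bounded_operator bT.
have [s1 b1] := operator_form lT id_linear bT id_nsq_bounded.
apply: (form_eq_ket s1 sB b1 bB) => i j /=.
by rewrite inner_ketl (op_of_matrix_ket c0 mB).
Qed.

Section unitary_matrix.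
Variables (M N : I -> I -> C).
Hypotheses (MN : forall i j, N i j = conjc (M j i))
  (col : forall i j, has_csum (fun k => N i k * M k j) (i == j)%:R).

(** The columns are orthonormal, so the combination [w] of columns has squared norm the square sum
    of y, and Cauchy-Schwarz gives the constant 1. *)
Lemma unitary_matrix_bounded : matrix_bounded M 1.
Proof.
pose c j := toell2 (fun i => M i j).
have cE j : c j = (fun i => M i j) :> (I -> C).
  apply: (@toell2E _ _ _ 1) => F.
  have E i : N j i * M i j = (Re `|M i j| ^+ 2)%:C by rewrite MN conj_mul_self.
  have := has_csum_ge_fset F (col j j); rewrite eqxx -lecR rmorph_sum.
  under eq_bigr do rewrite E.
  by apply=> i; rewrite E ler0c sqr_ge0.
have cc i j : inner (c i) (c j) = (i == j)%:R.
  apply: has_csumE; apply: eq_has_csum (col i j) => k.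
  by rewrite !cE MN.
move=> F G x y; rewrite mul1r.
have s := inner_sesquilinear R I.
pose w := \sum_(j <- G) y j *: c j.
have -> : \sum_(j <- G) Re `|y j| ^+ 2 = nsq w.
  apply: complexI; rewrite nsqC rmorph_sum (form_suml s).
  rewrite big_seq [RHS]big_seq; apply: eq_bigr => i iG.
  rewrite (formZl s) (form_sumr s) (big_fsetD1 i)//= big1_seq ?addr0 => [|j].
    by rewrite (formZr s) cc eqxx mulr1 conj_mul_self.
  by rewrite !inE eq_sym /= => /andP[/negbTE ij _]; rewrite (formZr s) cc ij mulr0.
rewrite -nsq_finite_vector.
rewrite (_ : \sum_(i <- F) _ = inner (finite_vector F x) w) ?inner_CS//.
rewrite inner_finite_vector; apply: eq_bigr => i _.
rewrite -inner_ketl (form_sumr s) mulr_sumr; apply: eq_bigr => j _.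
by rewrite (formZr s) inner_ketl cE; ring.
Qed.

End unitary_matrix.

Section unitary_matrix2.
Variables (M N : I -> I -> C).
Hypotheses (MN : forall i j, N i j = conjc (M j i))
  (col : forall i j, has_csum (fun k => N i k * M k j) (i == j)%:R)
  (row : forall i j, has_csum (fun k => M i k * N k j) (i == j)%:R).
Let U := op_of_matrix M.
Let V := op_of_matrix N.

Let NM i j : M i j = conjc (N j i). Proof. by rewrite MN conjcK. Qed.
Let bM := unitary_matrix_bounded MN col.
Let bN := unitary_matrix_bounded NM row.

Lemma unitary_linear : linear U. Proof. exact: (op_of_matrix_linear ler01 bM). Qed.
Lemma unitary_nsq_bounded : nsq_bounded U 1.
Proof. exact: (op_of_matrix_nsq ler01 bM). Qed.
Lemma unitary_ket i j : U (ket R j) i = M i j.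
Proof. exact: (op_of_matrix_ket ler01 bM). Qed.

Lemma unitary_adjoint u v : inner (V u) v = inner u (U v).
Proof.
have lV := op_of_matrix_linear ler01 bN; have nV := op_of_matrix_nsq ler01 bN.
have [s1 b1] := operator_form id_linear lV id_nsq_bounded nV.
have [s2 b2] := operator_form unitary_linear id_linear unitary_nsq_bounded id_nsq_bounded.
apply: (form_eq_ket s1 s2 b1 b2) => i j /=.
by rewrite inner_ketl unitary_ket inner_ketr (op_of_matrix_ket ler01 bN) -NM.
Qed.

Lemma unitary_comp u : U (V u) = u.
Proof.
have lV := op_of_matrix_linear ler01 bN; have nV := op_of_matrix_nsq ler01 bN.
apply: inner_extr => w; rewrite -unitary_adjoint.
have [s1 b1] := operator_form lV lV nV nV.
have [s2 b2] := operator_form id_linear id_linear id_nsq_bounded id_nsq_bounded.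
apply: (form_eq_ket s1 s2 b1 b2) => i j /=.
rewrite inner_ketl ketE; apply: has_csumE; apply: eq_has_csum (row i j) => k.
have e1 := op_of_matrix_ket ler01 bN k i; have e2 := op_of_matrix_ket ler01 bN k j.
congr (_ * _); last exact: esym e2.
transitivity (conjc (N k i)); [exact: NM | congr conjc; exact: esym e1].
Qed.

End unitary_matrix2.

(** Here [rho] is the mixture of the |w_l><w_l| with weights p_l. The trace is an iterated sum over
    the basis and over l; absolute summability permits summing over the basis first, which leaves
    <w_l, T w_l>. *)
Lemma trace_mixture (w : I -> H) (p : I -> R) (M c : R) (rho T : H -> H) :
  (forall l, nsq (w l) <= 1) -> (forall l, 0 <= p l) ->
  (forall F : {fset I}, \sum_(l <- F) p l <= M) ->
  (forall v i, has_csum (fun l => (p l)%:C * (w l i * inner (w l) v)) (rho v i)) ->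
  nsq_bounded T c -> (forall u v, inner (T u) v = inner u (T v)) ->
  has_csum (fun l => (p l)%:C * inner (w l) (T (w l))) (trace (rho \o T)).
Proof.
move=> w1 p0 pM rhoE [c0 Tc] Tsym.
pose f (q : I * I) := (p q.2)%:C * (w q.2 q.1 * inner (w q.2) (T (ket R q.1))).
have wT l i : inner (w l) (T (ket R i)) = conjc (T (w l) i).
  by rewrite -Tsym inner_ketr.
have sf : csummable f.
  (* The factor 1 + c comes from |x y| <= x^2 + y^2: the squares sum to at most |w_l|^2 <= 1 and |T
     w_l|^2 <= c. *)
  apply: (@csummable_pair _ _ _ _ (M * (1 + c))%:C) => F G.
  rewrite exchange_big.
  apply: (@le_trans _ _ (\sum_(l <- G) (p l * (1 + c))%:C)); last first.
    rewrite -rmorph_sum lecR -mulr_suml ler_wpM2r//; lra.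
  apply: ler_sum => l _.
  rewrite (eq_bigr (fun i => (p l * (Re `|w l i| * Re `|T (w l) i|))%:C)) => [|i _].
    rewrite -rmorph_sum lecR -mulr_sumr ler_wpM2l//.
    have h1 : \sum_(i <- F) Re `|w l i| ^+ 2 <= 1 by exact: le_trans (nsq_ge_fset _ _) _.
    have h2 : \sum_(i <- F) Re `|T (w l) i| ^+ 2 <= c.
      apply: le_trans (nsq_ge_fset _ _) _; apply: le_trans (Tc _) _.
      by rewrite ler_piMr.
    apply: le_trans (lerD h1 h2); rewrite -big_split; apply: ler_sum => i _.
    have ab (a b : R) : a * b <= a ^+ 2 + b ^+ 2 by nra.
    exact: ab.
  rewrite /f /= wT -[LHS]ReC_norm; congr (_%:C).
  by rewrite !Re_normM normcJ Re_norm_real ger0_norm.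
have hf := csummable_has_csum sf.
have [_ h1] := has_csum_pair hf; have [_ h2] := has_csum_pair (has_csum_swap hf).
have -> : trace (rho \o T) = csum f.
  rewrite -(has_csumE h1) /trace; congr csum; apply/funext => i.
  rewrite inner_ketl; apply: esym; apply: has_csumE.
  exact: (rhoE (T (ket R i)) i).
apply: eq_has_csum h2 => l; apply: has_csumE; rewrite /f /=; apply: has_csumZ.
rewrite -Tsym; apply: eq_has_csum (has_csum_inner (T (w l)) (w l)) => i.
by rewrite wT mulrC.
Qed.

End matrices.

(** * Displacement operators *)

Section power_series.
Context (R : realType).
Local Notation C := R[i].
Local Notation Re := (@complex.Re R).

Lemma fset_nat_sub (F : {fset nat}) : exists n, (F `<=` [fset i | i in iota 0 n])%fset.
Proof.
exists (\max_(i <- F) i).+1; apply/fsubsetP => i iF.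
have h : (i < (\max_(i <- F) i).+1)%N by rewrite ltnS (big_rem i)//= leq_maxl.
have h2 : i \in iota 0 (\max_(i <- F) i).+1 by rewrite mem_iota; exact: h.
by apply/imfsetP; exists i.
Qed.

Lemma sum_iota_fset (V : nmodType) (f : nat -> V) n :
  \sum_(i <- [fset i | i in iota 0 n]%fset) f i = \sum_(0 <= i < n) f i.
Proof.
rewrite big_imfset//= /index_iota subn0; apply: perm_big; apply: uniq_perm.
- exact: undup_uniq.
- exact: iota_uniq.
by move=> i; rewrite mem_undup.
Qed.

Lemma has_csum_series (p : nat -> R) s : has_csum (fun k => (p k)%:C) s ->
  series p @ \oo --> Re s.
Proof.
move=> [_ /cvg_complexP[h _]].
have -> : series p = (Re \o fset_sum (fun k => (p k)%:C)) \o
    (fun n => [fset i | i in iota 0 n]%fset).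
  by apply/funext => n; rewrite /= /fset_sum Re_sum /= sum_iota_fset.
apply: cvg_comp h => A [F0 _ /= hA].
have [n0 hn0] := fset_nat_sub F0; near=> n; apply: hA => /=.
apply: fsubset_trans hn0 _; apply/fsubsetP => i /imfsetP[j /=].
rewrite mem_iota add0n /= => jn ->; apply/imfsetP; exists j => //=.
by rewrite mem_iota add0n /= (leq_trans jn)//; near: n; exact: nbhs_infty_ge.
Unshelve. all: by end_near. Qed.

Lemma csummable_exp (z : C) : csummable (fun k => z ^+ k / k`!%:R).
Proof.
set x := Re `|z|; have x0 : 0 <= x by exact: Re_norm_ge0.
apply: (@csummable_le _ _ (expR x)) => F.
rewrite (eq_bigr (fun k => exp_coeff x k)) => [|k _]; last first.
  rewrite /exp_coeff; apply: complexI; rewrite ReC_norm normrM normrX normfV normr_nat.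
  by rewrite rmorphM fmorphV rmorphXn /= ReC_norm rmorph_nat.
have [n Fn] := fset_nat_sub F.
apply: (@le_trans _ _ (series (exp_coeff x) n)).
  rewrite /series /= -sum_iota_fset (@fset_sum_incl _ _ F)// lerDl sumr_ge0// => k _.
  exact: exp_coeff_ge0.
apply: nondecreasing_cvgn_le; last exact: is_cvg_series_exp_coeff.
by apply/nondecreasing_series => k _ _; exact: exp_coeff_ge0.
Qed.

Lemma has_csum_exp (x : R) : has_csum (fun k => x%:C ^+ k / k`!%:R) (expR x)%:C.
Proof.
have h := csummable_has_csum (csummable_exp x%:C).
have E : (fun k => x%:C ^+ k / k`!%:R) = (fun k => (exp_coeff x k)%:C).
  by apply/funext => k; rewrite /exp_coeff rmorphM fmorphV rmorphXn /= rmorph_nat.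
move: h; rewrite E => h.
have := has_csum_series h => h2.
have e : Re (csum (fun k => (exp_coeff x k)%:C)) = expR x.
  by apply: cvg_unique h2 _ => //; exact: is_cvg_series_exp_coeff.
rewrite -e (_ : (_)%:C = csum (fun k => (exp_coeff x k)%:C))//.
apply: RRe_real; have [_ /cvg_complexP[_ hi]] := h.
have : complex.Im (csum (fun k => (exp_coeff x k)%:C)) = 0.
  apply: cvg_unique hi _ => //; apply: cvg_near_cst; near=> F.
  by rewrite /= /fset_sum Im_sum big1.
by case: csum => a b /= ->; rewrite complex_real.
Unshelve. all: by end_near. Qed.

End power_series.

Section displacement_matrix.
Context (R : realType).
Local Notation C := R[i].
Local Notation Re := (@complex.Re R).
Implicit Types (x y : nat -> C) (z w : C) (j k l m : nat).

Local Notation s k := ((Num.sqrt k%:R)%:C : C).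
(** Evaluation at the predecessor, with value 0 at k = 0, in accordance with a|0> = 0. *)
Local Notation pre f k := (if k is k'.+1 then f k' else 0).

Lemma sqrt_nat_sqr k : s k * s k = k%:R.
Proof. by rewrite -rmorphM /= -expr2 sqr_sqrtr// rmorph_nat. Qed.

Lemma sqrt_natS_neq0 k : s k.+1 != 0.
Proof.
apply/eqP => h; have := sqrt_nat_sqr k.+1; rewrite h mul0r => /eqP.
by rewrite eq_sym pnatr_eq0.
Qed.

Local Notation G := displacement_generator.

Lemma generator_linear z c x y k :
  G z (fun i => c * x i + y i) k = c * G z x k + G z y k.
Proof.
rewrite /displacement_generator /creation /annihilation.
by case: k => [|k]; ring.
Qed.

Lemma generator_iter_linear z j c x y k :
  iter j (G z) (fun i => c * x i + y i) k = c * iter j (G z) x k + iter j (G z) y k.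
Proof.
elim: j k => [//|j IH] k; rewrite !iterS -generator_linear.
by congr (G z _ k); apply/funext => i; exact: IH.
Qed.

Lemma generator_iterZ z j c x k :
  iter j (G z) (fun i => c * x i) k = c * iter j (G z) x k.
Proof.
have -> : (fun i => c * x i) = (fun i => c * x i + (fun=> 0) i).
  by apply/funext => i; rewrite addr0.
rewrite generator_iter_linear (_ : iter j (G z) (fun=> 0) k = 0) ?addr0//.
elim: j k => [//|j IH] k; rewrite iterS.
rewrite (_ : iter _ _ _ = fun=> 0); last by apply/funext => i; exact: IH.
by rewrite /displacement_generator /creation /annihilation; case: k => [|k]; ring.
Qed.

(** [a, G] = z follows from [a, a^+] = 1, which in coordinates says that the squares of sqrt (k+2)
    and sqrt (k+1) differ by 1. On arbitrary sequences no domain question arises. *)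
Lemma annihilation_generator z x k :
  annihilation (G z x) k = G z (annihilation x) k + z * x k.
Proof.
rewrite /displacement_generator /creation /annihilation.
case: k => [|k].
  have h1 := sqrt_nat_sqr 1.
  transitivity (z * (s 1 * s 1) * x 0%N - conjc z * (s 1 * (s 2 * x 2))); first by ring.
  by rewrite h1; ring.
have h1 := sqrt_nat_sqr k.+1; have h2 := sqrt_nat_sqr k.+2.
transitivity (z * (s k.+2 * s k.+2) * x k.+1 - conjc z * (s k.+2 * (s k.+3 * x k.+3))).
  by ring.
transitivity (z * (s k.+1 * s k.+1 + 1) * x k.+1 - conjc z * (s k.+2 * (s k.+3 * x k.+3))).
  by rewrite h1 h2 -[k.+2%:R]natr1.
by ring.
Qed.

Lemma creation_generator z x k :
  creation (G z x) k = G z (creation x) k + conjc z * x k.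
Proof.
rewrite /displacement_generator /creation /annihilation.
case: k => [|k].
  have h1 := sqrt_nat_sqr 1.
  transitivity (conjc z * x 0%N - conjc z * (s 1 * s 1) * x 0%N); last by ring.
  by rewrite h1; ring.
have h1 := sqrt_nat_sqr k.+1; have h2 := sqrt_nat_sqr k.+2.
case: k h1 h2 => [|k] h1 h2.
  transitivity (- conjc z * (s 1 * s 1) * x 1); first by ring.
  transitivity (- conjc z * (s 2 * s 2 - 1) * x 1); last by ring.
  by rewrite h1 h2; ring.
transitivity (z * (s k.+2 * (s k.+1 * x k)) - conjc z * (s k.+2 * s k.+2) * x k.+2).
  by ring.
transitivity (z * (s k.+2 * (s k.+1 * x k)) - conjc z * (s k.+3 * s k.+3 - 1) * x k.+2).
  by rewrite h1 h2 -[k.+3%:R]natr1; ring.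
by ring.
Qed.

(* If [c, G] = t then [c, G^j] = t j G^(j-1). *)
Lemma commutator_iter (c : (nat -> C) -> nat -> C) z (t : C) :
  (forall x y a k, c (fun i => a * x i + y i) k = a * c x k + c y k) ->
  (forall x k, c (G z x) k = G z (c x) k + t * x k) ->
  forall j x k, c (iter j (G z) x) k =
    iter j (G z) (c x) k + t * (j%:R * iter j.-1 (G z) x k).
Proof.
move=> clin hc; elim=> [|j IH] x k; first by rewrite /= mul0r mulr0 addr0.
rewrite !iterS hc /=.
rewrite (_ : c _ = fun i => (t * j%:R) * iter j.-1 (G z) x i + iter j (G z) (c x) i).
  rewrite generator_linear -iterS -natr1; case: j {IH} => [|j] /=; ring.
by apply/funext => i; rewrite IH; ring.
Qed.

Definition exp_term z j m k : C := iter j (G z) (ket R k) m / j`!%:R.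

Lemma exp_termS z j m k : iter j (G z) (ket R k) m * j.+1%:R / j.+1`!%:R = exp_term z j m k.
Proof.
rewrite /exp_term factS natrM; field.
by rewrite pnatr_eq0 -lt0n fact_gt0 /= nat1r pnatr_eq0.
Qed.

Lemma annihilation_ket k : annihilation (ket R k) = (fun i => s k * pre (fun k' => ket R k' i) k).
Proof.
apply/funext => i; rewrite /annihilation ketE.
case: k => [|k]; first by rewrite /= !mulr0.
by rewrite ketE eqSS; case: eqP => [->//|_]; rewrite !mulr0.
Qed.

Lemma creation_ket k : creation (ket R k) = (fun i => s k.+1 * ket R k.+1 i).
Proof.
apply/funext => -[|i]; rewrite /creation ketE ?mulr0// ketE eqSS.
by case: eqP => [->//|_]; rewrite !mulr0.
Qed.

(** The commutator of a with G^j / j! at entry (m, k): a on the left raises the row index, a on the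
    right lowers the column index. *)
Lemma exp_term_row z j m k :
  s m.+1 * exp_term z j m.+1 k =
  s k * pre (fun k' => exp_term z j m k') k + z * pre (fun j' => exp_term z j' m k) j.
Proof.
have := @commutator_iter (@annihilation R) z z.
have clin x y a i : annihilation (fun i => a * x i + y i) i =
    a * annihilation x i + annihilation y i by rewrite /annihilation; ring.
move=> /(_ clin (annihilation_generator z) j (ket R k) m) h.
rewrite {1}/exp_term mulrA.
have -> : s m.+1 * iter j (G z) (ket R k) m.+1 = annihilation (iter j (G z) (ket R k)) m by [].
rewrite h annihilation_ket generator_iterZ mulrDl; congr (_ + _).
  case: k {h} => [|k]; last by rewrite /exp_term mulrA.
  have -> : (fun=> 0 : C) = (fun i => 0 * (ket R 0%N) i) by apply/funext => i; rewrite mul0r.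
  by rewrite generator_iterZ mul0r mulr0 mul0r.
case: j {h} => [|j]; first by rewrite mul0r mulr0 mul0r.
by rewrite -exp_termS /=; ring.
Qed.

Lemma exp_term_col z j m k :
  s k.+1 * exp_term z j m k.+1 =
  s m * pre (fun m' => exp_term z j m' k) m - conjc z * pre (fun j' => exp_term z j' m k) j.
Proof.
have := @commutator_iter (@creation R) z (conjc z).
have clin x y a i : creation (fun i => a * x i + y i) i =
    a * creation x i + creation y i by rewrite /creation; case: i => [|i]; ring.
move=> /(_ clin (creation_generator z) j (ket R k) m).
rewrite creation_ket generator_iterZ => h.
have -> : s k.+1 * exp_term z j m k.+1 =
    (s k.+1 * iter j (G z) (ket R k.+1) m) / j`!%:R by rewrite mulrA.
have -> : s k.+1 * iter j (G z) (ket R k.+1) m =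
   creation (iter j (G z) (ket R k)) m - conjc z * (j%:R * iter j.-1 (G z) (ket R k) m).
  by rewrite h addrK.
rewrite mulrBl; congr (_ - _).
  by case: m {h} => [|m]; rewrite /creation ?mul0r ?mulr0// /exp_term mulrA.
case: j {h} => [|j]; first by rewrite mul0r mulr0 mul0r.
by rewrite -exp_termS /=; ring.
Qed.

Definition normsq z : R := Re `|z| ^+ 2.

Lemma normsqC z : (normsq z)%:C = conjc z * z.
Proof. by rewrite conj_mul_self. Qed.

Lemma oppnormsqC z : (- normsq z)%:C = - (conjc z * z).
Proof. by rewrite -normsqC -rmorphN. Qed.

Lemma exp_term00_rec z j :
  exp_term z j.+1 0 0 = z / j.+1%:R * exp_term z j 0 1.
Proof.
rewrite /exp_term iterSr.
have -> : G z (ket R 0%N) = (fun i => z * ket R 1%N i).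
  apply/funext => i; rewrite /displacement_generator annihilation_ket creation_ket mulr0 mulr0 subr0.
  by rewrite sqrtr1 mul1r.
rewrite generator_iterZ factS natrM; field.
by rewrite pnatr_eq0 -lt0n fact_gt0 /= nat1r pnatr_eq0.
Qed.

(** G|0> = z|1>, and [exp_term_col] brings <0|G^j|1> back to <0|G^(j-1)|0>. This two-step recursion
    kills the odd terms and turns the even ones into the series of exp(-|z|^2 / 2). *)
Lemma exp_term00 z r : exp_term z r.*2 0 0 = ((- normsq z / 2) %:C) ^+ r / r`!%:R /\
  exp_term z r.*2.+1 0 0 = 0.
Proof.
have c1 j : exp_term z j 0 1 = - conjc z * pre (fun j' => exp_term z j' 0 0) j.
  by have := exp_term_col z j 0 0; rewrite sqrtr1 mul1r mulr0 sub0r mulNr.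
have step j : exp_term z j.+2 0 0 = (- normsq z)%:C / j.+2%:R * exp_term z j 0 0.
  rewrite exp_term00_rec c1 oppnormsqC; ring.
elim: r => [|r [IH1 IH2]].
  split; first by rewrite /exp_term /= ketE expr0.
  by rewrite exp_term00_rec c1 !mulr0.
split; last by rewrite doubleS step IH2 mulr0.
rewrite doubleS step IH1 factS natrM exprSr.
have -> : (r.*2.+2)%:R = 2 * r.+1%:R :> C by rewrite -mul2n -natrM mulnS addnC addn2.
rewrite rmorphM fmorphV rmorph_nat; field.
rewrite pnatr_eq0 -lt0n fact_gt0 /=; by rewrite nat1r !pnatr_eq0.
Qed.

Lemma has_csum_exp_term00 z : has_csum (fun j => exp_term z j 0 0) (expR (- normsq z / 2))%:C.
Proof.
apply/(@has_csum_inj _ _ _ double).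
- by move=> i j h; rewrite -(doubleK i) h doubleK.
- move=> j hj; rewrite -(odd_double_half j); case: (boolP (odd j)) => o.
    by rewrite add1n; have [] := exp_term00 z j./2.
  by case: (hj j./2); rewrite -{2}(odd_double_half j) (negbTE o).
apply: eq_has_csum (has_csum_exp _) => r /=.
by have [->] := exp_term00 z r.
Qed.

Definition displacement_matrix z m k : C := csum (fun j => exp_term z j m k).
Local Notation D := displacement_matrix.

Lemma has_csum_scale_inv (f : nat -> C) a S : a != 0 ->
  has_csum (fun j => a * f j) S -> has_csum f (a^-1 * S).
Proof.
move=> a0 h; apply: eq_has_csum (has_csumZ a^-1 h) => j.
by rewrite mulrA mulVf// mul1r.
Qed.

(** Summability spreads from the vacuum entry along the row and column recursions, dividing by a
    nonzero square root each time; the powers of G are never estimated. *)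
Lemma has_csum_displacement z m k : has_csum (fun j => exp_term z j m k) (D z m k).
Proof.
apply: csummable_has_csum; elim: k m => [|k IH] m.
  elim: m => [|m IH]; first by case: (has_csum_exp_term00 z).
  have [] := @has_csum_scale_inv (fun j => exp_term z j m.+1 0) (s m.+1) (z * D z m 0)
    (sqrt_natS_neq0 m); last by [].
  apply: eq_has_csum (has_csumZ z (has_csum_shift (csummable_has_csum IH))) => j.
  by rewrite exp_term_row mulr0 add0r.
have h := has_csum_shift (csummable_has_csum (IH m)).
have h1 : has_csum (fun j => pre (fun m' => exp_term z j m' k) m) (pre (fun m' => D z m' k) m).
  by case: m {h} => [|m]; [exact: has_csum0 | exact: csummable_has_csum].
have [] := @has_csum_scale_inv (fun j => exp_term z j m k.+1) (s k.+1)
  (s m * pre (fun m' => D z m' k) m - conjc z * D z m k) (sqrt_natS_neq0 k); last by [].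
apply: eq_has_csum (has_csumB (has_csumZ (s m) h1) (has_csumZ (conjc z) h)) => j.
by rewrite exp_term_col.
Qed.

Lemma displacement00 z : D z 0 0 = (expR (- normsq z / 2))%:C.
Proof. exact/has_csumE/has_csum_exp_term00. Qed.

(* [a, exp G] = z exp G, read on matrix entries. *)
Lemma displacement_row z m k :
  s m.+1 * D z m.+1 k = s k * pre (fun k' => D z m k') k + z * D z m k.
Proof.
apply: has_csum_unique (has_csumZ _ (has_csum_displacement z m.+1 k)) _.
have h1 : has_csum (fun j => pre (fun k' => exp_term z j m k') k) (pre (fun k' => D z m k') k).
  by case: k => [|k]; [exact: has_csum0 | exact: has_csum_displacement].
apply: eq_has_csum (has_csumD (has_csumZ (s k) h1)
  (has_csumZ z (has_csum_shift (has_csum_displacement z m k)))) => j.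
by rewrite exp_term_row.
Qed.

(* [a^+, exp G] = conj(z) exp G. *)
Lemma displacement_col z m k :
  s k.+1 * D z m k.+1 = s m * pre (fun m' => D z m' k) m - conjc z * D z m k.
Proof.
apply: has_csum_unique (has_csumZ _ (has_csum_displacement z m k.+1)) _.
have h1 : has_csum (fun j => pre (fun m' => exp_term z j m' k) m) (pre (fun m' => D z m' k) m).
  by case: m => [|m]; [exact: has_csum0 | exact: has_csum_displacement].
apply: eq_has_csum (has_csumB (has_csumZ (s m) h1)
  (has_csumZ (conjc z) (has_csum_shift (has_csum_displacement z m k)))) => j.
by rewrite exp_term_col.
Qed.

Lemma normsqN z : normsq (- z) = normsq z. Proof. by rewrite /normsq normrN. Qed.

Lemma conjcM z w : conjc (z * w) = conjc z * conjc w. Proof. exact: rmorphM. Qed.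
Lemma conjcB z w : conjc (z - w) = conjc z - conjc w. Proof. exact: rmorphB. Qed.

(** Conjugation exchanges the column recursion at z with the row recursion at -z, so induction from
    the real vacuum entry suffices. *)
Lemma displacement_conj z m k : D (- z) m k = conjc (D z k m).
Proof.
elim: m k => [|m IH] k.
  elim: k => [|k IH]; first by rewrite !displacement00 normsqN conjc_real.
  apply: (mulfI (sqrt_natS_neq0 k)).
  have h := congr1 (@conjc R) (displacement_row z k 0).
  rewrite mulr0 add0r !conjcM conjc_real in h.
  by rewrite displacement_col mulr0 sub0r IH h raddfN; ring.
apply: (mulfI (sqrt_natS_neq0 m)).
have h := congr1 (@conjc R) (displacement_col z k m).
rewrite conjcM conjcB !conjcM !conjc_real conjcK in h.
rewrite displacement_row IH h mulNr; congr (_ * _ - _).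
by case: k {h} => [|k]; rewrite ?conjc0 ?IH.
Qed.

Lemma displacement_id m k : D 0 m k = (m == k)%:R.
Proof.
elim: m k => [|m IH] k.
  case: k => [|k]; first by rewrite displacement00 /normsq normr0 expr0n oppr0 mul0r expR0.
  apply: (mulfI (sqrt_natS_neq0 k)).
  by rewrite displacement_col mulr0 conjc0 mul0r subr0 mulr0.
apply: (mulfI (sqrt_natS_neq0 m)); rewrite displacement_row mul0r addr0.
case: k => [|k]; first by rewrite !mulr0.
by rewrite IH eqSS; case: eqP => [->//|_]; rewrite !mulr0.
Qed.

(** The scalar relating D(z) D(w) to D(z + w), read off at the vacuum entry. It is exp((z conj(w) -
    conj(z) w) / 2); below only its value at (z, -z) and the modulus of its n-th power matter. *)
Definition weyl_phase z w : C := csum (fun k => D z 0 k * D w k 0) / D (z + w) 0 0.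

Lemma displacement00_neq0 z : D z 0 0 != 0.
Proof.
rewrite displacement00 -(rmorph0 (real_complex R)) (inj_eq (@complexI R)).
by rewrite gt_eqF ?expR_gt0.
Qed.

(** The two factors are coherent-state amplitudes, each carrying 1 / sqrt(k!), so the product is a
    term of an exponential series. *)
Lemma displacement_prod00 z w k : D z 0 k * D w k 0 =
  D z 0 0 * D w 0 0 * ((- conjc z * w) ^+ k / k`!%:R).
Proof.
elim: k => [|k IH]; first by rewrite expr0 divr1 mulr1.
have k0 : k.+1%:R != 0 :> C by rewrite pnatr_eq0.
apply: (mulfI k0); rewrite -{1}sqrt_nat_sqr.
transitivity ((s k.+1 * D z 0 k.+1) * (s k.+1 * D w k.+1 0)); first by ring.
rewrite displacement_col displacement_row !mulr0 !add0r.
transitivity (- conjc z * w * (D z 0 k * D w k 0)); first by ring.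
rewrite IH exprS factS natrM; field.
by rewrite pnatr_eq0 -lt0n fact_gt0 /= nat1r k0.
Qed.

Lemma has_csum_displacement00 z w :
  has_csum (fun k => D z 0 k * D w k 0) (weyl_phase z w * D (z + w) 0 0).
Proof.
rewrite /weyl_phase mulfVK ?displacement00_neq0//; apply: csummable_has_csum.
have [] := has_csumZ (D z 0 0 * D w 0 0) (csummable_has_csum (csummable_exp (- conjc z * w))).
move=> h _; apply: csummable_dom h => k; by rewrite displacement_prod00.
Qed.

(** Both sides obey the row and column recursions of parameter z + w, so the equality at (0, 0),
    which defines the phase, propagates to all entries. *)
Lemma weyl z w m l :
  has_csum (fun k => D z m k * D w k l) (weyl_phase z w * D (z + w) m l).
Proof.
elim: l m => [|l IH] m.
  elim: m => [|m IH]; first exact: has_csum_displacement00.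
  have -> : weyl_phase z w * D (z + w) m.+1 0 =
      (s m.+1)^-1 * (w * (weyl_phase z w * D (z + w) m 0) + z * (weyl_phase z w * D (z + w) m 0)).
    apply: (mulfI (sqrt_natS_neq0 m)); rewrite mulVKf ?sqrt_natS_neq0//.
    by rewrite mulrCA displacement_row mulr0; ring.
  apply: has_csum_scale_inv; first exact: sqrt_natS_neq0.
  (* The row recursion of the left factor produces sqrt k times D z m (k-1) times D w k 0; the row
     recursion of the right factor turns this into w times the term of index k-1. *)
  apply: eq_has_csum (has_csumD (has_csumZ w (has_csum_shift IH)) (has_csumZ z IH)) => k.
  rewrite [RHS]mulrA displacement_row [RHS]mulrDl -[X in _ = _ + X]mulrA; congr (_ + _).
  case: k => [|k]; first by rewrite !(mulr0, mul0r).
  by rewrite -mulrA [RHS]mulrCA displacement_row mulr0 add0r mulrCA.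
have -> : weyl_phase z w * D (z + w) m l.+1 = (s l.+1)^-1 *
   ((s m * (pre (fun m' => weyl_phase z w * D (z + w) m' l) m)
     - conjc z * (weyl_phase z w * D (z + w) m l)) - conjc w * (weyl_phase z w * D (z + w) m l)).
  apply: (mulfI (sqrt_natS_neq0 l)); rewrite mulVKf ?sqrt_natS_neq0//.
  rewrite mulrCA displacement_col rmorphD; case: m => [|m]; ring.
apply: has_csum_scale_inv; first exact: sqrt_natS_neq0.
have h1 : has_csum (fun k => pre (fun m' => D z m' k * D w k l) m)
    (pre (fun m' => weyl_phase z w * D (z + w) m' l) m).
  by case: m => [|m]; [exact: has_csum0 | exact: IH].
(* The column recursion of the right factor brings in sqrt k times D w (k-1) l. Shifted by one this
   is the present series, to which the column recursion of the left factor applies. *)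
have h2 : has_csum (fun k => s k.+1 * D z m k.+1 * D w k l)
    (s m * (pre (fun m' => weyl_phase z w * D (z + w) m' l) m)
     - conjc z * (weyl_phase z w * D (z + w) m l)).
  apply: eq_has_csum (has_csumB (has_csumZ (s m) h1) (has_csumZ (conjc z) (IH m))) => k.
  by rewrite displacement_col; case: m {h1} => [|m]; ring.
apply: eq_has_csum (has_csumB (has_csum_shift h2) (has_csumZ (conjc w) (IH m))) => k.
rewrite [RHS]mulrCA displacement_col; case: k => [|k]; by ring.
Qed.

(** The vacuum sum is exp(-|z|^2) times the series of exp(|z|^2). *)
Lemma weyl_phaseN z : weyl_phase z (- z) = 1.
Proof.
have h := has_csum_displacement00 z (- z).
rewrite subrr displacement_id eqxx mulr1 in h; apply: has_csum_unique h _.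
have -> : 1 = D z 0 0 * D (- z) 0 0 * (expR (normsq z))%:C.
  rewrite !displacement00 normsqN -!rmorphM /= -!expRD.
  by rewrite (_ : _ + _ = 0) ?expR0//; field.
apply: eq_has_csum (has_csumZ _ (has_csum_exp (normsq z))) => k.
by rewrite [RHS]displacement_prod00 normsqC mulrNN.
Qed.

Lemma displacement_unitary z m l :
  has_csum (fun k => D z m k * D (- z) k l) (m == l)%:R.
Proof. by have := weyl z (- z) m l; rewrite weyl_phaseN subrr displacement_id mul1r. Qed.

End displacement_matrix.

(* Unification would otherwise compare vectors by unfolding their l^2 sums. *)
Opaque ket toell2 op_of_matrix.

Section operator_matrix.
Context (R : realType) (I : choiceType).
Local Notation C := R[i].
Local Notation H := (ell2 R I).
Local Notation Re := (@complex.Re R).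

Lemma operator_matrix_bounded (T : H -> H) (c : R) : linear T -> nsq_bounded T c ->
  matrix_bounded (fun i j => inner (ket R i) (T (ket R j))) c.
Proof.
move=> linT Tc F G x y; rewrite -!nsq_finite_vector.
have [s b] := operator_form linT (@id_linear R I) Tc (@id_nsq_bounded R I).
have -> : \sum_(i <- F) \sum_(j <- G) conjc (x i) * inner (ket R i) (T (ket R j)) * y j =
    (fun u v => inner (idfun u) (T v)) (finite_vector F x) (finite_vector G y).
  rewrite (form_suml s); apply: eq_bigr => i _; rewrite (form_sumr s).
  by apply: eq_bigr => j _; rewrite (formZl s) (formZr s) /=; ring.
by have := b (finite_vector F x) (finite_vector G y); rewrite mulr1.
Qed.

Lemma op_of_matrixK (T : H -> H) (c : R) : linear T -> nsq_bounded T c ->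
  op_of_matrix (fun i j => inner (ket R i) (T (ket R j))) = T.
Proof.
move=> linT Tc; have mT := operator_matrix_bounded linT Tc; have [c0 _] := Tc.
have lT := op_of_matrix_linear c0 mT; have bT := op_of_matrix_nsq c0 mT.
have [s1 b1] := operator_form lT (@id_linear R I) bT (@id_nsq_bounded R I).
have [s2 b2] := operator_form linT (@id_linear R I) Tc (@id_nsq_bounded R I).
apply/funext => v; apply: inner_extr => u.
apply: (form_eq_ket s1 s2 b1 b2) => i j.
by rewrite [LHS]inner_ketl (op_of_matrix_ket c0 mT).
Qed.

End operator_matrix.

Section collective_displacement.
Context (R : realType).
Local Notation C := R[i].
Local Notation Re := (@complex.Re R).
Local Notation D := (@displacement_matrix R).
Implicit Types z w : C.

Let DN z i j : D (- z) i j = conjc (D z j i). Proof. exact: displacement_conj. Qed.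
Let Dcol z i j : has_csum (fun k => D (- z) i k * D z k j) (i == j)%:R.
Proof. by have := displacement_unitary (- z) i j; rewrite opprK. Qed.

Lemma displacement_linear z : linear (displacement z).
Proof. exact: (unitary_linear (DN z) (Dcol z)). Qed.
Lemma displacement_nsq_bounded z : nsq_bounded (displacement z) 1.
Proof. exact: (unitary_nsq_bounded (DN z) (Dcol z)). Qed.
Lemma displacement_ket z i j : displacement z (ket R j) i = D z i j.
Proof. exact: (unitary_ket (DN z) (Dcol z)). Qed.
Lemma displacement_adjoint z : adjoint (displacement z) = displacement (- z).
Proof.
apply: adjointE => u v.
exact: (unitary_adjoint (DN z) (Dcol z) (displacement_unitary z)).
Qed.

Variable n : nat.
Local Notation J := {ffun 'I_n -> nat}.
Local Notation H := (modes R n).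

Definition tensor_displacement z (m k : J) : C := \prod_(i < n) D z (m i) (k i).
Local Notation W := tensor_displacement.

Lemma tensor_displacement_conj z m k : W (- z) m k = conjc (W z k m).
Proof.
rewrite /tensor_displacement rmorph_prod; apply: eq_bigr => i _.
exact: displacement_conj.
Qed.

(** Sums over multi-indices factor over the modes, and each mode contributes one phase. *)
Lemma tensor_displacement_weyl z w m l :
  has_csum (fun k => W z m k * W w k l) (weyl_phase z w ^+ n * W (z + w) m l).
Proof.
have := has_csum_ffun (fun i => weyl z w (m i) (l i)).
rewrite big_split /= prodr_const card_ord; apply: eq_has_csum => k.
by rewrite big_split.
Qed.

Lemma tensor_displacement_unitary z m l :
  has_csum (fun k => W z m k * W (- z) k l) (m == l)%:R.
Proof.
have := tensor_displacement_weyl z (- z) m l.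
rewrite weyl_phaseN subrr expr1n mul1r.
rewrite (_ : W 0 m l = (m == l)%:R)//.
rewrite /tensor_displacement; have [->|ml] := eqVneq m l.
  by rewrite big1// => i _; rewrite displacement_id eqxx.
have [i mli] : exists i, m i != l i.
  apply/existsP; rewrite -negb_forall; apply: contra ml => /forallP h.
  by apply/eqP/ffunP => i; apply/eqP.
by rewrite (bigD1 i)//= displacement_id (negbTE mli) mul0r.
Qed.

Let WN z i j : W (- z) i j = conjc (W z j i). Proof. exact: tensor_displacement_conj. Qed.
Let Wcol z i j : has_csum (fun k => W (- z) i k * W z k j) (i == j)%:R.
Proof. by have := tensor_displacement_unitary (- z) i j; rewrite opprK. Qed.

Definition collective z : H -> H := tensor_power n (displacement z).

Lemma collectiveE z : collective z = op_of_matrix (W z).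
Proof.
rewrite /collective /tensor_power; congr op_of_matrix.
apply/funext => m; apply/funext => k; apply: eq_bigr => i _.
by rewrite inner_ketl displacement_ket.
Qed.

Lemma collective_linear z : linear (collective z).
Proof. rewrite collectiveE; exact: (unitary_linear (WN z) (Wcol z)). Qed.
Lemma collective_nsq_bounded z : nsq_bounded (collective z) 1.
Proof. rewrite collectiveE; exact: (unitary_nsq_bounded (WN z) (Wcol z)). Qed.
Lemma collective_ket z i j : collective z (ket R j) i = W z i j.
Proof. rewrite collectiveE; exact: (unitary_ket (WN z) (Wcol z)). Qed.
Lemma inner_collectiveN z u v : inner (collective (- z) u) v = inner u (collective z v).
Proof.
rewrite !collectiveE.
exact: (unitary_adjoint (WN z) (Wcol z) (tensor_displacement_unitary z)).
Qed.
Lemma collective_adjoint z : adjoint (collective z) = collective (- z).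
Proof. by apply: adjointE => u v; exact: inner_collectiveN. Qed.
Lemma collectiveK z u : collective z (collective (- z) u) = u.
Proof.
rewrite !collectiveE.
exact: (unitary_comp (WN z) (Wcol z) (tensor_displacement_unitary z)).
Qed.

Opaque collective.

Lemma collectiveD z u v : collective z (u + v) = collective z u + collective z v.
Proof. by have [h _] := linearP2 (collective_linear z). Qed.
Lemma collectiveZ z a u : collective z (a *: u) = a *: collective z u.
Proof. by have [_ h] := linearP2 (collective_linear z). Qed.

Lemma inner_collective z u v : inner (collective z u) (collective z v) = inner u v.
Proof.
by rewrite -inner_collectiveN; have := collectiveK (- z) u; rewrite opprK => ->.
Qed.

Lemma nsq_collective z u : nsq (collective z u) = nsq u.
Proof. by rewrite /nsq inner_collective. Qed.

Lemma collective_comp z w u :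
  collective z (collective w u) = weyl_phase z w ^+ n *: collective (z + w) u.
Proof.
apply: inner_extr => v.
have s := inner_sesquilinear R J.
rewrite (formZr s) -inner_collectiveN.
have [s1 b1] := operator_form (collective_linear w) (collective_linear (- z))
  (collective_nsq_bounded w) (collective_nsq_bounded (- z)).
set c := weyl_phase z w ^+ n.
have lT : linear (fun u => c *: collective (z + w) u).
  move=> a x y; rewrite collectiveD collectiveZ scalerDr !scalerA.
  by rewrite mulrC.
have bT : nsq_bounded (fun u => c *: collective (z + w) u) (Re `|c| ^+ 2).
  split; first exact: sqr_ge0.
  move=> x; rewrite le_eqVlt; apply/orP; left; apply/eqP.
  rewrite -(nsq_collective (z + w) x); apply: complexI; rewrite nsqC rmorphM /= nsqC.
  by rewrite (formZl s) (formZr s) mulrA conj_mul_self.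
have [s2 b2] := operator_form lT (@id_linear R J) bT (@id_nsq_bounded R J).
have e := form_eq_ket s1 s2 b1 b2 _ v u.
rewrite -(formZr s); apply: e => i j.
rewrite [RHS]inner_ketl ell2Z collective_ket; apply: has_csumE.
apply: eq_has_csum (tensor_displacement_weyl z w i j) => k.
have e1 := collective_ket (- z) k i; have e2 := collective_ket w k j.
congr (_ * _); last exact: esym e2.
transitivity (conjc (W (- z) k i)); first by rewrite tensor_displacement_conj conjcK.
by congr conjc; exact: esym e1.
Qed.

Lemma nsqZ (a : C) (u : H) : nsq (a *: u) = Re `|a| ^+ 2 * nsq u.
Proof.
have s := inner_sesquilinear R J; apply: complexI; rewrite nsqC rmorphM /= nsqC.
by rewrite (formZl s) (formZr s) mulrA conj_mul_self.
Qed.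

(** Collective displacements are isometric, so comparing norms on one unit vector, here the vacuum,
    is enough. *)
Lemma weyl_phase_norm z w : Re `|weyl_phase z w ^+ n| ^+ 2 = 1.
Proof.
pose k0 : J := [ffun=> 0%N].
set c := weyl_phase z w ^+ n; set e := ket R k0.
have e1 x : nsq (collective x e) = 1 by exact: etrans (nsq_collective x e) (nsq_ket R k0).
have h1 : nsq (c *: collective (z + w) e) = 1.
  have <- : collective z (collective w e) = c *: collective (z + w) e.
    exact: collective_comp.
  exact: etrans (nsq_collective z (collective w e)) (e1 w).
by have := nsqZ c (collective (z + w) e); rewrite h1 e1 mulr1 => <-.
Qed.

End collective_displacement.

(** * Thermal states as mixtures of displaced number states *)

Section thermal_states.
Context (R : realType).
Local Notation C := R[i].
Local Notation Re := (@complex.Re R).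
Implicit Types (z : C) (N : R).

Definition thermal_weight N (k : nat) : R := (N + 1)^-1 * (N / (N + 1)) ^+ k.

Lemma thermal_weight_ge0 N k : 0 < N -> 0 <= thermal_weight N k.
Proof.
by move=> N0; rewrite mulr_ge0 ?exprn_ge0 ?invr_ge0 ?divr_ge0 ?addr_ge0 ?ltW.
Qed.

Lemma thermal_weight_sum N (F : {fset nat}) : 0 < N -> \sum_(k <- F) thermal_weight N k <= 1.
Proof.
move=> N0; have [n Fn] := fset_nat_sub F.
apply: (@le_trans _ _ (\sum_(0 <= k < n) thermal_weight N k)).
  rewrite -sum_iota_fset (@fset_sum_incl _ _ F)// lerDl sumr_ge0// => k _.
  exact: thermal_weight_ge0.
suff -> : \sum_(0 <= k < n) thermal_weight N k = 1 - (N / (N + 1)) ^+ n.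
  by rewrite gerBl exprn_ge0// divr_ge0 ?addr_ge0 ?ltW.
have N1 : N + 1 != 0 by rewrite gt_eqF// addr_gt0.
elim: n {Fn} => [|n IH]; first by rewrite big_nil expr0 subrr.
by rewrite big_nat_recr//= IH /thermal_weight exprSr; field.
Qed.

Lemma thermal_weight_le1 N k : 0 < N -> thermal_weight N k <= 1.
Proof. by move=> N0; have := @thermal_weight_sum N [fset k]%fset N0; rewrite big_seq_fset1. Qed.

Section diagonal.
Variables (I : choiceType) (p : I -> R).
Hypotheses (p0 : forall i, 0 <= p i) (p1 : forall i, p i <= 1).
Local Notation H := (ell2 R I).

Definition diagonal (u : H) : H := toell2 (fun i => (p i)%:C * u i).

Let diag_bound (u : H) (F : {fset I}) :
  \sum_(i <- F) Re `|(p i)%:C * u i| ^+ 2 <= nsq u.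
Proof.
apply: le_trans (nsq_ge_fset u F); apply: ler_sum => i _.
rewrite Re_normM Re_norm_real exprMn ler_piMl ?sqr_ge0// ger0_norm//.
by rewrite expr_le1.
Qed.

Lemma diagonalE u i : diagonal u i = (p i)%:C * u i.
Proof. by rewrite /diagonal (toell2E (diag_bound u)). Qed.

Lemma diagonal_linear : linear diagonal.
Proof.
move=> a u v; apply: ell2_ext => i.
by rewrite diagonalE !ell2D !ell2Z !diagonalE mulrDr mulrCA.
Qed.

Lemma diagonal_nsq_bounded : nsq_bounded diagonal 1.
Proof.
split=> // u; rewrite mul1r; apply: nsq_le_fset => F.
under eq_bigr do rewrite diagonalE; exact: diag_bound.
Qed.

End diagonal.

Lemma thermalE N (u : mode R) : thermal N u = diagonal (thermal_weight N) u.
Proof. by []. Qed.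

Section collective_states.
Variable n : nat.
Local Notation J := {ffun 'I_n -> nat}.
Local Notation H := (modes R n).

Definition joint_weight N (l : J) : R := \prod_(i < n) thermal_weight N (l i).

Lemma joint_weight_ge0 N l : 0 < N -> 0 <= joint_weight N l.
Proof. by move=> N0; apply: prodr_ge0 => i _; exact: thermal_weight_ge0. Qed.

Lemma joint_weight_le1 N l : 0 < N -> joint_weight N l <= 1.
Proof.
move=> N0; apply: prodr_ile1 => i _.
by rewrite thermal_weight_ge0// thermal_weight_le1.
Qed.

Lemma joint_weight_sum N : 0 < N -> exists M, forall F : {fset J}, \sum_(l <- F) joint_weight N l <= M.
Proof.
move=> N0.
have h : has_csum (fun k => (thermal_weight N k)%:C) (csum (fun k => (thermal_weight N k)%:C)).
  apply: csummable_has_csum; apply: (@csummable_le _ _ 1) => F.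
  apply: le_trans (@thermal_weight_sum N F N0); rewrite le_eqVlt; apply/orP; left; apply/eqP.
  by apply: eq_bigr => k _; rewrite Re_norm_real ger0_norm// thermal_weight_ge0.
have [/csummableP[M _ hM] _] := has_csum_ffun (fun i : 'I_n => h).
exists M => F; apply: le_trans (hM F); apply: ler_sum => l _.
by rewrite -rmorph_prod Re_norm_real ler_norm.
Qed.

Lemma displaced_thermal_matrix z N i k : 0 < N ->
  has_csum (fun l => displacement_matrix z i l * ((thermal_weight N l)%:C *
     displacement_matrix (- z) l k))
    (inner (ket R i) (displaced_thermal z N (ket R k))).
Proof.
move=> N0; rewrite /displaced_thermal displacement_adjoint /= inner_ketl.
have m := operator_matrix_bounded (displacement_linear z) (displacement_nsq_bounded z).
have h := has_csum_op_of_matrix ler01 m (thermal N (displacement (- z) (ket R k))) i.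
rewrite (op_of_matrixK (displacement_linear z) (displacement_nsq_bounded z)) in h.
apply: eq_has_csum h => l.
rewrite inner_ketl displacement_ket thermalE diagonalE ?displacement_ket// => j.
- exact: thermal_weight_ge0.
- exact: thermal_weight_le1.
Qed.

Local Notation U := (@collective R n).

(** [rho] is assembled from collective operators, for which the mixture is immediate; its matrix
    entries factor over the modes by [has_csum_ffun], which identifies it with the tensor power of
    the one-mode state. *)
Lemma collective_state_mixture z N (v : H) i : 0 < N ->
  has_csum (fun l => (joint_weight N l)%:C * (U z (ket R l) i * inner (U z (ket R l)) v))
    (tensor_power n (displaced_thermal z N) v i).
Proof.
move=> N0; pose rho u := U z (diagonal (joint_weight N) (U (- z) u)).
have p0 l := @joint_weight_ge0 N l N0; have p1 l := @joint_weight_le1 N l N0.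
have rhoL : linear rho.
  by move=> a x y; rewrite /rho !(collective_linear, diagonal_linear).
have rhoB : nsq_bounded rho 1.
  split=> // u; rewrite /rho nsq_collective; have [_ h] := diagonal_nsq_bounded p0 p1.
  by apply: le_trans (h _) _; rewrite nsq_collective.
have rhoE u j : has_csum (fun l => (joint_weight N l)%:C *
    (U z (ket R l) j * inner (U z (ket R l)) u)) (rho u j).
  have m := operator_matrix_bounded (@collective_linear R n z) (@collective_nsq_bounded R n z).
  rewrite /rho -[X in has_csum _ (ell2_val (X _) j)]
    (op_of_matrixK (@collective_linear R n z) (@collective_nsq_bounded R n z)).
  apply: eq_has_csum (has_csum_op_of_matrix ler01 m _ j) => l.
  rewrite diagonalE// inner_ketl mulrCA; congr (_ * (_ * _)).
  by rewrite -[LHS]inner_ketl -inner_collectiveN opprK.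
suff -> : tensor_power n (displaced_thermal z N) = rho by exact: rhoE.
rewrite -(op_of_matrixK rhoL rhoB) /tensor_power; congr op_of_matrix.
apply/funext => m; apply/funext => k; rewrite inner_ketl.
apply: has_csum_unique (has_csum_ffun (fun i : 'I_n => displaced_thermal_matrix z (m i) (k i) N0)) _.
apply: eq_has_csum (rhoE _ _) => l.
rewrite /joint_weight inner_ketr !collective_ket -tensor_displacement_conj.
rewrite rmorph_prod /tensor_displacement -!big_split /=; apply: eq_bigr => j _.
by rewrite mulrCA.
Qed.

Lemma trace_collective_state z N (T : H -> H) c : 0 < N -> nsq_bounded T c ->
  (forall u v, inner (T u) v = inner u (T v)) ->
  has_csum (fun l => (joint_weight N l)%:C * inner (U z (ket R l)) (T (U z (ket R l))))
    (trace (tensor_power n (displaced_thermal z N) \o T)).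
Proof.
move=> N0 Tc Tsym; have [M hM] := joint_weight_sum N0.
apply: (trace_mixture _ _ hM _ Tc Tsym) => [l|l|v i].
- by rewrite nsq_collective nsq_ket.
- exact: joint_weight_ge0.
- exact: collective_state_mixture.
Qed.

End collective_states.
End thermal_states.

(** * Measures on a compact metric space *)

Section measure_construction.
Context d (T : measurableType d) (R : realType).
Local Open Scope ereal_scope.
Import HBNNSimple.

(** A measure structure asks for nonnegativity on all sets, while POVM laws are controlled on
    measurable sets only; hence the value 0 elsewhere. *)
Lemma ex_measure (f : set T -> \bar R) : f set0 = 0 ->
  (forall E, measurable E -> 0 <= f E) -> semi_sigma_additive f ->
  exists mu : {measure set T -> \bar R}, forall E, measurable E -> mu E = f E.
Proof.
move=> f0 fge0 fs; pose g E := if `[< measurable E >] then f E else 0.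
have gE E : measurable E -> g E = f E by move=> mE; rewrite /g asboolT.
have g0 : g set0 = 0 by rewrite gE.
have gge0 E : 0 <= g E.
  by rewrite /g; case: asboolP => // mE; exact: fge0.
have gs : semi_sigma_additive g.
  move=> F mF tF mUF; rewrite gE//.
  rewrite (_ : (fun n => _) = (fun n => \sum_(0 <= i < n) f (F i))).
    exact: fs.
  by apply/funext => n; apply: eq_bigr => i _; rewrite gE.
pose gm := isMeasure.Build _ _ _ g g0 gge0 gs.
by exists (HB.pack_for {measure set T -> \bar R} g gm).
Qed.

(** [risk] integrates against a bare set function; this replaces it by a measure, since the integral
    sees only values on measurable sets. *)
Lemma eq_integral_set_function (m1 m2 : set T -> \bar R) (f : T -> \bar R) :
  (forall E, measurable E -> m1 E = m2 E) ->
  \int[m1]_x f x = \int[m2]_x f x.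
Proof.
move=> m12; rewrite /integral.
have e (h : {nnsfun T >-> R}) : sintegral m1 h = sintegral m2 h.
  by apply: eq_fsbigr => r _; rewrite m12.
by congr (ereal_sup _ - ereal_sup _); apply: eq_imagel => h _; rewrite e.
Qed.

(** The enumeration is chosen before the family, so one reordering serves the values of the
    functional and the pointwise sums alike. *)
Lemma nneseries_pair : exists f : nat -> nat * nat,
  forall h : nat -> nat -> \bar R, (forall n m, 0 <= h n m) ->
    \sum_(k <oo) h (f k).1 (f k).2 = \sum_(n <oo) \sum_(m <oo) h n m.
Proof.
have /card_esym/ppcard_eqP[f] := card_nat2; exists f => h h0.
rewrite nneseries_esumT//.
rewrite -(@reindex_esum _ _ _ setT setT f (fun p => h p.1 p.2)); last first.
  by have := 'bij_f.
have -> : [set: nat * nat] = setT `*`` (fun=> setT) by apply/seteqP; split.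
rewrite -(@esum_esum _ _ _ setT (fun=> setT) h)// -nneseries_esumT => [|n].
  by apply: eq_eseriesr => n _; rewrite nneseries_esumT.
exact: esum_ge0.
Qed.

End measure_construction.

Section continuous_functions.
Context (R : realType) (A : pmetricType R).
Implicit Types f g : A -> R.

Lemma continuousD' f g : continuous f -> continuous g -> continuous (fun a => f a + g a).
Proof. by move=> cf cg a; apply: cvgD; [exact: cf|exact: cg]. Qed.
Lemma continuousM' f g : continuous f -> continuous g -> continuous (fun a => f a * g a).
Proof. by move=> cf cg a; apply: cvgM; [exact: cf|exact: cg]. Qed.
Lemma continuousC (c : R) : continuous (fun _ : A => c).
Proof. by move=> a; exact: cvg_cst. Qed.
Lemma continuousZ' c f : continuous f -> continuous (fun a => c * f a).
Proof. by move=> cf; apply: continuousM' => //; exact: continuousC. Qed.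
Lemma continuousN' f : continuous f -> continuous (fun a => - f a).
Proof. by move=> cf a; apply: cvgN; exact: cf. Qed.
Lemma continuousB' f g : continuous f -> continuous g -> continuous (fun a => f a - g a).
Proof. by move=> cf cg; apply: continuousD' => //; exact: continuousN'. Qed.
Lemma continuous_min' f g : continuous f -> continuous g ->
  continuous (fun a => Num.min (f a) (g a)).
Proof. by move=> cf cg a; apply: continuous_min; [exact: cf|exact: cg]. Qed.
Lemma continuous_sum' n (f : nat -> A -> R) : (forall i, continuous (f i)) ->
  continuous (fun a => \sum_(0 <= i < n) f i a).
Proof.
move=> cf; elim: n => [|n IH].
  by under eq_fun do rewrite big_nil; exact: continuousC.
by under eq_fun do rewrite big_nat_recr//=; exact: continuousD'.
Qed.

Lemma continuous_measurable f : continuous f ->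
  measurable_fun [set: borel_type A] (f : borel_type A -> R).
Proof.
move=> /continuousP cf.
apply: (measurability _ (RGenOpens.measurableE R)) => _ [U [x [y ->]] <-].
rewrite setTI; apply: sub_sigma_algebra; apply: cf.
exact: interval_open.
Qed.

(** The functions are min(k d, 1), with d the distance to the complement of U. Starting at 0 makes
    their increments telescope. *)
Lemma open_approx (U : set A) : open U -> exists h : nat -> A -> R,
  [/\ forall k, continuous (h k), forall a, h 0%N a = 0,
    forall k a, 0 <= h k a <= 1, forall k a, h k a <= h k.+1 a &
    (forall k a, ~ U a -> h k a = 0) /\ (forall a, U a -> exists k, h k a = 1)].
Proof.
(* When U is the whole space the distance to its complement is an infimum over the empty set, so
   this case is treated apart. *)
move=> oU; have [[c0 Fc0]|UT] := pselect (exists c, ~ U c); last first.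
  exists (fun k _ => if k is 0%N then 0 else 1); split => //.
  - by move=> k; exact: continuousC.
  - by case=> [|k] a; rewrite ?lexx ?ler01.
  - by case=> [|k] a; rewrite ?lexx ?ler01.
  - by split=> [k a Ua|a Ua]; [case: UT; exists a|exists 1%N].
pose S a := [set mdist a c | c in ~` U].
have S0 a : S a !=set0 by exists (mdist a c0), c0.
have Slb a : has_lbound (S a) by exists 0 => _ [c _ <-]; exact: mdist_ge0.
pose dU a := inf (S a).
have d0 a : 0 <= dU a by apply: lb_le_inf => // _ [c _ <-]; exact: mdist_ge0.
have dtri a b : dU a <= mdist a b + dU b.
  rewrite -lerBlDl; apply: lb_le_inf => // _ [c Uc <-].
  rewrite lerBlDl; apply: le_trans (metric_triangle a b c).
  by apply: ge_inf => //; exists c.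
have cd : continuous dU.
  move=> a; apply/cvgrPdist_lt => e e0; near=> b.
  have ab : mdist a b < e.
    have : ball a e b by near: b; exact: nbhsx_ballx.
    by rewrite ballEmdist.
  rewrite ltr_norml; have := dtri a b; have := dtri b a.
  rewrite (metric_sym b a) => h1 h2; apply/andP; split; lra.
have dz a : ~ U a -> dU a = 0.
  move=> Ua; apply/eqP; rewrite eq_le d0 andbT; apply: ge_inf => //.
  by exists a => //; exact: mdistxx.
have dp a : U a -> 0 < dU a.
  move=> Ua; have /nbhs_ballP[e /= e0 eU] := open_nbhs_nbhs (conj oU Ua).
  apply: lt_le_trans e0 _; apply: lb_le_inf => // _ [c Uc <-].
  by rewrite leNgt; apply/negP => h; apply: Uc; apply: eU; rewrite ballEmdist.
exists (fun k a => Num.min (k%:R * dU a) 1); split.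
- by move=> k; apply: continuous_min'; [exact: continuousZ'|exact: continuousC].
- by move=> a; rewrite mul0r; apply/min_idPl.
- by move=> k a; rewrite le_min ler01 mulr_ge0// ge_min lexx orbT.
- move=> k a; rewrite le_min !ge_min lexx orbT andbT -natr1 mulrDl mul1r.
  by rewrite lerDl d0.
- split=> [k a /dz ->|a /dp da]; first by rewrite mulr0; apply/min_idPl.
  exists (Num.truncn (dU a)^-1).+1; apply/min_idPr.
  by rewrite -ler_pdivrMr// mul1r; exact/ltW/truncnS_gt.
Unshelve. all: by end_near. Qed.

Lemma open_measurable_borel (U : set A) : open U -> measurable (U : set (borel_type A)).
Proof. exact: sub_sigma_algebra. Qed.

(** Indicators of open sets are increasing limits of continuous functions, and open sets form a
    generating family stable under intersection. *)
Lemma borel_measure_unique (m1 m2 : {measure set (borel_type A) -> \bar R}) :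
  (m1 setT < +oo)%E ->
  (forall f, continuous f -> (forall a, 0 <= f a <= 1) ->
    (\int[m1]_a (f a)%:E = \int[m2]_a (f a)%:E)%E) ->
  forall E, measurable E -> m1 E = m2 E.
Proof.
move=> m1oo hf.
have mU (U : set A) : open U -> m1 U = m2 U.
  move=> oU; have [h [ch h0 h01 hnd [hz h1]]] := open_approx oU.
  have hlim (a : A) : (limn (fun k => (h k a)%:E) = (\1_U a)%:E)%E.
    apply/cvg_lim => //; apply: cvg_near_cst; rewrite indicE.
    have [Ua|Ua] := pselect (U a).
      have [k0 hk0] := h1 a Ua; rewrite mem_set//; near=> k; congr EFin.
      apply/eqP; rewrite eq_le; have /andP[_ ->] := h01 k a; rewrite -hk0 /=.
      have nd : {homo (h ^~ a) : n m / (n <= m)%N >-> n <= m}.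
        by apply: homo_leq => [x|y x z|i]; [exact: lexx|exact: le_trans|exact: hnd].
      by apply: nd; near: k; exact: nbhs_infty_ge.
    by rewrite memNset//; near=> k; rewrite hz.
  have E (m : {measure set (borel_type A) -> \bar R}) :
      (m U = limn (fun k => \int[m]_a (h k a)%:E))%E.
    rewrite -monotone_convergence//.
    - under eq_integral do rewrite hlim.
      by rewrite integral_indic ?setIT//; exact: open_measurable_borel.
    - by move=> k; apply/measurable_EFinP; exact: continuous_measurable.
    - by move=> k a _; rewrite lee_fin; have /andP[] := h01 k a.
    - move=> a _; apply: homo_leq => [x|y x z|i]; [exact: lexx|exact: le_trans|].
      by rewrite lee_fin hnd.
  rewrite !E; congr (limn _); apply/funext => k; apply: hf => //.
move=> E mE; apply: (@g_sigma_algebra_measure_unique _ R (borel_type A) (@open A : set (set (borel_type A))) _ (fun=> setT) _ _ m1 m2) => //.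
- by move=> U oU; exact: open_measurable_borel.
- by move=> _; exact: openT.
- by rewrite bigcup_const//; exists 0%N.
- by move=> U V oU oV; exact: openI.
Unshelve. all: by end_near. Qed.

Lemma compact_continuous_bounded f : compact [set: A] -> continuous f ->
  exists2 M : R, 0 <= M & forall a, `|f a| <= M.
Proof.
move=> cA cf; have : compact (f @` setT).
  by apply: continuous_compact => //; apply: continuous_subspaceT.
move=> /compact_bounded[M [Mr hM]]; exists (`|M| + 1); first by rewrite addr_ge0.
move=> a; apply: (hM (`|M| + 1)); last by exists a.
by rewrite (le_lt_trans (ler_norm M))// ltrDl.
Qed.

End continuous_functions.

(** * The Riesz-Markov theorem on a compact metric space *)

Section riesz_markov.
Context (R : realType) (A : pmetricType R).
Hypothesis cA : compact [set: A].
Variable L : (A -> R) -> R.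
Hypotheses (LD : forall f g : A -> R, continuous f -> continuous g ->
    L (fun a => f a + g a) = L f + L g)
  (LZ : forall (c : R) (f : A -> R), continuous f -> L (fun a => c * f a) = c * L f)
  (L_ge0 : forall f : A -> R, continuous f -> (forall a, 0 <= f a) -> 0 <= L f).
Implicit Types (f : A -> R) (g : nat -> A -> R) (E X : set A).

Lemma functional0 : L (fun=> 0) = 0.
Proof.
have E : (fun=> 0) = (fun a : A => 0 * (fun=> 0) a) :> (A -> R).
  by apply/funext => a; rewrite mul0r.
by rewrite E LZ ?mul0r//; exact: continuousC.
Qed.

Lemma functionalB f1 f2 : continuous f1 -> continuous f2 ->
  L (fun a => f1 a - f2 a) = L f1 - L f2.
Proof.
move=> c1 c2; have := LD c1 (continuousZ' (c := -1) c2); rewrite LZ// mulN1r => <-.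
by congr L; apply/funext => a; rewrite mulN1r.
Qed.

Lemma functional_le f1 f2 : continuous f1 -> continuous f2 ->
  (forall a, f1 a <= f2 a) -> L f1 <= L f2.
Proof.
move=> c1 c2 f12; rewrite -subr_ge0 -functionalB// L_ge0// => [|a].
  exact: continuousB'.
by rewrite subr_ge0.
Qed.

Lemma functional_sum g n : (forall i, continuous (g i)) ->
  L (fun a => \sum_(0 <= i < n) g i a) = \sum_(0 <= i < n) L (g i).
Proof.
move=> cg; elim: n => [|n IH].
  by under eq_fun do rewrite big_nil; rewrite big_nil functional0.
under eq_fun do rewrite big_nat_recr//=.
by rewrite LD ?IH ?big_nat_recr//; exact: continuous_sum'.
Qed.

(** Countable covers by functions in place of sets: their cost is measured by L itself, without a
    prior content on open sets. *)
Definition function_cover E g : Prop :=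
  [/\ forall n, continuous (g n), forall n a, 0 <= g n a &
   forall a, E a -> (1 <= \sum_(n <oo) (g n a)%:E)%E].

Local Open Scope ereal_scope.

Definition riesz_outer E : \bar R :=
  ereal_inf [set \sum_(n <oo) (L (g n))%:E | g in function_cover E].

Let Lg0 E g n : function_cover E g -> 0 <= (L (g n))%:E.
Proof. by move=> [cg g0 _]; rewrite lee_fin L_ge0. Qed.

Lemma riesz_outer_ge0 E : 0 <= riesz_outer E.
Proof.
apply: le_ereal_inf_tmp => _ [g cg <-]; apply: nneseries_ge0 => n _ _.
exact: Lg0 cg.
Qed.

Lemma riesz_outer_le E g : function_cover E g -> riesz_outer E <= \sum_(n <oo) (L (g n))%:E.
Proof. by move=> cg; apply: ereal_inf_lbound; exists g. Qed.

Lemma nneseries_head (u : nat -> \bar R) : (forall n, u n.+1 = 0) ->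
  \sum_(n <oo) u n = u 0%N.
Proof.
move=> u0; apply/cvg_lim => //; apply: cvg_near_cst; exists 1%N => // -[//|n] _ /=.
by rewrite big_nat_recl// big1 ?adde0.
Qed.

Lemma riesz_outer_le1 E f : continuous f -> (forall a, (0 <= f a)%R) ->
  (forall a, E a -> (1 <= f a)%R) -> riesz_outer E <= (L f)%:E.
Proof.
move=> cf f0 f1; pose g n := if n is 0%N then f else (fun=> 0%R).
have := @riesz_outer_le E g; rewrite nneseries_head => [|n /=]; last by rewrite functional0.
apply; split.
- by case=> [//|n]; exact: continuousC.
- by case=> [//|n] a /=.
- by move=> a Ea; rewrite nneseries_head//= lee_fin f1.
Qed.

Lemma riesz_outer0 : riesz_outer set0 = 0.
Proof.
apply/eqP; rewrite eq_le riesz_outer_ge0 andbT.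
have := @riesz_outer_le1 set0 (fun=> 0%R); rewrite functional0.
by apply=> //; exact: continuousC.
Qed.

Lemma le_riesz_outer : {homo riesz_outer : E X / E `<=` X >-> E <= X}.
Proof.
move=> E X EX; apply: le_ereal_inf => _ [g [cg g0 g1] <-]; exists g => //.
by split => // a /EX; exact: g1.
Qed.

Lemma riesz_outer_approx E (e : R) : (0 < e)%R -> riesz_outer E != +oo ->
  exists2 g, function_cover E g & \sum_(n <oo) (L (g n))%:E <= riesz_outer E + e%:E.
Proof.
move=> e0 Eoo.
have fin : riesz_outer E \is a fin_num.
  by rewrite ge0_fin_numE ?riesz_outer_ge0// ltey.
have [_ [g cg <-] /ltW h] := lb_ereal_inf_adherent e0 fin.
by exists g.
Qed.

Lemma riesz_outer_sigma_subadditive : sigma_subadditive riesz_outer.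
Proof.
move=> F; have [[i ioo]|] := pselect (exists i, riesz_outer (F i) = +oo).
  rewrite (eseries_pinfty _ _ ioo) ?leey// => n _.
  by rewrite -ltNye (lt_le_trans _ (riesz_outer_ge0 _)).
rewrite -forallNE => Foo.
suff add2e (e : {posnum R}) :
    riesz_outer (\bigcup_n F n) <= \sum_(i <oo) riesz_outer (F i) + e%:num%:E.
  by apply/lee_addgt0Pr => _/posnumP[].
rewrite (le_trans _ (epsilon_trick _ _ _))//; last first.
  by move=> n; exact: riesz_outer_ge0.
pose P n g := function_cover (F n) g /\
  \sum_(k <oo) (L (g k))%:E <= riesz_outer (F n) + (e%:num / (2 ^ n.+1)%:R)%:E.
have [G PG] : {G : nat -> nat -> A -> R & forall n, P n (G n)}.
  apply: (@choice _ _ P) => n.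
  have en1 : (0 < e%:num / (2 ^ n.+1)%:R)%R by [].
  by have [|g cg hg] := @riesz_outer_approx (F n) _ en1; [exact/eqP/Foo|exists g].
have [f hf] := @nneseries_pair R.
apply: (@le_trans _ _ (\sum_(n <oo) \sum_(k <oo) (L (G n k))%:E)).
  rewrite -hf; last by move=> n m; exact: (Lg0 _ (PG n).1).
  apply: (@riesz_outer_le _ (fun k => G (f k).1 (f k).2)); split.
  - by move=> k; have [[cg _ _] _] := PG (f k).1; exact: cg.
  - by move=> k a; have [[_ g0 _] _] := PG (f k).1; exact: g0.
  move=> a [n _ Fna]; rewrite (hf (fun n m => (G n m a)%:E)); last first.
    by move=> m k; have [[_ g0 _] _] := PG m; rewrite lee_fin g0.
  have [[_ _ /(_ _ Fna) g1] _] := PG n; apply: (le_trans g1).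
  rewrite (@nneseriesD1 _ (fun n => \sum_(m <oo) (G n m a)%:E) n xpredT)//.
    rewrite leeDl// nneseries_ge0// => m _ _; apply: nneseries_ge0 => k _ _.
    by have [[_ g0 _] _] := PG m; rewrite lee_fin g0.
  move=> m _; apply: nneseries_ge0 => k _ _.
  by have [[_ g0 _] _] := PG m; rewrite lee_fin g0.
apply: lee_nneseries => [n _ _|n _]; last exact: (PG n).2.
by apply: nneseries_ge0 => m _ _; exact: (Lg0 _ (PG n).1).
Qed.

HB.instance Definition _ := isOuterMeasure.Build R A riesz_outer
  riesz_outer0 riesz_outer_ge0 le_riesz_outer riesz_outer_sigma_subadditive.

(** A cover g of X is split by the functions h_k increasing to the indicator of U: the g_n (1 - h_k)
    cover X outside U, the increments in k of the g_n h_k cover X inside U, and L is additive. *)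
Lemma open_caratheodory (U : set A) : open U -> caratheodory_measurable riesz_outer U.
Proof.
move=> oU; apply: le_caratheodory_measurable => X.
have [h [ch h0 h01 hnd [hz h1]]] := open_approx oU.
apply: le_ereal_inf_tmp => _ [g cg <-]; have [cg1 g0 gX] := cg.
set S := \sum_(n <oo) _.
have S0 : 0 <= S by apply: nneseries_ge0 => n _ _; exact: Lg0 cg.
have [->|Soo] := eqVneq S +oo; first exact: leey.
have cgh n k : continuous (fun a => g n a * h k a)%R by exact: continuousM'.
have gh0 n k : (0 <= L (fun a => g n a * h k a))%R.
  by apply: L_ge0 => // a; rewrite mulr_ge0//; have /andP[] := h01 k a.
pose d n k : A -> R := (fun a => g n a * h k.+1 a - g n a * h k a)%R.
have cd n k : continuous (d n k) by exact: continuousB'.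
have d0 n k a : (0 <= d n k a)%R by rewrite subr_ge0 ler_wpM2l.
have sumd n k a : (\sum_(0 <= i < k) d n i a = g n a * h k a)%R.
  elim: k => [|k IH]; first by rewrite big_nil h0 mulr0.
  by rewrite big_nat_recr//= IH /d addrC subrK.
have out k : riesz_outer (X `&` ~` U) + \sum_(n <oo) (L (fun a => g n a * h k a)%R)%:E <= S.
  pose g' n : A -> R := (fun a => g n a - g n a * h k a)%R.
  have cg' : function_cover (X `&` ~` U) g'.
    split=> [n|n a|a [Xa Ua]]; first exact: continuousB'.
      by rewrite subr_ge0 ler_piMr//; have /andP[] := h01 k a.
    by under eq_eseriesr do rewrite /g' hz// mulr0 subr0; exact: gX.
  have -> : S = \sum_(n <oo) (L (g' n))%:E + \sum_(n <oo) (L (fun a => g n a * h k a)%R)%:E.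
    rewrite -nneseriesD; last 2 first.
      by move=> n _ _; exact: Lg0 cg'.
      by move=> n _ _; rewrite lee_fin.
    apply: eq_eseriesr => n _; rewrite -EFinD -LD//; last by have [] := cg'.
    by congr (L _)%:E; apply/funext => a; rewrite /g' subrK.
  by rewrite leeD2r// riesz_outer_le.
have [f hf] := @nneseries_pair R.
(* On U some h_k equals 1, so there the increments over k add up to at least g_n. *)
have inn : riesz_outer (X `&` U) <= \sum_(k <oo) \sum_(n <oo) (L (d n k))%:E.
  rewrite -(hf (fun k n => (L (d n k))%:E)) => [|? ?]; last by rewrite lee_fin L_ge0.
  apply: (@riesz_outer_le _ (fun j => d (f j).2 (f j).1)); split => // a [Xa Ua].
  rewrite (hf (fun k n => (d n k a)%:E)); last by move=> ? ?; rewrite lee_fin.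
  rewrite nneseries_interchange; last by move=> ? ?; rewrite lee_fin.
  apply: (le_trans (gX a Xa)); apply: lee_nneseries => [n _ _|n _]; first by rewrite lee_fin.
  have [k hk] := h1 a Ua.
  apply: (@le_trans _ _ (\sum_(0 <= i < k) (d n i a)%:E)).
    by rewrite sumEFin sumd hk mulr1.
  by apply: (nneseries_lim_ge k) => i _ _; rewrite lee_fin.
have finS : S \is a fin_num by rewrite ge0_fin_numE// ltey.
have finO : riesz_outer (X `&` ~` U) \is a fin_num.
  rewrite ge0_fin_numE ?riesz_outer_ge0//; apply: le_lt_trans (_ : S < +oo); last by rewrite ltey.
  apply: le_trans (out 0%N); rewrite leeDl// nneseries_ge0// => n _ _.
  by rewrite lee_fin.
rewrite -leeBrDr//; apply: le_trans inn _.
apply: lime_le.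
  by apply: is_cvg_nneseries => k _ _; apply: nneseries_ge0 => n _ _; rewrite lee_fin L_ge0.
(* The first k increments telescope to g_n h_k, whose total cost is bounded by [out]. *)
apply: nearW => k; rewrite -nneseries_sum_nat; last by move=> ? ?; rewrite lee_fin L_ge0.
rewrite leeBrDr// addeC; apply: le_trans (out k); rewrite leeD2l//.
rewrite le_eqVlt; apply/orP; left; apply/eqP/eq_eseriesr => n _.
rewrite sumEFin -functional_sum//; congr (L _)%:E.
by apply/funext => a; rewrite sumd.
Qed.

Lemma borel_caratheodory (E : set (borel_type A)) : measurable E ->
  caratheodory_measurable riesz_outer E.
Proof.
apply: smallest_sub.
  exact: (@sigma_algebra_measurable _ (caratheodory_type riesz_outer)).
exact: open_caratheodory.
Qed.

(** For the lower bound, compactness makes the pointwise condition on a cover uniform: finitely many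
    terms already reach 1 - d everywhere. *)
Lemma riesz_outerT : riesz_outer setT = (L (fun=> 1%R))%:E.
Proof.
apply/eqP; rewrite eq_le; apply/andP; split.
  by apply: riesz_outer_le1 => //; exact: continuousC.
apply: le_ereal_inf_tmp => _ [g [cg g0 g1] <-].
have L1 : (0 <= L (fun=> 1%R))%R by apply: L_ge0 => //; exact: continuousC.
apply/lee_addgt0Pr => e e0.
(* This d satisfies d L(1) <= e, and the added e keeps the denominator positive when L(1) = 0. *)
pose d : R := (e / (L (fun=> 1%R) + e))%R.
have d0 : (0 < d)%R by rewrite divr_gt0// ltr_wpDl.
pose U N := [set a : A | (1 - d < \sum_(0 <= i < N) g i a)%R].
have oU N : open (U N).
  have /continuousP := @continuous_sum' _ A N g cg.
  by move=> /(_ _ (@open_gt R (1 - d)%R)).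
have covU : [set: A] `<=` cover setT U.
  move=> a _; suff [N hN] : exists N, U N a by exists N.
  apply/not_existsP => h.
  have : \sum_(n <oo) (g n a)%:E <= (1 - d)%:E.
    apply: lime_le; first by apply: is_cvg_nneseries => n _ _; rewrite lee_fin.
    apply: nearW => N; rewrite sumEFin lee_fin leNgt; apply/negP => hN.
    by apply: (h N).
  move=> /(le_trans (g1 a I)); rewrite lee_fin; lra.
have := cA; rewrite compact_cover => /(_ _ _ _ (fun N _ => oU N) covU) [D' _ D'cov].
pose N := (\max_(i <- D') i)%N.
have UN a : (1 - d <= \sum_(0 <= i < N) g i a)%R.
  have [i iD Uia] := D'cov a I; apply: (le_trans (ltW Uia)).
  have iN : (i <= N)%N by rewrite /N (big_rem i)//= leq_maxl.
  by rewrite (big_cat_nat (leq0n i) iN)/= lerDl sumr_ge0.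
apply: (@le_trans _ _ (\sum_(0 <= n < N) (L (g n))%:E + e%:E)); last first.
  by rewrite leeD2r//; apply: nneseries_lim_ge => n _ _; rewrite lee_fin L_ge0.
rewrite sumEFin -EFinD lee_fin -functional_sum//.
have := @functional_le (fun a => (1 - d) * 1)%R (fun a => \sum_(0 <= i < N) g i a)%R.
rewrite LZ; last exact: continuousC.
have c1 : continuous (fun a : A => (1 - d) * 1 : R)%R by exact: continuousC.
move=> /(_ c1 (@continuous_sum' _ A N g cg)).
have hUN a : ((1 - d) * 1 <= \sum_(0 <= i < N) g i a)%R by rewrite mulr1.
move=> /(_ hUN); rewrite mulrBl mul1r => h.
have : (d * L (fun=> 1%R) <= e)%R.
  rewrite /d mulrAC ler_pdivrMr; last by rewrite ltr_wpDl.
  by rewrite ler_wpM2l ?(ltW e0)// lerDl ltW.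
lra.
Qed.

(** Only the integral being at most L(f) needs work: applied to M - f too, the inequality becomes an
    equality because the total mass is L(1). *)
Lemma riesz_measure : exists mu : {measure set (borel_type A) -> \bar R},
  forall f, continuous f -> (forall a, (0 <= f a)%R) -> \int[mu]_a (f a)%:E = (L f)%:E.
Proof.
have sadd : semi_sigma_additive (riesz_outer : set (borel_type A) -> \bar R).
  move=> F mF tF mUF.
  by apply: caratheodory_measure_sigma_additive => // [i|]; exact: borel_caratheodory.
have [mu muE] := @ex_measure _ (borel_type A) R riesz_outer riesz_outer0 (fun E _ => riesz_outer_ge0 E) sadd.
exists mu.
have muT : mu setT = (L (fun=> 1%R))%:E by rewrite muE// riesz_outerT.
have L1 : (0 <= L (fun=> 1%R))%R by apply: L_ge0 => //; exact: continuousC.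
have mcont f : continuous f -> measurable_fun setT ((EFin \o f) : borel_type A -> \bar R).
  by move=> cf; apply/measurable_EFinP; exact: continuous_measurable.
have upper f : continuous f -> (forall a, (0 <= f a)%R) -> \int[mu]_a (f a)%:E <= (L f)%:E.
  move=> cf f0; have [M M0 fM] := compact_continuous_bounded cA cf.
  suff H n : \int[mu]_a (f a)%:E <= (L f + (M * L (fun=> 1%R)) / n.+1%:R)%:E.
    apply/lee_addgt0Pr => e e0.
    pose n := Num.truncn ((M * L (fun=> 1%R)) / e).
    apply: (le_trans (H n)); rewrite -EFinD lee_fin lerD2l ler_pdivrMr//.
    by rewrite [leRHS]mulrC -ler_pdivrMr//; exact/ltW/truncnS_gt.
  (* f is cut into n + 1 layers s_i of height c, squeezed between c times the indicators of F_(i+1)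
     and F_i; the two layer sums differ by at most c times the total mass. *)
  pose c := (M / n.+1%:R)%R; have c0 : (0 <= c)%R by rewrite divr_ge0.
  pose s i : A -> R := (fun a => Num.min (f a) (i.+1%:R * c) - Num.min (f a) (i%:R * c))%R.
  have cmin i : continuous (fun a => Num.min (f a) (i%:R * c)%R).
    by apply: continuous_min' => //; exact: continuousC.
  have cs i : continuous (s i) by exact: continuousB'.
  have ic i : (i%:R * c <= i.+1%:R * c)%R by rewrite ler_wpM2r// ler_nat.
  have s0 i a : (0 <= s i a)%R.
    by rewrite subr_ge0 le_min !ge_min lexx ic !orbT.
  pose F i : set A := [set a | (i%:R * c <= f a)%R].
  have mF i : measurable (F i : set (borel_type A)).
    have -> : F i = ~` [set a | (f a < i%:R * c)%R].
      by rewrite /F; apply/seteqP; split => a /=; rewrite leNgt => /negP.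
    apply: measurableC; apply: open_measurable_borel.
    by have /continuousP /(_ _ (@open_lt R (i%:R * c)%R)) := cf.
  have sF i a : (s i a <= c * \1_(F i) a)%R.
    rewrite indicE; have [Fa|Fa] := leP (i%:R * c)%R (f a).
      rewrite mem_set ?mulr1 /s ?lerBlDr//.
      rewrite (min_idPr Fa) ge_min; apply/orP; right.
      by rewrite -natr1 mulrDl mul1r addrC.
    rewrite memNset; last by rewrite /F /= leNgt Fa.
    rewrite mulr0 /s (min_idPl (ltW Fa)) (min_idPl _) ?subrr//.
    exact: le_trans (ltW Fa) (ic i).
  have fsum a : (f a = \sum_(0 <= i < n.+1) s i a)%R.
    rewrite telescope_sumr// mul0r (min_idPr (f0 a)) subr0.
    rewrite (min_idPl _)//; have := fM a; rewrite ger0_norm// => /le_trans; apply.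
    by rewrite /c mulrC mulfVK// pnatr_eq0.
  have muF i : c%:E * mu (F i.+1) <= (L (s i))%:E.
    have [c00|cn0] := eqVneq c 0%R; first by rewrite c00 mul0e lee_fin L_ge0.
    have cp : (0 < c)%R by rewrite lt_neqAle eq_sym cn0.
    rewrite -lee_pdivlMl// -EFinM -LZ// muE//.
    apply: riesz_outer_le1 => [|a|a Fa]; first exact: continuousZ'.
      by rewrite mulr_ge0// invr_ge0.
    rewrite -ler_pdivrMl ?invr_gt0// invrK mulr1 /s.
    rewrite (min_idPr Fa) (min_idPr (le_trans (ic i) Fa)).
    by rewrite -natr1 mulrDl mul1r addrAC subrr add0r.
  apply: (@le_trans _ _ (\int[mu]_a \sum_(0 <= i < n.+1) (c%:E * (\1_(F i) a)%:E))).
    apply: ge0_le_integral => //.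
    - by move=> a _; rewrite lee_fin.
    - exact: mcont.
    - apply: emeasurable_sum => i; apply: measurable_funeM.
      by apply/measurable_EFinP; exact: measurable_indic.
    - move=> a _; rewrite fsum (eq_bigr (fun i => (c * \1_(F i) a)%:E)) => [|i _]; last by rewrite EFinM.
      by rewrite sumEFin lee_fin; apply: ler_sum => i _; exact: sF.
  rewrite ge0_integral_sum//; last 2 first.
    - move=> i; apply: measurable_funeM.
      by apply/measurable_EFinP; exact: measurable_indic.
    - by move=> i a _; rewrite -EFinM lee_fin mulr_ge0.
  rewrite (eq_bigr (fun i => c%:E * mu (F i))) => [|i _]; last first.
    rewrite ge0_integralZl_EFin//; last first.
      by apply/measurable_EFinP; exact: measurable_indic.
    by rewrite integral_indic// setIT.
  (* F_(i+1) is paid for by the layer s_i; F_0 has no layer below it and contributes the error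
     term. *)
  rewrite big_nat_recl// EFinD addeC leeD//.
    apply: (@le_trans _ _ (\sum_(0 <= i < n) (L (s i))%:E)); first by apply: lee_sum.
    rewrite sumEFin lee_fin -functional_sum//; apply: functional_le => //.
      exact: continuous_sum'.
    by move=> a; rewrite fsum big_nat_recr//= lerDl.
  apply: (@le_trans _ _ (c%:E * mu setT)).
    apply: lee_wpmul2l; first by rewrite lee_fin.
    by apply: le_measure => //; apply: mem_set; first [exact: mF|exact: measurableT].
  by rewrite muT -EFinM /c mulrAC.
move=> f cf f0; have [M M0 fM] := compact_continuous_bounded cA cf.
apply/eqP; rewrite eq_le upper//=.
have cMf : continuous (fun a => M - f a)%R by apply: continuousB' => //; exact: continuousC.
have Mf0 a : (0 <= M - f a)%R by rewrite subr_ge0 (le_trans (ler_norm _)).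
have := upper _ cMf Mf0.
have I1 : \int[mu]_a (f a)%:E + \int[mu]_a (M - f a)%:E = (M * L (fun=> 1%R))%:E.
  rewrite -ge0_integralD//; last 4 first.
    - by move=> a _; rewrite lee_fin.
    - exact: mcont.
    - by move=> a _; rewrite lee_fin.
    - exact: mcont.
  under eq_integral do rewrite -EFinD addrC subrK.
  by rewrite integral_cst//= muT.
have fin1 : \int[mu]_a (f a)%:E \is a fin_num.
  rewrite ge0_fin_numE; first exact: le_lt_trans (upper _ cf f0) (ltry _).
  by apply: integral_ge0 => a _; rewrite lee_fin.
have fin2 : \int[mu]_a (M - f a)%:E \is a fin_num.
  rewrite ge0_fin_numE; first exact: le_lt_trans (upper _ cMf Mf0) (ltry _).
  by apply: integral_ge0 => a _; rewrite lee_fin.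
have LM : L (fun a => M - f a)%R = (M * L (fun=> 1%R) - L f)%R.
  rewrite functionalB//; last exact: continuousC.
  congr (_ - _)%R; rewrite -LZ; last exact: continuousC.
  by congr L; apply/funext => a; rewrite mulr1.
rewrite LM -(fineK fin1) -(fineK fin2) !lee_fin.
move: I1; rewrite -{1}(fineK fin1) -{1}(fineK fin2) -EFinD => -[]; lra.
Qed.

End riesz_markov.

(** * Invariant means on abelian groups *)

Section invariant_mean.
Context (R : realType) (T : zmodType).
Implicit Types (f g : T -> R) (x t : T) (s : seq T).

Definition bounded_by (M : R) f := forall x, `|f x| <= M.

(* Average over the box of the x + sum_i k_i t_i with 0 <= k_i <= n. *)
Fixpoint translation_average s (n : nat) f x : R :=
  if s is t :: s' then
    n.+1%:R^-1 * \sum_(k < n.+1) translation_average s' n f (x + t *+ k)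
  else f x.
Local Notation avg := translation_average.

Lemma averageD s n f g x : avg s n (fun x => f x + g x) x = avg s n f x + avg s n g x.
Proof.
elim: s x => [//|t s IH] x /=; rewrite -mulrDr -big_split /=.
by congr (_ * _); apply: eq_bigr => k _.
Qed.

Lemma averageZ s n c f x : avg s n (fun x => c * f x) x = c * avg s n f x.
Proof.
elim: s x => [//|t s IH] x /=; rewrite [RHS]mulrCA.
congr (_ * _); rewrite mulr_sumr; apply: eq_bigr => k _; exact: IH.
Qed.

Lemma average_translate s n f t x : avg s n (fun x => f (x + t)) x = avg s n f (x + t).
Proof.
elim: s x => [//|u s IH] x /=; congr (_ * _); apply: eq_bigr => k _.
by rewrite IH addrAC.
Qed.

Lemma mean_const_le n (M : R) (a : 'I_n.+1 -> R) : (forall k, a k <= M) ->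
  n.+1%:R^-1 * \sum_(k < n.+1) a k <= M.
Proof.
move=> aM; rewrite ler_pdivrMl// (le_trans (ler_sum _ (fun k _ => aM k)))//.
by rewrite sumr_const card_ord mulr_natl.
Qed.

Lemma average_le s n f M : (forall x, f x <= M) -> forall x, avg s n f x <= M.
Proof. by move=> fM; elim: s => [//|t s IH] x /=; apply: mean_const_le => k. Qed.

Lemma average_bound s n f M : bounded_by M f -> bounded_by M (avg s n f).
Proof.
move=> fM x; rewrite ler_norml; apply/andP; split; last first.
  by apply: average_le => y; rewrite (le_trans (ler_norm _)).
rewrite lerNl -mulN1r -averageZ; apply: average_le => y.
by rewrite mulN1r (le_trans (ler_norm _))// normrN.
Qed.

(** In the direction t the average telescopes to two boundary values; by commutativity the other
    directions only average translates of that difference. *)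
Lemma average_almost_invariant s n f M t : bounded_by M f -> t \in s ->
  forall x, `|avg s n f (x + t) - avg s n f x| <= 2 * M / n.+1%:R.
Proof.
move=> fM; elim: s => [//|u s IH]; rewrite inE => /orP[/eqP ->{t IH}|ts] x /=.
  rewrite -mulrBr -sumrB.
  have -> : \sum_(k < n.+1) (avg s n f (x + u + u *+ k) - avg s n f (x + u *+ k)) =
      avg s n f (x + u *+ n.+1) - avg s n f x.
    rewrite (eq_bigr (fun k : 'I_n.+1 => avg s n f (x + u *+ k.+1) - avg s n f (x + u *+ k))).
      rewrite -(big_mkord xpredT (fun k => avg s n f (x + u *+ k.+1) - avg s n f (x + u *+ k))).
      by rewrite telescope_sumr// mulr0n addr0.
    by move=> k _; rewrite mulrS addrA.
  rewrite normrM ger0_norm// [leRHS]mulrC ler_wpM2l ?invr_ge0//.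
  rewrite mulr_natl mulr2n (le_trans (ler_normB _ _))// lerD// average_bound//.
rewrite -mulrBr -sumrB normrM ger0_norm//.
apply: le_trans (ler_wpM2l _ (ler_norm_sum _ _ _)) _; first by rewrite invr_ge0.
by apply: mean_const_le => k; rewrite addrAC; exact: IH.
Qed.

Lemma ultra_fmap (I J : Type) (f : I -> J) (U : set_system I) :
  UltraFilter U -> UltraFilter (f @ U).
Proof.
move=> UU; have UP : ProperFilter U by exact: ultra_proper.
split; first exact: fmap_proper_filter.
move=> G GP UG; apply/seteqP; split=> [B GB|B /UG//].
have [//|UB] := in_ultra_setVsetC (f @^-1` B) UU.
have GnB : G (~` B) by apply: UG.
exfalso; apply: (@filter_not_empty _ G); rewrite -(setICr B); exact: filterI.
Qed.

Definition average_index := (seq T * nat)%type.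

Definition average_base : set_system average_index :=
  filter_from setT (fun p : average_index =>
    [set q : average_index | {subset p.1 <= q.1} /\ (p.2 <= q.2)%N]).

Lemma average_base_filter : ProperFilter average_base.
Proof.
apply: filter_from_proper; last by move=> p _; exists p; split.
apply: filter_from_filter; first by exists ([::], 0%N).
move=> p q _ _; exists (p.1 ++ q.1, maxn p.2 q.2) => // r [/= h1 h2].
move: h2; rewrite geq_max => /andP[h2 h3].
by split; split => // x xp; apply: h1; rewrite mem_cat xp ?orbT.
Qed.

Definition invariant_mean (m : (T -> R) -> R) : Prop :=
  [/\ forall f g M N, bounded_by M f -> bounded_by N g ->
        m (fun x => f x + g x) = m f + m g,
      forall c f M, bounded_by M f -> m (fun x => c * f x) = c * m f,
      forall f M B, bounded_by M f -> (forall x, f x <= B) -> m f <= B &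
      forall f M t, bounded_by M f -> m (fun x => f (x + t)) = m f].

(** Averages of f based at 0 stay in [-M, M], so they converge along an ultrafilter finer than the
    tails of the index set of directions and box sizes. *)
Lemma ex_invariant_mean : exists m, invariant_mean m.
Proof.
have bF := average_base_filter.
have [U [UU baseU]] := ultraFilterLemma bF.
have UP : ProperFilter U by exact: ultra_proper.
pose a f (i : average_index) := avg i.1 i.2 f 0.
have acvg f M : bounded_by M f -> cvg (a f @ U).
  move=> fM; have := @segment_compact R (- M) M.
  rewrite compact_ultra => /(_ (a f @ U) (ultra_fmap _ UU)) [].
    apply: (@filterS _ U _ setT); last exact: filterT.
    by move=> i _ /=; rewrite in_itv/= -ler_norml; exact: average_bound.
  by move=> l [_ al]; apply/cvg_ex; exists l.
exists (fun f => lim (a f @ U)); split.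
- move=> f g M N fM gN; apply/cvg_lim => //.
  have -> : a (fun x => f x + g x) = (fun i => a f i + a g i).
    by apply/funext => i; exact: averageD.
  by apply: cvgD; [exact: acvg fM|exact: acvg gN].
- move=> c f M fM; apply/cvg_lim => //.
  have -> : a (fun x => c * f x) = (fun i => c * a f i).
    by apply/funext => i; exact: averageZ.
  by apply: cvgM; [exact: cvg_cst|exact: acvg fM].
- move=> f M B fM fB; apply: limr_le; first exact: acvg fM.
  by apply: filterS filterT => i _; exact: average_le.
move=> f M t fM; apply/cvg_lim => //.
have M0 : 0 <= M by exact: le_trans (normr_ge0 _) (fM 0).
have -> : a (fun x => f (x + t)) = (fun i => a f i + (avg i.1 i.2 f t - avg i.1 i.2 f 0)).
  by apply/funext => i; rewrite /a average_translate add0r addrC subrK.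
rewrite -[X in _ --> X]addr0; apply: cvgD; first exact: acvg fM.
apply/cvgr0Pnorm_le => e e0; apply: baseU.
(* Beyond this index t is among the directions and 2 M / (n + 1) is at most e. *)
exists ([:: t], Num.truncn (2 * M / e)) => // -[s n] [/= ts nn].
have := average_almost_invariant n fM (ts t (mem_head _ _)) 0; rewrite add0r.
move=> /le_trans; apply; rewrite ler_pdivrMr// [leRHS]mulrC -ler_pdivrMr//.
by apply: le_trans (ltW (truncnS_gt _)) _; rewrite ler_nat.
Qed.

End invariant_mean.


(** * Averaging a POVM over displacements *)

(* Measures only admit nonnegative combinations, so a linear relation is moved to
   an equality between its positive and its negative part. *)
Definition opposite_weights (R : realType) (X : Type) (s : seq (R * X)) :=
  [seq (- p.1, p.2) | p <- s].

Lemma relation_split (R : realType) (X : Type) (a : X -> R) (s : seq (R * X)) :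
  \sum_(p <- s) p.1 * a p.2 =
  \sum_(p <- s) Num.max p.1 0 * a p.2 -
  \sum_(p <- opposite_weights s) Num.max p.1 0 * a p.2.
Proof.
rewrite big_map /= -sumrB; apply: eq_bigr => p _; rewrite -mulrBl; congr (_ * _).
by rewrite /Num.max; case: ifP; case: ifP; lra.
Qed.

Lemma sum_max_fine (R : realType) (X : Type) (g : X -> \bar R) (s : seq (R * X)) :
  (forall x, g x \is a fin_num) ->
  (\sum_(p <- s) (Num.max p.1 0)%:E * g p.2 =
    (\sum_(p <- s) Num.max p.1 0 * fine (g p.2))%:E)%E.
Proof. by move=> gfin; rewrite -sumEFin; apply: eq_bigr => p _; rewrite EFinM fineK. Qed.

Section linear_relations.
Context d (T : measurableType d) (R : realType) (X : Type).
Variable mu : X -> {measure set T -> \bar R}.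
Hypothesis mu_fin : forall x, (mu x setT < +oo)%E.
Implicit Types (s : seq (R * X)) (f : T -> R).

Lemma measure_combination s : exists P : {measure set T -> \bar R},
  (forall E, P E = \sum_(p <- s) (Num.max p.1 0)%:E * mu p.2 E)%E /\
  (forall f, (forall a, (0 <= f a)%R) -> measurable_fun setT f ->
    \int[P]_a (f a)%:E = \sum_(p <- s) (Num.max p.1 0)%:E * \int[mu p.2]_a (f a)%:E)%E.
Proof.
elim: s => [|[c x] s [P [PE Pf]]].
  exists mzero; split => [E|f f0 mf]; first by rewrite big_nil.
  by rewrite integral_measure_zero big_nil.
have c0 : 0 <= Num.max c 0 by rewrite le_max lexx orbT.
exists (measure_add (mscale (NngNum c0) (mu x)) P); split => [E|f f0 mf].
  by rewrite big_cons /= -PE; exact: measure_addE.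
have mf' : measurable_fun setT (EFin \o f) by apply/measurable_EFinP.
rewrite ge0_integral_measure_add// => [|a _]; last by rewrite lee_fin.
rewrite ge0_integral_mscale// => [|a _]; last by rewrite lee_fin.
by rewrite Pf// big_cons.
Qed.

Lemma finite_measure_fin_num x E : measurable E -> mu x E \is a fin_num.
Proof.
move=> mE; rewrite ge0_fin_numE//; apply: le_lt_trans (mu_fin x).
by apply: le_measure => //; apply: mem_set.
Qed.

Lemma finite_integral_fin_num x f (M : R) : (forall a, 0 <= f a <= M) ->
  measurable_fun setT f -> (\int[mu x]_a (f a)%:E)%E \is a fin_num.
Proof.
move=> fM mf; rewrite ge0_fin_numE; last first.
  by apply: integral_ge0 => a _; rewrite lee_fin; have /andP[] := fM a.
have M0 : (0 <= M) by have /andP[/le_trans h /h] := fM point.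
apply: (@le_lt_trans _ _ (\int[mu x]_a (M%:E))%E); last first.
  rewrite integral_cst// lte_mul_pinfty//.
apply: ge0_le_integral => //.
- by move=> a _; rewrite lee_fin; have /andP[] := fM a.
- exact/measurable_EFinP.
- by move=> a _; rewrite lee_fin; have /andP[] := fM a.
Qed.

(** The positive and negative parts of the relation are two measures that agree on measurable
    sets. *)
Lemma set_relation_integral s f (M : R) :
  (forall E, measurable E -> \sum_(p <- s) p.1 * fine (mu p.2 E) = 0) ->
  (forall a, 0 <= f a <= M) -> measurable_fun setT f ->
  \sum_(p <- s) p.1 * fine (\int[mu p.2]_a (f a)%:E)%E = 0.
Proof.
move=> rel fM mf; have f0 a : 0 <= f a by have /andP[] := fM a.
have [P [PE Pf]] := measure_combination s.
have [N [NE Nf]] := measure_combination (opposite_weights s).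
have PN E : measurable E -> P E = N E.
  move=> mE; rewrite PE NE !(sum_max_fine (g := fun x => mu x E)) => [|x|x];
    try exact: finite_measure_fin_num.
  congr EFin; apply/eqP; rewrite -subr_eq0; apply/eqP.
  by rewrite -(relation_split (fun x => fine (mu x E))); exact: rel.
rewrite (relation_split (fun x => fine (\int[mu x]_a (f a)%:E)%E)).
apply/eqP; rewrite subr_eq0; apply/eqP/EFin_inj.
rewrite -!(sum_max_fine (g := fun x => \int[mu x]_a (f a)%:E)%E) => [|x|x];
  try exact: finite_integral_fin_num fM mf.
by rewrite -Pf// -Nf//; exact: eq_integral_set_function.
Qed.

End linear_relations.

(** The way back: the two parts agree on continuous functions, hence as Borel measures. *)
Lemma continuous_relation_borel (R : realType) (A : pmetricType R) (X : Type)
    (mu : X -> {measure set (borel_type A) -> \bar R}) (s : seq (R * X)) :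
  (forall x, (mu x setT < +oo)%E) ->
  (forall f : A -> R, continuous f -> (forall a, 0 <= f a <= 1) ->
    \sum_(p <- s) p.1 * fine (\int[mu p.2]_a (f a)%:E)%E = 0) ->
  forall E, measurable E -> \sum_(p <- s) p.1 * fine (mu p.2 E) = 0.
Proof.
move=> mu_fin rel E mE.
have [P [PE Pf]] := measure_combination mu s.
have [N [NE Nf]] := measure_combination mu (opposite_weights s).
have gE F x : measurable F -> mu x F \is a fin_num by exact: finite_measure_fin_num.
have PN : P E = N E.
  apply: borel_measure_unique => // [|f cf f01].
    by rewrite PE (sum_max_fine (g := fun x => mu x setT)) ?ltry// => x; exact: gE.
  have mf := continuous_measurable cf.
  have f0 a : 0 <= f a by have /andP[] := f01 a.
  rewrite Pf// Nf// !(sum_max_fine (g := fun x => \int[mu x]_a (f a)%:E)%E) => [|x|x];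
    try exact: (finite_integral_fin_num mu_fin x f01 mf).
  congr EFin; apply/eqP; rewrite -subr_eq0; apply/eqP.
  by rewrite -(relation_split (fun x => fine (\int[mu x]_a (f a)%:E)%E)); exact: rel.
rewrite (relation_split (fun x => fine (mu x E))); apply/eqP; rewrite subr_eq0; apply/eqP/EFin_inj.
by rewrite -!(sum_max_fine (g := fun x => mu x E)) => [|x|x]; try exact: gE; rewrite -PE -NE.
Qed.

(** * From quadratic functions to sesquilinear forms *)

Section polarization.
Context (R : realType) (V : lmodType R[i]).
Local Notation C := R[i].
Local Notation Re := (@complex.Re R).
Implicit Types (q : V -> R) (u v w : V).

Definition real_polar q u v : R := (q (u + v) - q (u - v)) / 4.
(** The sign fits a form linear in its second argument, for which Re B(u, iv) = - Im B(u, v). *)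
Definition polar q u v : C := real_polar q u v +i* - real_polar q u ('i *: v).

(* The linear relations between values of q that make its polarization
   sesquilinear; being linear, they survive averaging over displacements. *)
Definition quadratic_relations q : Prop :=
  [/\ forall u v w, q (u + (v + w)) - q (u - (v + w)) =
        q (u + v) - q (u - v) + (q (u + w) - q (u - w)),
      forall (c : R) u v, q (u + c%:C *: v) - q (u - c%:C *: v) =
        c * (q (u + v) - q (u - v)),
      forall c u, q (c *: u) = (Re `|c|) ^+ 2 * q u &
      forall u, 0 <= q u].

(** The scaling by |c|^2 makes q invariant under -1 and under i. The first gives symmetry of the
    real part, the second its compatibility with i, so complex linearity reduces to real
    linearity. *)
Lemma polar_form q : quadratic_relations q ->
  sesquilinear (polar q) /\ forall u, polar q u u = (q u)%:C.
Proof.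
move=> [qD qZ qN q0].
have qi u : q ('i *: u) = q u.
  by rewrite qN normcE2 /= expr0n expr1n add0r mul1r.
have qneg u : q (- u) = q u.
  by rewrite -scaleN1r qN normrN normr1 expr1n mul1r.
have QD u v w : real_polar q u (v + w) = real_polar q u v + real_polar q u w.
  by rewrite /real_polar qD; ring.
have QZ (c : R) u v : real_polar q u (c%:C *: v) = c * real_polar q u v.
  by rewrite /real_polar qZ; ring.
have QC u v : real_polar q u v = real_polar q v u.
  by rewrite /real_polar (addrC u v) -(opprB v u) qneg.
have Qi u v : real_polar q ('i *: u) ('i *: v) = real_polar q u v.
  by rewrite /real_polar -scalerDr -scalerBr !qi.
have ii u : 'i *: ('i *: u) = - u :> V.
  by rewrite scalerA -expr2 sqr_i scaleN1r.
have QN u v : real_polar q u (- v) = - real_polar q u v.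
  by rewrite /real_polar opprK; ring.
have herm u v : polar q v u = conjc (polar q u v).
  rewrite /polar /= QC opprK; congr (_ +i* _).
  by rewrite -Qi ii QN opprK QC.
have BD u v w : polar q u (v + w) = polar q u v + polar q u w.
  rewrite /polar scalerDr !QD; apply/eqP; rewrite eq_complex /=; apply/andP.
  by split; apply/eqP; ring.
have BZ u c v : polar q u (c *: v) = c * polar q u v.
  have -> : c *: v = (Re c)%:C *: v + (complex.Im c)%:C *: ('i *: v).
    by rewrite scalerA -scalerDl {1}(complexE c) mulrC.
  rewrite /polar scalerDr !QD (scalerA 'i) (mulrC 'i) -scalerA.
  rewrite (scalerA 'i (_%:C)) (mulrC 'i) -scalerA ii !QZ QN.
  apply/eqP; rewrite eq_complex; case: c => a b /=; apply/andP.
  by split; apply/eqP; ring.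
split; last first.
  move=> u; rewrite /polar /real_polar; congr (_ +i* _).
    rewrite subrr -[u in u + u]scale1r -scalerDl qN -(scale0r u) qN normr0 expr0n mul0r subr0.
    by rewrite (_ : 1 + 1 = 2%:C :> C) ?Re_norm_real ?rmorph_nat// ger0_norm//; field.
  (* Hence q takes the same value at u - iu and u + iu, and the diagonal is real. *)
  have -> : u - 'i *: u = - 'i *: (u + 'i *: u).
    by rewrite scalerDr scaleNr scaleNr ii opprK addrC.
  by rewrite qN normrN /= expr0n expr1n add0r sqrtr1 expr1n mul1r subrr mul0r oppr0.
split; [exact: BD|split; [exact: BZ|split]] => [u v w|c u v].
  by rewrite (herm w) (herm w u) (herm w v) BD; exact: rmorphD.
by rewrite (herm v) (herm v u) BZ; exact: rmorphM.
Qed.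

Lemma form_diff (B : V -> V -> C) u v : sesquilinear B ->
  Re (B (u + v) (u + v)) - Re (B (u - v) (u - v)) = 2 * (Re (B u v) + Re (B v u)).
Proof.
move=> s.
rewrite !(formDr s) !(formDl s) !(formNl s) !(formNr s) opprK.
 move: (B u u) (B u v) (B v u) (B v v) => [a1 b1] [a2 b2] [a3 b3] [a4 b4] /=; ring.
Qed.

Lemma form_quadratic_relations (B : V -> V -> C) : sesquilinear B ->
  (forall u, 0 <= B u u) -> quadratic_relations (fun u => Re (B u u)).
Proof.
move=> s B0; have h := form_herm s B0.
have I0 u : complex.Im (B u u) = 0 by exact: ger0_Im.
split.
- by move=> u v w; rewrite !(form_diff _ _ s) (formDr s) (formDl s) !ReD; ring.
- move=> c u v; rewrite !(form_diff _ _ s) (formZr s) (formZl s) conjc_real !ReM /=; ring.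
- move=> c u; rewrite (formZr s) (formZl s) normcE2 mulrA !ReM ImM I0.
  by case: c => a b /=; ring.
- by move=> u; have := B0 u; rewrite lecE => /andP[].
Qed.

Lemma form_polar (B : V -> V -> C) u v : sesquilinear B -> (forall u, 0 <= B u u) ->
  polar (fun x => Re (B x x)) u v = B u v.
Proof.
move=> s B0; have h x y : real_polar (fun x => Re (B x x)) x y = Re (B x y).
  rewrite /real_polar (form_diff _ _ s) (form_herm s B0 x y).
  by case: (B x y) => a b /=; field.
rewrite /polar !h (formZr s); case: (B u v) => a b /=.
by congr (_ +i* _); ring.
Qed.

End polarization.


(** * POVMs and their families of laws *)

Section povm_of_law.
Context (R : realType) (n : nat) (A : pmetricType R).
Local Notation H := (modes R n).
Local Notation C := R[i].
Local Notation Re := (@complex.Re R).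
Local Notation law := (H -> {measure set (borel_type A) -> \bar R}).
Implicit Types (D : set (borel_type A) -> H -> H) (mu : law) (u v : H).

Definition povm_law D v : set (borel_type A) -> \bar R :=
  fun E => (Re (inner v (D E v)))%:E.

Definition law_family mu : Prop := (forall v, mu v setT = (nsq v)%:E) /\
  forall E, measurable E -> quadratic_relations (fun v => fine (mu v E)).

Lemma povm_ge0 D v E : is_povm D -> measurable E -> (0 <= povm_law D v E)%E.
Proof.
move=> pD mE; rewrite lee_fin.
by have := povm_positive pD mE v; rewrite lecE => /andP[].
Qed.

Lemma povm_measure D v : is_povm D -> exists mu : {measure set (borel_type A) -> \bar R},
  forall E, measurable E -> mu E = povm_law D v E.
Proof.
move=> pD.
have sadd (F : (set (borel_type A))^nat) : (forall k, measurable (F k)) -> trivIset setT F ->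
    (fun k => \sum_(0 <= i < k) povm_law D v (F i))%E @ \oo -->
      povm_law D v (\bigcup_k F k).
  move=> mF tF; have /cvg_complexP[h _] := @povm_sigma_additive _ _ _ _ pD _ mF tF v v.
  rewrite (_ : (fun k => _) = EFin \o (Re \o series (fun k => inner v (D (F k) v)))).
    by apply: (cvg_comp _ _ h); exact: cvg_id.
  by apply/funext => k; rewrite /= /series /= Re_sum /povm_law sumEFin.
apply: ex_measure => [|E mE|F mF tF _]; last exact: sadd.
(* The empty set gets measure 0 from additivity: for the constant sequence of empty sets the partial
   sums k c converge to c, so their increments, all equal to c, tend to 0. *)
- have := sadd (fun=> set0) (fun=> measurable0) (@trivIset_set0 _ _ _).
  rewrite bigcup0// => h; rewrite /povm_law in h *; congr EFin.
  set c := Re _ in h *.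
  have /fine_cvg h' : ((c *+ k)%:E @[k --> \oo] --> c%:E)%E.
    by apply: cvg_trans h; apply: near_eq_cvg; near=> k; rewrite sumEFin sumr_const_nat subn0.
  have h1 : (c *+ k.+1 @[k --> \oo] --> c).
    by rewrite (cvg_shiftS (fun k => c *+ k)).
  have h2 : (fun k : nat => c *+ k.+1 - c *+ k) @ \oo --> c - c by exact: cvgB h1 h'.
  have h3 : (fun k : nat => c *+ k.+1 - c *+ k) @ \oo --> c.
    by under eq_fun do rewrite mulrS addrK; exact: cvg_cst.
  by have := cvg_unique _ h3 h2; rewrite subrr; apply.
- exact: povm_ge0.
Unshelve. all: by end_near. Qed.

Lemma povm_law_family D : is_povm D -> exists mu : law, law_family mu /\
  forall v E, measurable E -> mu v E = povm_law D v E.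
Proof.
move=> pD; have /choice[mu muE] := fun v => povm_measure v pD.
exists mu; split=> //; split=> [v|E mE].
  by rewrite muE// /povm_law (povm_total pD).
have [l _] := povm_bounded pD mE.
have := form_quadratic_relations (positive_form l (povm_positive pD mE)) (povm_positive pD mE).
congr quadratic_relations; apply/funext => v; by rewrite muE.
Qed.

Lemma law_family_le mu v E : law_family mu -> measurable E -> fine (mu v E) <= nsq v.
Proof.
move=> [muT _] mE; rewrite -[leRHS]/(fine (nsq v)%:E) -muT fine_le//.
- by apply: finite_measure_fin_num mE => x; rewrite muT ltry.
- by rewrite muT.
- by apply: le_measure => //; apply: mem_set.
Qed.

Lemma law_family_fin mu v E : law_family mu -> measurable E -> mu v E \is a fin_num.
Proof. by move=> [muT _]; apply: finite_measure_fin_num => x; rewrite muT ltry. Qed.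

(** Cauchy-Schwarz for the polarized form, together with q <= [nsq], makes it bounded with constant
    1. *)
Lemma law_operator mu E : law_family mu -> measurable E -> exists T : H -> H,
  [/\ bounded_operator T, positive_operator T &
    forall u v, inner u (T v) = polar (fun x => fine (mu x E)) u v].
Proof.
move=> Fmu mE; have [s d] := polar_form (Fmu.2 E mE).
have d0 u : 0 <= polar (fun x => fine (mu x E)) u u.
  by rewrite d lecR fine_ge0.
have [|T bT TE] := operator_of_form ler01 s.
  move=> u v; rewrite mul1r; apply: le_trans (form_CS s d0 u v) _.
  rewrite !d /=; apply: ler_pM; rewrite ?fine_ge0//; exact: law_family_le.
by exists T; split => // u; rewrite TE.
Qed.

Lemma polar_cvg (q : H -> nat -> R) (l : H -> R) u v :
  (forall x, q x @ \oo --> l x) ->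
  ((fun k => polar (q^~ k) u v) : nat -> C^o) @ \oo --> (polar l u v : C^o).
Proof.
move=> ql; have h x y : (fun k => real_polar (q^~ k) x y) @ \oo --> real_polar l x y.
  by apply: cvgMl; apply: cvgB.
by apply/cvg_complexP; split; [exact: h|apply: cvgN; exact: h].
Qed.

Lemma polar_sum (q : nat -> H -> R) k u v :
  \sum_(0 <= i < k) polar (q i) u v = polar (fun x => \sum_(0 <= i < k) q i x) u v.
Proof.
have h x y : \sum_(0 <= i < k) real_polar (q i) x y =
    real_polar (fun x => \sum_(0 <= i < k) q i x) x y.
  by rewrite /real_polar -mulr_suml sumrB.
apply/eqP; rewrite eq_complex Re_sum Im_sum /= h eqxx /=.
by rewrite sumrN h.
Qed.

Lemma polar_nsq u v : polar (@nsq R _) u v = inner u v.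
Proof. exact: form_polar (inner_sesquilinear R _) (@inner_ge0 R _). Qed.

(** Polarization is a fixed finite combination of values of q, so countable additivity of the laws
    passes to all matrix elements. *)
Lemma povm_of_law mu : law_family mu -> exists D, is_povm D /\
  forall E, measurable E -> forall u v,
    inner u (D E v) = polar (fun x => fine (mu x E)) u v.
Proof.
move=> Fmu.
have ex E : exists T : H -> H, measurable E ->
    [/\ bounded_operator T, positive_operator T &
    forall u v, inner u (T v) = polar (fun x => fine (mu x E)) u v].
  have [mE|nE] := pselect (measurable E); last by exists idfun.
  by have [T hT] := law_operator Fmu mE; exists T.
have /choice[D DE] := ex.
exists D; split; last by move=> E /DE[].
split=> [E /DE[]//|E /DE[]//|F mF tF u v|].
- have mUF : measurable (\bigcup_k F k) by exact: bigcupT_measurable.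
  have [_ _ ->] := DE _ mUF.
  rewrite (_ : series _ = fun k => polar (fun x => fine (\sum_(0 <= i < k) mu x (F i))%E) u v).
    apply: polar_cvg => x.
    apply/fine_cvg; rewrite fineK; last exact: law_family_fin.
    exact: measure_semi_sigma_additive.
  apply/funext => k; rewrite /series /=.
  under eq_bigr => i _ do (have [_ _ ->] := DE _ (mF i)).
  rewrite polar_sum; congr polar; apply/funext => x.
  rewrite -sum_fine// => i _; exact: law_family_fin.
- apply/funext => v; apply: inner_extr => u.
  have [_ _ ->] := DE _ measurableT; rewrite -polar_nsq; congr polar.
  by apply/funext => x; rewrite Fmu.1.
Qed.

End povm_of_law.


Section averaged_law.
Context (R : realType) (n : nat) (A : pmetricType R).
Hypothesis cA : compact [set: A].
Local Notation H := (modes R n).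
Local Notation C := R[i].
Local Notation law := (H -> {measure set (borel_type A) -> \bar R}).
Local Notation W := (@collective R n).
Implicit Types (v : H) (w z : C) (f g : A -> R).

Variables (mu : law) (Fmu : law_family mu).
Variable m : (C -> R) -> R.
Hypothesis m_mean : invariant_mean m.

Let mD h k M N : bounded_by M h -> bounded_by N k ->
  m (fun x => h x + k x) = m h + m k.
Proof. by case: m_mean => + _ _ _; apply. Qed.
Let mZ c h M : bounded_by M h -> m (fun x => c * h x) = c * m h.
Proof. by case: m_mean => _ + _ _; apply. Qed.
Let m_le h M B : bounded_by M h -> (forall x, h x <= B) -> m h <= B.
Proof. by case: m_mean => _ _ + _; apply. Qed.
Let m_shift h M t : bounded_by M h -> m (fun x => h (x + t)) = m h.
Proof. by case: m_mean => _ _ _; apply. Qed.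

Let mean_ge0 h M : bounded_by M h -> (forall x, 0 <= h x) -> 0 <= m h.
Proof.
move=> hM h0; have := @m_le (fun x => (-1) * h x) M 0; rewrite (mZ _ hM) mulN1r oppr_le0.
by apply=> x; rewrite mulN1r ?normrN ?oppr_le0.
Qed.

Let mean_cst c : m (fun=> c) = c.
Proof.
have b1 : bounded_by 1 (fun _ : C => 1 : R) by move=> x; rewrite normr1.
have m1 : m (fun=> 1) = 1.
  apply/eqP; rewrite eq_le (m_le b1)//=.
  have h : m (fun=> -1 * 1) <= -1.
    by apply: (@m_le _ 1) => x; rewrite mulN1r ?normrN ?normr1.
  by rewrite (mZ _ b1) mulN1r lerN2 in h.
rewrite -[RHS](mulr1 c) -[X in _ = c * X]m1 -(mZ c b1); congr m; apply/funext => x.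
by rewrite mulr1.
Qed.

Let mean_sum (J : Type) (r : seq J) (F : J -> C -> R) (M : J -> R) :
  (forall j, bounded_by (M j) (F j)) ->
  m (fun x => \sum_(j <- r) F j x) = \sum_(j <- r) m (F j) /\
  exists B, bounded_by B (fun x => \sum_(j <- r) F j x).
Proof.
move=> FM; elim: r => [|j r [IH [B hB]]].
  split; first by under eq_fun do rewrite big_nil; rewrite mean_cst big_nil.
  by exists 0 => x; rewrite big_nil normr0.
split; last first.
  exists (M j + B) => x; rewrite big_cons (le_trans (ler_normD _ _))// lerD//; exact: FM.
under eq_fun do rewrite big_cons; rewrite (mD (FM j) hB) IH big_cons //.
Qed.

Definition law_value f v w : R := (\int[mu (W w v)]_a f a)%R.

Lemma law_finite v : (mu v setT < +oo)%E. Proof. by rewrite Fmu.1 ltry. Qed.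

Lemma continuous_integrable f v : continuous f -> (mu v).-integrable setT (EFin \o f).
Proof.
move=> cf; apply: measurable_bounded_integrable => //; first exact: law_finite.
  exact: continuous_measurable.
have [M M0 hM] := compact_continuous_bounded cA cf.
exists M; split; first exact: num_real.
by move=> x Mx a _; exact: le_trans (hM a) (ltW Mx).
Qed.

Lemma law_value_bounded f v M : continuous f -> (forall a, `|f a| <= M) ->
  bounded_by (M * nsq v) (law_value f v).
Proof.
move=> cf fM w; apply: le_trans (le_normr_Rintegral _ (continuous_integrable _ cf)) _ => //.
have cn : continuous (fun a => `|f a|) by move=> a; apply: cvg_norm; exact: cf.
apply: (@le_trans _ _ (\int[mu (W w v)]_(a in setT) M)).
  apply: le_Rintegral => //; first exact: continuous_integrable.
  by apply: continuous_integrable; exact: continuousC.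
by rewrite Rintegral_cst// Fmu.1 /= nsq_collective.
Qed.

Let value_bounded f v : continuous f -> exists M, bounded_by M (law_value f v).
Proof.
move=> cf; have [M M0 hM] := compact_continuous_bounded cA cf.
by exists (M * nsq v); exact: law_value_bounded.
Qed.

Definition mean_value v f : R := m (law_value f v).

Lemma mean_measure v : exists nu : {measure set (borel_type A) -> \bar R},
  forall f, continuous f -> (forall a, 0 <= f a) ->
    (\int[nu]_a (f a)%:E = (mean_value v f)%:E)%E.
Proof.
apply: riesz_measure => //.
- move=> f g cf cg; have [M hM] := value_bounded v cf; have [N hN] := value_bounded v cg.
  rewrite /mean_value -(mD hM hN); congr m; apply/funext => w.
  by rewrite /law_value RintegralD//; exact: continuous_integrable.
- move=> c f cf; have [M hM] := value_bounded v cf.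
  rewrite /mean_value -(mZ c hM); congr m; apply/funext => w.
  by rewrite /law_value RintegralZl//; exact: continuous_integrable.
- move=> f cf f0; have [M hM] := value_bounded v cf.
  by apply: mean_ge0 hM _ => w; apply: Rintegral_ge0.
Qed.

Lemma mean_law : exists nu : law,
  [/\ law_family nu,
    forall w v E, measurable E -> nu (W w v) E = nu v E &
    forall v f, continuous f -> (forall a, 0 <= f a) ->
      (\int[nu v]_a (f a)%:E = (mean_value v f)%:E)%E].
Proof.
have /choice[nu nuE] := mean_measure.
have nuT v : nu v setT = (nsq v)%:E.
  have := nuE v (fun=> 1) (@continuousC R A 1) (fun _ => ler01).
  rewrite integral_cst// mul1e => ->; congr EFin; rewrite /mean_value -(mean_cst (nsq v)).
  congr m; apply/funext => w; rewrite /law_value Rintegral_cst// mul1r Fmu.1 /=.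
  exact: nsq_collective.
have nu_fin v : (nu v setT < +oo)%E by rewrite nuT ltry.
have transfer (s : seq (R * H)) :
    (forall w E, measurable E -> \sum_(p <- s) p.1 * fine (mu (W w p.2) E) = 0) ->
    forall E, measurable E -> \sum_(p <- s) p.1 * fine (nu p.2 E) = 0.
  move=> rel; apply: continuous_relation_borel => // f cf f01.
  have f0 a : 0 <= f a by have /andP[] := f01 a.
  under eq_bigr do rewrite nuE//=.
  have bf v : bounded_by (1 * nsq v) (law_value f v).
    by apply: law_value_bounded => // a; have /andP[_] := f01 a; rewrite ger0_norm.
  have bp (p : R * H) : bounded_by (`|p.1| * (1 * nsq p.2)) (fun w => p.1 * law_value f p.2 w).
    by move=> w; rewrite normrM ler_wpM2l// bf.
  rewrite (eq_bigr (fun p => m (fun w => p.1 * law_value f p.2 w))) => [|p _]; last first.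
    by rewrite (mZ _ (bf p.2)).
  have [<- _] := mean_sum s bp; rewrite -[RHS]mean_cst; congr m; apply/funext => w.
  apply: (@set_relation_integral _ (borel_type A) R H (fun v => mu (W w v)) _ s f 1) => //.
  - by move=> v; exact: law_finite.
  - exact: rel.
  - exact: continuous_measurable.
have inv w v E : measurable E -> nu (W w v) E = nu v E.
  apply: borel_measure_unique => // f cf f01.
  have f0 a : 0 <= f a by have /andP[] := f01 a.
  have e1 := nuE (W w v) f cf f0; have e2 := nuE v f cf f0.
  apply: etrans e1 _; apply: etrans _ (esym e2); apply: (congr1 EFin).
  have [M hM] := value_bounded v cf.
  (* At x the function averaged for W_w v is the one for v at x + w: W_x W_w v is W_(x+w) v up to a
     scalar of modulus 1, which a quadratic law ignores. *)
  apply: etrans _ (m_shift w hM); apply: (congr1 m); apply/funext => x.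
  apply: (congr1 fine); apply: eq_integral_set_function => F mF.
  have e3 := collective_comp x w v; apply: etrans (congr1 (fun y => mu y F) e3) _.
  have [_ _ q _] := Fmu.2 F mF.
  have := q (weyl_phase x w ^+ n) (W (x + w) v); rewrite weyl_phase_norm mul1r.
  have fin y : mu y F \is a fin_num by exact: law_family_fin.
  move=> q1; exact: etrans (esym (fineK (fin _))) (etrans (congr1 EFin q1) (fineK (fin _))).
have WD x a b : W x (a + b) = W x a + W x b := collectiveD x a b.
have WZ x c a : W x (c *: a) = c *: W x a := collectiveZ x c a.
have WB x a b : W x (a - b) = W x a - W x b.
  by apply: etrans (WD x a (- b)) _; rewrite -[- b]scaleN1r WZ scaleN1r.
(* The three relations as weighted sums ending in 0, the shape in which [big_cons] unfolds the lists
   given to [transfer]. *)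
have r6 (a b c d e f : R) : a - b = c - d + (e - f) <->
    1 * a + (-1 * b + (-1 * c + (1 * d + (-1 * e + (1 * f + 0))))) = 0.
  by split => *; lra.
have r4 (a b c d e : R) : a - b = c * (d - e) <->
    1 * a + (-1 * b + (- c * d + (c * e + 0))) = 0.
  by split => *; lra.
have r2 (a b c : R) : a = b * c <-> 1 * a + (- b * c + 0) = 0 by split => *; lra.
exists nu; split => //; split => // E mE; split.
- move=> u v w.
  have t : \sum_(p <- [:: (1, u + (v + w)); (-1, u - (v + w)); (-1, u + v); (1, u - v);
      (-1, u + w); (1, u - w)]) p.1 * fine (nu p.2 E) = 0.
    apply: transfer => // x F mF; rewrite !big_cons big_nil /=.
    have [q _ _ _] := Fmu.2 F mF; have := q (W x u) (W x v) (W x w).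
    rewrite (WB x u (v + w)) (WD x u (v + w)) (WD x v w) (WD x u v) (WB x u v).
    rewrite (WD x u w) (WB x u w); exact: (r6 _ _ _ _ _ _).1.
  by rewrite !big_cons big_nil /= in t; exact: (r6 _ _ _ _ _ _).2 t.
- move=> c u v.
  have t : \sum_(p <- [:: (1, u + c%:C *: v); (-1, u - c%:C *: v); (- c, u + v); (c, u - v)])
      p.1 * fine (nu p.2 E) = 0.
    apply: transfer => // x F mF; rewrite !big_cons big_nil /=.
    have [_ q _ _] := Fmu.2 F mF; have := q c (W x u) (W x v).
    rewrite (WB x u (c%:C *: v)) (WD x u (c%:C *: v)) (WZ x c%:C v) (WD x u v) (WB x u v).
    exact: (r4 _ _ _ _ _).1.
  by rewrite !big_cons big_nil /= in t; exact: (r4 _ _ _ _ _).2 t.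
- move=> c u.
  have t : \sum_(p <- [:: (1, c *: u); (- (complex.Re `|c|) ^+ 2, u)])
      p.1 * fine (nu p.2 E) = 0.
    apply: transfer => // x F mF; rewrite !big_cons big_nil /=.
    have [_ _ q _] := Fmu.2 F mF; have := q c (W x u); rewrite (WZ x c u).
    exact: (r2 _ _ _).1.
  by rewrite !big_cons big_nil /= in t; exact: (r2 _ _ _).2 t.
- by move=> u; rewrite fine_ge0.
Qed.

Lemma mean_value_sum_le (v : nat -> H) (f : nat -> A -> R) k B :
  (forall i, continuous (f i)) ->
  (forall w, \sum_(0 <= i < k) law_value (f i) (v i) w <= B) ->
  \sum_(0 <= i < k) mean_value (v i) (f i) <= B.
Proof.
move=> cf fB; have /choice[M hM] := fun i => value_bounded (v i) (cf i).
have [<- [N hN]] := mean_sum (index_iota 0 k) hM.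
exact: m_le hN fB.
Qed.

End averaged_law.

Section averaged_povm.
Context (R : realType) (n : nat) (A : pmetricType R).
Hypothesis cA : compact [set: A].
Local Notation H := (modes R n).
Implicit Types (D : set (borel_type A) -> H -> H) (f : A -> R).

Lemma povm_integral D v (mu : {measure set (borel_type A) -> \bar R}) (f : A -> R) :
  (forall E, measurable E -> mu E = povm_law D v E) ->
  (\int[povm_law D v]_a (f a)%:E = \int[mu]_a (f a)%:E)%E.
Proof. by move=> h; apply: eq_integral_set_function => E mE; rewrite h. Qed.

(** All terms of the sum share the same w, so the mean is taken of the whole sum; bounding the terms
    one by one would cost a supremum over w for each. *)
Lemma ex_invariant_povm D : is_povm D -> exists D', [/\ is_povm D', displacement_invariant D' &
  forall (k : nat) (v : nat -> H) (f : nat -> A -> R) (B : R),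
    (forall i, continuous (f i)) -> (forall i a, 0 <= f i a) ->
    (forall w, \sum_(0 <= i < k) \int[povm_law D (collective w (v i))]_a (f i a)%:E <= B%:E)%E ->
    (\sum_(0 <= i < k) \int[povm_law D' (v i)]_a (f i a)%:E <= B%:E)%E].
Proof.
move=> pD; have [mu [Fmu muD]] := povm_law_family pD.
have [m m_mean] := ex_invariant_mean R R[i].
have [nu [Fnu nu_inv nuE]] := mean_law cA Fmu m_mean.
have [D' [pD' D'E]] := povm_of_law Fnu.
have nuD' v E : measurable E -> nu v E = povm_law D' v E.
  move=> mE; have [_ d] := polar_form (Fnu.2 E mE).
  have e := d v; have e1 := D'E E mE v v; rewrite e in e1.
  rewrite /povm_law e1 /=; exact/esym/fineK/law_family_fin.
exists D'; split => //.
  move=> w E mE W; apply/funext => v; apply: inner_extr => u.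
  rewrite /= /W -/(collective w) collective_adjoint.
  have := inner_collectiveN (- w) u (D' E (collective w v)); rewrite opprK => <-.
  apply: etrans (D'E E mE _ _) _; apply: etrans (esym (D'E E mE u v)).
  (* Polarization evaluates the law at four vectors; by linearity each is a displaced one, so
     invariance of [nu] is enough. *)
  rewrite /polar /real_polar.
  have P (a b : H) : nu (collective w a + collective w b) E = nu (a + b) E.
    by rewrite -(nu_inv w (a + b) E mE) (collectiveD w a b).
  have PB (a b : H) : nu (collective w a - collective w b) E = nu (a - b) E.
    have e : collective w (- b) = - collective w b.
      by rewrite -(scaleN1r b) (collectiveZ w (-1) b) scaleN1r.
    by rewrite -e; exact: P.
  rewrite -(collectiveZ w 'i v) (P u v) (PB u v) (P u ('i *: v)).
  by rewrite (PB u ('i *: v)).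
move=> k v f B cf f0 fB.
under eq_bigr => i _ do
  rewrite (povm_integral (f i) (fun E mE => nuD' (v i) E mE)) nuE//.
rewrite sumEFin lee_fin; apply: mean_value_sum_le => // w; rewrite -lee_fin -sumEFin.
apply: le_trans (fB w); apply: lee_sum => i _.
rewrite (povm_integral (f i) (fun E mE => muD _ E mE)) /law_value fineK//.
apply: integrable_fin_num => //; exact: continuous_integrable.
Qed.

End averaged_povm.

(** * Risks of thermal states *)

Lemma ex_finite_measure d (T : measurableType d) (R : realType)
    (mu : {measure set T -> \bar R}) : (mu setT < +oo)%E ->
  exists nu : {finite_measure set T -> \bar R}, nu = mu :> (set T -> \bar R).
Proof.
move=> muoo; exists (mfrestr measurableT muoo).
by apply/funext => E; exact: congr1 (setIT E).
Qed.

(** * Loss kernels over a compact parameter set *)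

Section continuous_kernels.
Context (R : realType) (A : pmetricType R).
Hypothesis cA : compact [set: A].
Variables (K : set R) (G : R -> A -> R) (M : R).
Hypotheses (cK : compact K) (G0 : forall N a, K N -> 0 <= G N a)
  (GM : forall N a, K N -> G N a <= M)
  (cG : {within K `*` [set: A], continuous (fun p : R * A => G p.1 p.2)}).
Local Notation T := (measurableTypeR R).
Implicit Types (N : R) (a b : A) (e : R).

Let mK : measurable (K : set T). Proof. exact: compact_measurable. Qed.

Lemma kernel_near N b e : K N -> 0 < e ->
  \forall N' \near N & a \near b, K N' -> `|G N' a - G N b| < e.
Proof.
move=> KN e0; have := (subspace_continuousP _ _).1 cG (N, b) (conj KN I).
move=> /cvgrPdist_lt/(_ e e0); rewrite near_withinE => h.
suff : \forall p \near (N, b), K p.1 -> `|G p.1 p.2 - G N b| < e by [].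
by apply: filterS h => -[x y] /= h Kx; rewrite distrC; apply: h.
Qed.

(** The tube lemma: compactness of K merges the neighbourhoods obtained at each (N, b) into one
    neighbourhood of b. *)
Lemma kernel_uniform_near b e : 0 < e ->
  \forall a \near b, forall N, K N -> `|G N a - G N b| < e.
Proof.
move=> e0; have := (near_covering_withinP K).2 ((compact_near_coveringP K).1 cK).
move=> /(_ A (nbhs b) (fun a N => `|G N a - G N b| < e) _); apply => N KN.
have e2 : 0 < e / 2 by rewrite divr_gt0.
have h := kernel_near b KN e2.
have h' : \forall N' \near N & a \near b, K N' -> `|G N' b - G N b| < e / 2.
  case: h => -[U V] [/= hU hV] hUV; exists (U, V) => //= -[x y] [/= Ux Vy] Kx.
  exact: (hUV (x, b) (conj Ux (nbhs_singleton hV)) Kx).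
apply: filterS2 h h' => -[x y] /= h1 h2 Kx.
have := h1 Kx; have := h2 Kx; rewrite !ltr_norml => /andP[? ?] /andP[? ?].
by apply/andP; split; lra.
Qed.

Lemma kernel_continuous_l a : {within K, continuous (fun N => G N a)}.
Proof.
apply/subspace_continuousP => N KN; apply/cvgrPdist_lt => e e0; rewrite /within /=.
have [[U V] [/= hU hV] hUV] := kernel_near a KN e0.
apply: filterS hU => x Ux Kx; rewrite distrC.
exact: (hUV (x, a) (conj Ux (nbhs_singleton hV)) Kx).
Qed.

Lemma kernel_measurable_l a : measurable_fun (K : set T) (fun N => G N a).
Proof. by apply: subspace_continuous_measurable_fun => //; exact: kernel_continuous_l. Qed.

Lemma kernel_continuous_r N : K N -> continuous (G N).
Proof.
move=> KN b; apply/cvgrPdist_lt => e e0.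
apply: filterS (kernel_uniform_near b e0) => a /(_ N KN); by rewrite distrC.
Qed.

(** Set to 0 off K, so that measurability and Tonelli are available on the whole line. *)
Definition cut_kernel a : T -> R := (fun N => G N a) \_ K.

Lemma cut_kernel_measurable a : measurable_fun setT (cut_kernel a).
Proof.
have [k _] := measurable_restrictT (fun N => G N a) mK.
exact: k (@kernel_measurable_l a).
Qed.

(* Replaces a by the first point of s whose e-ball has a in its interior. *)
Fixpoint nearby_kernel (s : seq A) e (p : T * borel_type A) : R :=
  if s is c :: s' then
    if (p.2 : A) \in ((ball c e)° : set A) then cut_kernel c p.1 else nearby_kernel s' e p
  else 0.

Lemma nearby_kernel_measurable s e : measurable_fun setT (nearby_kernel s e).
Proof.
elim: s => [|c s IH]; first exact: measurable_cst.
apply: measurable_fun_ifT => //; last first.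
  by apply: measurableT_comp => //; exact: cut_kernel_measurable.
apply: (measurable_fun_bool true).
rewrite (_ : _ @^-1` _ = snd @^-1` ((ball c e)° : set (borel_type A))).
  have m2 := @measurable_snd _ _ T (borel_type A); apply: m2 => //.
  by apply: open_measurable_borel; exact: open_interior.
by apply/seteqP; split => -[x y] /= => [/set_mem|/mem_set].
Qed.

Lemma nearby_kernelP s e p c : c \in s -> (ball c e)° (p.2 : A) ->
  exists2 c', ball c' e (p.2 : A) & nearby_kernel s e p = cut_kernel c' p.1.
Proof.
elim: s => [//|d s IH]; rewrite inE /= => cs cp.
case: ifPn => [|dp]; first by move=> /set_mem/interior_subset dp; exists d.
by case/orP: cs => [/eqP cd|/IH]; [rewrite -cd mem_set in dp|exact].
Qed.

Lemma finite_net e : 0 < e -> exists s : seq A, forall a, exists2 c, c \in s & (ball c e)° a.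
Proof.
move=> e0; have := cA; rewrite compact_cover => /(_ A setT (fun c => (ball c e)°)).
case=> [c _|a _|D _ hD]; first exact: open_interior.
  by exists a => //; exact: nbhsx_ballx.
by exists (enum_fset D) => a; have [c /= cD ca] := hD a I; exists c.
Qed.

(** Tonelli asks for measurability in the product of the two Borel sigma-algebras. The kernel is a
    pointwise limit of functions that are piecewise constant in the action, built on finite nets of
    radius 1/(k+1). *)
Lemma cut_kernel_jointly_measurable :
  measurable_fun setT (fun p : T * borel_type A => cut_kernel p.2 p.1).
Proof.
have e0 (k : nat) : 0 < k.+1%:R^-1 :> R by rewrite invr_gt0.
have /choice[s hs] := fun k => finite_net (e0 k).
apply: (@measurable_fun_cvg _ _ _ _ (fun k => nearby_kernel (s k) k.+1%:R^-1)).
  by move=> k; exact: nearby_kernel_measurable.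
move=> [N b] _ /=; apply/cvgrPdist_lt => e ep.
have [KN|nKN] := pselect (K N); last first.
  near=> k; have [c cs cb] := hs k b.
  have [c' _ ->] := @nearby_kernelP (s k) _ (N, b) c cs cb.
  by rewrite /cut_kernel /= !patchE memNset//= subr0 normr0.
have : \forall a \near b, `|G N b - G N a| < e.
  by have /cvgrPdist_lt/(_ e ep) := @kernel_continuous_r N KN b.
move=> /nbhs_ballP[d /= d0 hd].
near=> k; have [c cs cb] := hs k b.
have [c' c'b ->] := @nearby_kernelP (s k) _ (N, b) c cs cb.
rewrite /cut_kernel /= !patchE mem_set//=; apply: hd.
apply: ball_sym; apply: le_ball c'b; apply/ltW.
near: k; exact: (near_infty_natSinv_lt (PosNum d0)).
Unshelve. all: by end_near. Qed.

Lemma cut_kernel_ge0 a N : 0 <= cut_kernel a N.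
Proof. by rewrite /cut_kernel patchE; case: ifPn => // /set_mem KN; exact: G0. Qed.

Lemma cut_kernel_le a N : cut_kernel a N <= `|M|.
Proof.
rewrite /cut_kernel patchE; case: ifPn => [/set_mem KN|_]; last exact: normr_ge0.
by apply: le_trans (GM a KN) _; exact: ler_norm.
Qed.

Variable Pi : probability T R.

Let PiT : Pi setT = 1%E. Proof. exact: (probability_setT Pi). Qed.
Let Pi_fin : (Pi setT < +oo)%E. Proof. by rewrite PiT ltry. Qed.

Definition mean_kernel a : R := (\int[Pi]_N cut_kernel a N)%R.

Lemma cut_kernel_integrable a : Pi.-integrable setT (EFin \o cut_kernel a).
Proof.
apply: measurable_bounded_integrable => //.
- exact: cut_kernel_measurable.
exists `|M|; split; first exact: num_real.
move=> x Mx N _; rewrite /= ger0_norm ?cut_kernel_ge0//.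
exact: le_trans (cut_kernel_le _ _) (ltW Mx).
Qed.

Lemma mean_kernelE a : (\int[Pi]_N (cut_kernel a N)%:E = (mean_kernel a)%:E)%E.
Proof.
by rewrite /mean_kernel /Rintegral fineK//; exact: integrable_fin_num (cut_kernel_integrable a).
Qed.

Lemma mean_kernel_ge0 a : 0 <= mean_kernel a.
Proof. by apply: Rintegral_ge0 => N _; exact: cut_kernel_ge0. Qed.

Lemma mean_kernel_continuous : continuous mean_kernel.
Proof.
move=> b; apply/cvgrPdist_le => e e0.
apply: filterS (kernel_uniform_near b e0) => a hab.
rewrite /mean_kernel -RintegralB//; try exact: cut_kernel_integrable.
have iB : Pi.-integrable setT (EFin \o (fun N => cut_kernel b N - cut_kernel a N)).
  have := integrableB measurableT (cut_kernel_integrable b) (cut_kernel_integrable a).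
  by congr (_.-integrable _ _).
have iN : Pi.-integrable setT (EFin \o (fun N => `|cut_kernel b N - cut_kernel a N|)).
  exact: integrable_norm iB.
apply: le_trans (le_normr_Rintegral _ iB) _ => //.
apply: (@le_trans _ _ (\int[Pi]_(N in setT) e)%R).
  apply: le_Rintegral => //.
    apply: measurable_bounded_integrable => //.
    exists `|e|; split; first exact: num_real.
    by move=> x ex N _; exact: ltW.
  move=> N _; rewrite /cut_kernel !patchE; case: ifPn => [/set_mem KN|_].
    by rewrite distrC ltW// hab.
  by rewrite subrr normr0 ltW.
have r := etrans (Rintegral_cst Pi measurableT e) (congr1 (fun x => e * fine x) PiT).
by rewrite [leLHS]r mulr1.
Qed.

Lemma kernel_tonelli (mu : {measure set (borel_type A) -> \bar R}) : (mu setT < +oo)%E ->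
  measurable_fun setT (fun N : T => \int[mu]_a (cut_kernel a N)%:E)%E /\
  (\int[Pi]_N \int[mu]_a (cut_kernel a N)%:E = \int[mu]_a (mean_kernel a)%:E)%E.
Proof.
move=> /ex_finite_measure[nu <-].
pose f (p : T * borel_type A) : \bar R := (cut_kernel p.2 p.1)%:E.
have mf : measurable_fun setT f.
  by apply/measurable_EFinP; exact: cut_kernel_jointly_measurable.
have f0 p : (0 <= f p)%E by rewrite lee_fin cut_kernel_ge0.
split; first exact: (@measurable_fun_fubini_tonelli_F _ _ T (borel_type A) R nu f mf f0).
have := @fubini_tonelli _ _ T (borel_type A) R Pi nu f mf f0; rewrite /f /= => e.
apply: etrans e _; apply: eq_integral => a _; exact: mean_kernelE.
Qed.

End continuous_kernels.


(** * Risks as series over number states *)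

Section risk_series.
Context (R : realType) (n : nat) (A : pmetricType R).
Local Notation J := {ffun 'I_n -> nat}.
Local Notation H := (modes R n).
Local Notation U := (@collective R n).
Implicit Types (D : set (borel_type A) -> H -> H) (N : R) (z w : R[i]) (f : A -> R).

(* The product basis enumerated by nat; 0, with weight 0, at unused indices. *)
Definition number_state (k : nat) : H := oapp (fun j : J => ket R j) 0 (@pickle_inv J k).
Definition number_weight N (k : nat) : R := oapp (joint_weight N) 0 (@pickle_inv J k).

Lemma number_weight_ge0 N k : 0 < N -> 0 <= number_weight N k.
Proof.
by move=> N0; rewrite /number_weight; case: pickle_inv => //= j; exact: joint_weight_ge0.
Qed.

Lemma number_weight_le1 N k : 0 < N -> number_weight N k <= 1.
Proof.
by move=> N0; rewrite /number_weight; case: pickle_inv => //= j; exact: joint_weight_le1.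
Qed.

Lemma continuous_number_weight k N : 0 < N -> {for N, continuous (number_weight^~ k)}.
Proof.
move=> N0; rewrite /number_weight; case: pickle_inv => [j|] /=; last exact: cvg_cst.
have N1 : N + 1 != 0 by rewrite gt_eqF// addr_gt0.
have ct m : (fun x : R => thermal_weight x m) @ N --> thermal_weight N m.
  have cD : (fun x : R => (x + 1)^-1) @ N --> (N + 1)^-1.
    by apply: cvgV => //; apply: cvgD; [exact: cvg_id|exact: cvg_cst].
  apply: cvgM => //; apply: (@continuous_comp _ _ _ (fun x : R => x / (x + 1)) (fun x => x ^+ m)).
    by apply: cvgM => //; exact: cvg_id.
  exact: exprn_continuous.
change ((fun x => joint_weight x j) @ N --> joint_weight N j).
rewrite /joint_weight; elim: (index_enum _) => [|i r IH].
  by under eq_fun do rewrite big_nil; rewrite big_nil; exact: cvg_cst.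
by under eq_fun do rewrite big_cons; rewrite big_cons; apply: cvgM; [exact: ct|exact: IH].
Qed.

(** Integration against the outcome law goes through a series of measures indexed by nat, hence the
    passage from multi-indices to nat. *)
Lemma outcome_law_series D z N E : is_povm D -> 0 < N -> measurable E ->
  (outcome_law (tensor_power n (displaced_thermal z N)) D E =
   \sum_(k <oo) (number_weight N k)%:E * povm_law D (U z (number_state k)) E)%E.
Proof.
move=> pD N0 mE; have bD := povm_bounded pD mE; have posD := povm_positive pD mE.
have [c Dc] := bounded_operator_nsq bD.
have h := trace_collective_state z N0 Dc (fun u v => positive_sym u v bD.1 posD).
pose p (l : J) := joint_weight N l * complex.Re (inner (U z (ket R l)) (D E (U z (ket R l)))).
have pE l : (joint_weight N l)%:C * inner (U z (ket R l)) (D E (U z (ket R l))) = (p l)%:C.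
  rewrite /p [RHS]rmorphM; congr (_ * _).
  exact: esym (RRe_real (ger0_real (posD _))).
pose g k := oapp p 0 (@pickle_inv J k).
have Re0 v : 0 <= complex.Re (inner v (D E v)) by have := posD v; rewrite lecE => /andP[].
have g0 k : 0 <= g k.
  by rewrite /g; case: pickle_inv => //= j; rewrite mulr_ge0 ?joint_weight_ge0.
(* [pickle] embeds the multi-indices in nat, and [g] vanishes off its range. *)
have gs : has_csum (fun k => (g k)%:C) (trace (tensor_power n (displaced_thermal z N) \o D E)).
  have inj : injective (@choice.pickle J) := pcan_inj (@pickleK_inv J).
  apply/(@has_csum_inj _ _ _ (@choice.pickle J) (fun k => (g k)%:C) _ inj).
    move=> k hk; rewrite /g; have := @pickle_invK J k.
    by case: pickle_inv => //= j jk; case: (hk j).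
  apply: eq_has_csum h => l; rewrite pE; apply: (congr1 (fun x => x%:C)).
  by rewrite /g /comp pickleK_inv.
rewrite /outcome_law -(csummable_esum g0 gs) -nneseries_esumT => [|k]; last by rewrite lee_fin.
apply: eq_eseriesr => k _; rewrite /= /g /number_weight /number_state.
by case: pickle_inv => [j|] /=; rewrite ?mul0e.
Qed.

Lemma povm_integral_ge0 D v f : is_povm D -> (forall a, 0 <= f a) ->
  (0 <= \int[povm_law D v]_a (f a)%:E)%E.
Proof.
move=> pD f0; have [mu [_ muE]] := povm_law_family pD.
rewrite (povm_integral f (fun E mE => muE v E mE)).
by apply: integral_ge0 => a _; rewrite lee_fin.
Qed.

(** The weight is moved from the measure into the integrand, where it can later be averaged over Pi
    together with the loss. *)
Lemma outcome_integral_series D z N f : is_povm D -> 0 < N -> continuous f ->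
  (forall a, 0 <= f a) ->
  (\int[outcome_law (tensor_power n (displaced_thermal z N)) D]_a (f a)%:E =
   \sum_(k <oo) \int[povm_law D (U z (number_state k))]_a (number_weight N k * f a)%:E)%E.
Proof.
move=> pD N0 cf f0; have [mu [_ muE]] := povm_law_family pD.
have mf : measurable_fun setT (EFin \o (f : borel_type A -> R)).
  by apply/measurable_EFinP; exact: continuous_measurable.
have w0 k : 0 <= number_weight N k by exact: number_weight_ge0.
pose m k : {measure set (borel_type A) -> \bar R} :=
  mscale (NngNum (w0 k)) (mu (U z (number_state k))).
have e E : measurable E ->
    outcome_law (tensor_power n (displaced_thermal z N)) D E = mseries m 0%N E.
  move=> mE; rewrite outcome_law_series//; apply: eq_eseriesr => k _.
  by rewrite -muE.
rewrite (eq_integral_set_function _ e) ge0_integral_measure_series// => [|a _]; last first.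
  by rewrite lee_fin.
apply: eq_eseriesr => k _; rewrite ge0_integral_mscale// => [|a _]; last by rewrite lee_fin.
rewrite (povm_integral (fun a => number_weight N k * f a) (fun E mE => muE _ E mE)).
under [RHS]eq_integral do rewrite EFinM.
by rewrite ge0_integralZl_EFin// => a _; rewrite lee_fin.
Qed.

Lemma invariant_povm_law D w v E : displacement_invariant D -> measurable E ->
  povm_law D (U w v) E = povm_law D v E.
Proof.
move=> iD mE; congr (complex.Re _)%:E.
have e := congr1 (fun T => inner v (T v)) (iD w E mE).
apply: etrans _ e; rewrite /= -/(collective w) collective_adjoint.
have := inner_collectiveN (- w) v (D E (collective w v)); rewrite opprK => <-.
by [].
Qed.

(** All integrals are nonnegative: a partial sum for D is at most its series, and the series for D'
    is the limit of its partial sums. *)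
Lemma ex_better_invariant_povm D : compact [set: A] -> is_povm D ->
  exists D', [/\ is_povm D', displacement_invariant D' &
  forall (f : nat -> A -> R) (S : \bar R),
    (forall k, continuous (f k)) -> (forall k a, 0 <= f k a) ->
    (forall w, \sum_(k <oo) \int[povm_law D (U w (number_state k))]_a (f k a)%:E <= S)%E ->
    (\sum_(k <oo) \int[povm_law D' (number_state k)]_a (f k a)%:E <= S)%E].
Proof.
move=> cA pD; have [D' [pD' iD' D'D]] := ex_invariant_povm cA pD.
exists D'; split => // f S cf f0 fS.
have S0 : (0 <= S)%E.
  by apply: le_trans (fS 0); apply: nneseries_ge0 => k _ _; exact: povm_integral_ge0.
apply: lime_le; first by apply: is_cvg_nneseries => k _ _; exact: povm_integral_ge0.
apply: nearW => k; case: S S0 fS => [B| |] // _ fS; last by rewrite leey.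
apply: D'D => // w; apply: le_trans (fS w).
by apply: nneseries_lim_ge => i _ _; exact: povm_integral_ge0.
Qed.

End risk_series.


Section thermal_risk.
Context (R : realType) (n : nat) (A : pmetricType R).
Hypothesis cA : compact [set: A].
Variables (K : set R) (L : R -> A -> R) (M : R).
Hypotheses (K_gt0 : forall N, K N -> 0 < N) (cK : compact K)
  (L0 : forall N a, K N -> 0 <= L N a) (LM : forall N a, K N -> L N a <= M)
  (cL : {within K `*` [set: A], continuous (fun p : R * A => L p.1 p.2)}).
Local Notation H := (modes R n).
Local Notation U := (@collective R n).
Local Notation state := (number_state R n).
Implicit Types (D : set (borel_type A) -> H -> H) (N : R) (z w : R[i]).

Definition weighted_loss k N (a : A) : R := number_weight n N k * L N a.

Let G0 k N a : K N -> 0 <= weighted_loss k N a.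
Proof. by move=> KN; rewrite mulr_ge0 ?L0//; apply: number_weight_ge0; exact: K_gt0. Qed.

Let GM k N a : K N -> weighted_loss k N a <= M.
Proof.
move=> KN; apply: le_trans (LM a KN); rewrite ler_piMl ?L0//.
by apply: number_weight_le1; exact: K_gt0.
Qed.

Let cG k : {within K `*` [set: A], continuous (fun p : R * A => weighted_loss k p.1 p.2)}.
Proof.
apply/subspace_continuousP => -[N a] [/= KN _].
have c1 : (fun p : R * A => number_weight n p.1 k) @ within (K `*` [set: A]) (nbhs (N, a)) -->
    number_weight n N k.
  apply: cvg_within_filter.
  have c0 : (fun N => number_weight n N k) @ N --> number_weight n N k :=
    @continuous_number_weight R n k N (K_gt0 KN).
  exact: (cvg_comp _ _ (@cvg_fst R A (nbhs N) (nbhs a) _) c0).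
exact: cvgM c1 ((subspace_continuousP _ _).1 cL (N, a) (conj KN I)).
Qed.

Lemma risk_series D z N : is_povm D -> K N ->
  (risk L D z N = \sum_(k <oo) \int[povm_law D (U z (state k))]_a (weighted_loss k N a)%:E)%E.
Proof.
move=> pD KN; apply: outcome_integral_series => //; first exact: K_gt0.
  by apply: kernel_continuous_r cK cL _ KN.
by move=> a; exact: L0.
Qed.

(** Two exchanges for nonnegative terms: the integral over Pi with the series in k, then with the
    integral over actions. *)
Lemma mean_risk_series D z (Pi : probability (measurableTypeR R) R) : is_povm D ->
  (\int[Pi]_(N in K) risk L D z N =
   \sum_(k <oo) \int[povm_law D (U z (state k))]_a
     (mean_kernel K (weighted_loss k) Pi a)%:E)%E.
Proof.
move=> pD; have [mu [Fmu muE]] := povm_law_family pD.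
have mu_fin v : (mu v setT < +oo)%E by rewrite Fmu.1 ltry.
have tonelli k := kernel_tonelli cA cK (@G0 k) (@GM k) (@cG k) Pi (mu_fin (U z (state k))).
rewrite integral_mkcond.
transitivity (\int[Pi]_N \sum_(k <oo)
    \int[mu (U z (state k))]_a (cut_kernel K (weighted_loss k) a N)%:E)%E.
  apply: eq_integral => N _; rewrite patchE; case: ifPn => [/set_mem KN|nKN].
    rewrite risk_series//; apply: eq_eseriesr => k _.
    rewrite (povm_integral _ (fun E mE => muE _ E mE)).
    by apply: eq_integral => a _; rewrite /cut_kernel patchE mem_set.
  rewrite eseries0// => k _ _; rewrite integral0_eq// => a _.
  by rewrite /cut_kernel patchE (negbTE nKN).
rewrite integral_nneseries// => [|k|k N _]; last first.
- apply: integral_ge0 => a _; rewrite lee_fin; exact: cut_kernel_ge0 (@G0 k) _ _.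
- by have [] := tonelli k.
apply: eq_eseriesr => k _; have [_ ->] := tonelli k.
by rewrite (povm_integral _ (fun E mE => muE _ E mE)).
Qed.

Lemma invariant_series D w (f : nat -> A -> R) : displacement_invariant D ->
  (\sum_(k <oo) \int[povm_law D (U w (state k))]_a (f k a)%:E =
   \sum_(k <oo) \int[povm_law D (state k)]_a (f k a)%:E)%E.
Proof.
move=> iD; apply: eq_eseriesr => k _; apply: eq_integral_set_function => E mE.
exact: invariant_povm_law.
Qed.

Lemma invariant_risk_series D z N : is_povm D -> displacement_invariant D -> K N ->
  (risk L D z N = \sum_(k <oo) \int[povm_law D (state k)]_a (weighted_loss k N a)%:E)%E.
Proof.
by move=> pD iD KN; exact: etrans (risk_series z pD KN) (invariant_series z _ iD).
Qed.

Lemma invariant_mean_risk_series D z (Pi : probability (measurableTypeR R) R) :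
  is_povm D -> displacement_invariant D ->
  (\int[Pi]_(N in K) risk L D z N =
   \sum_(k <oo) \int[povm_law D (state k)]_a (mean_kernel K (weighted_loss k) Pi a)%:E)%E.
Proof.
by move=> pD iD; exact: etrans (mean_risk_series z Pi pD) (invariant_series z _ iD).
Qed.

Lemma mean_loss_continuous k (Pi : probability (measurableTypeR R) R) :
  continuous (mean_kernel K (weighted_loss k) Pi).
Proof. exact: (mean_kernel_continuous cK (@G0 k) (@GM k) (@cG k)). Qed.

Lemma mean_loss_ge0 k (Pi : probability (measurableTypeR R) R) a :
  0 <= mean_kernel K (weighted_loss k) Pi a.
Proof. exact: mean_kernel_ge0 (@G0 k) _ _. Qed.

Lemma weighted_loss_continuous k N : K N -> continuous (weighted_loss k N).
Proof. by move=> KN; apply: kernel_continuous_r cK (@cG k) _ KN. Qed.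

Lemma weighted_loss_ge0 k N a : K N -> 0 <= weighted_loss k N a.
Proof. exact: G0. Qed.

End thermal_risk.

Theorem theorem6p4 (R : realType) (n : nat) (hn : (2 <= n)%N)
  (K : set R) (K_gt0 : forall N, K N -> 0 < N) (K_compact : compact K)
  (A : pmetricType R) (A_compact : compact [set: A])
  (L : R -> A -> R)
  (L_ge0 : forall N a, K N -> 0 <= L N a)
  (L_bounded : exists M : R, forall N a, K N -> L N a <= M)
  (L_continuous : {within K `*` [set: A], continuous (fun p : R * A => L p.1 p.2)}) :
  [/\ ereal_inf [set ereal_sup [set risk L D z N | z in [set: R[i]] & N in K]
                | D in povms n A]
      = ereal_inf [set ereal_sup [set risk L D z N | z in [set: R[i]] & N in K]
                  | D in invariant_povms n A],
      ereal_inf [set ereal_sup [set risk L D z N | z in [set: R[i]] & N in K]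
                | D in invariant_povms n A]
      = ereal_inf [set ereal_sup [set risk L D 0%R N | N in K]
                  | D in invariant_povms n A]
    & forall Pi : probability (measurableTypeR R) R, Pi K = 1%E ->
      ereal_inf [set ereal_sup [set (\int[Pi]_(N in K) risk L D z N)%E
                               | z in [set: R[i]]]
                | D in povms n A]
      = ereal_inf [set (\int[Pi]_(N in K) risk L D 0%R N)%E
                  | D in invariant_povms n A]].
Proof.
have [M LM] := L_bounded.
have iE D z N := @invariant_risk_series R n A K L K_gt0 K_compact L_ge0 L_continuous D z N.
have miE D z Pi := @invariant_mean_risk_series R n A A_compact K L M
  K_gt0 K_compact L_ge0 LM L_continuous D z Pi.
have inv_risk D z w N : invariant_povms n A D -> K N -> risk L D z N = risk L D w N.
  by move=> [pD iD] KN; exact: etrans (iE D z N pD iD KN) (esym (iE D w N pD iD KN)).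
have inv_mean D z w (Pi : probability (measurableTypeR R) R) : invariant_povms n A D ->
    (\int[Pi]_(N in K) risk L D z N = \int[Pi]_(N in K) risk L D w N)%E.
  by move=> [pD iD]; exact: etrans (miE D z Pi pD iD) (esym (miE D w Pi pD iD)).
have inv_sup D : invariant_povms n A D ->
    ereal_sup [set risk L D z N | z in [set: R[i]] & N in K] =
    ereal_sup [set risk L D 0%R N | N in K].
  move=> iD; apply: congr1; apply/seteqP; split => x.
    by move=> [z _ [N KN <-]]; exists N; [exact: KN|exact: esym (inv_risk D z 0 N iD KN)].
  by move=> [N KN <-]; exists 0; [exact: I|exists N].
(* One D' serves the minimax bound and every Pi at once, because it depends on D alone and the
   functions f are chosen afterwards. *)
have better D : povms n A D -> exists2 D', invariant_povms n A D' &
    (ereal_sup [set risk L D' 0%R N | N in K] <=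
      ereal_sup [set risk L D z N | z in [set: R[i]] & N in K])%E /\
    forall Pi : probability (measurableTypeR R) R,
      (\int[Pi]_(N in K) risk L D' 0%R N <=
       ereal_sup [set (\int[Pi]_(N in K) risk L D z N)%E | z in [set: R[i]]])%E.
  move=> pD; have [D' [pD' iD' D'D]] := ex_better_invariant_povm A_compact pD.
  exists D'; first by split.
  split => [|Pi].
    apply: ge_ereal_sup => _ [N KN <-].
    set S := ereal_sup _; pose f k := weighted_loss n L k N.
    apply: (eq_ind_r (fun x => x <= S)%E _ (iE D' 0 N pD' iD' KN)).
    apply: (D'D f S) => [k|k a|w].
    - exact: (weighted_loss_continuous K_gt0 K_compact L_continuous).
    - exact: (weighted_loss_ge0 n K_gt0 L_ge0 k a KN).
    - have e := risk_series K_gt0 K_compact L_ge0 L_continuous w pD KN.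
      apply: (eq_ind (risk L D w N) (fun x => x <= S)%E _ _ e).
      by apply: ereal_sup_ubound; exists w; [exact: I|exists N].
  set S := ereal_sup _; pose f k := mean_kernel K (weighted_loss n L k) Pi.
  apply: (eq_ind_r (fun x => x <= S)%E _ (miE D' 0 Pi pD' iD')).
  apply: (D'D f S) => [k|k a|w].
  - exact: (mean_loss_continuous K_gt0 K_compact L_ge0 LM L_continuous).
  - exact: (mean_loss_ge0 n K_gt0 L_ge0).
  - have e := mean_risk_series A_compact K_gt0 K_compact L_ge0 LM L_continuous w Pi pD.
    apply: (eq_ind (\int[Pi]_(N in K) risk L D w N)%E (fun x => x <= S)%E _ _ e).
    by apply: ereal_sup_ubound; exists w.
split.
- apply/eqP; rewrite eq_le; apply/andP; split.
    by apply: le_ereal_inf => _ [D [pD iD] <-]; exists D.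
  apply: le_ereal_inf_tmp => _ [D pD <-]; have [D' iD' [D'D _]] := better D pD.
  apply: le_trans D'D; rewrite -(inv_sup D' iD').
  by apply: ereal_inf_lbound; exists D'.
- apply: congr1; apply/seteqP; split => _ [D iD <-]; exists D; try exact: iD.
    exact: esym (inv_sup D iD).
  exact: inv_sup D iD.
- move=> Pi _; apply/eqP; rewrite eq_le; apply/andP; split.
    apply: le_ereal_inf_tmp => _ [D [pD iD] <-].
    apply: (@le_trans _ _ (ereal_sup [set (\int[Pi]_(N in K) risk L D z N)%E | z in [set: R[i]]])).
      by apply: ereal_inf_lbound; exists D.
    (* For an invariant D the averaged risk is constant in z, so the supremum is the value at 0. *)
    apply: ge_ereal_sup => _ [z _ <-].
    apply: (eq_ind_r (fun x => x <= _)%E _ (inv_mean D z 0 Pi (conj pD iD))).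
    exact: lexx.
  apply: le_ereal_inf_tmp => _ [D pD <-]; have [D' iD' [_ D'D]] := better D pD.
  by apply: le_trans (D'D Pi); apply: ereal_inf_lbound; exists D'.
Qed.
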